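(* Let $\lambda_1,\dots,\lambda_N$ be distinct points of $\mathbb G$ and $w_1,\dots,w_N\in\mathbb D$, and suppose that the Pick problem $\lambda_j\mapsto w_j$ $(1\le j\le N)$ in $\mathbb G$ is solvable. Then it has a rational solution. Moreover, the rational solution can be obtained so that it is unimodular almost everywhere (with respect to the Lebesgue measure) on the symmetrized torus $b\mathbb G=\{(z_1+z_2,z_1z_2):z_1,z_2\in\mathbb T\}$.
   Context: $\mathbb D$ is the open unit disk in $\mathbb C$ and $\mathbb T$ is the unit circle. The symmetrized bidisk is $\mathbb G=\{(z_1+z_2,z_1z_2):z_1,z_2\in\mathbb D\}\subset\mathbb C^2$. A Pick problem in $\mathbb G$ with data $\{(\lambda_j,w_j):1\le j\le N\}$ (distinct $\lambda_j\in\mathbb G$, $w_j\in\mathbb D$) is solvable if there is an analytic function $f:\mathbb G\to\mathbb D$ with $f(\lambda_j)=w_j$ for all $j$; such an $f$ is called a solution or an interpolant. Boundary values on $b\mathbb G$ of a bounded analytic function $f$ on $\mathbb G$ are the radial limits $\lim_{r\to1-}f(r\zeta+r\eta,r^2\zeta\eta)$, which exist for almost every $(\zeta,\eta)\in\mathbb T^2$. *)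

(* Defs.v *)
From mathcomp Require Import all_boot all_order all_algebra.
From mathcomp Require Import complex.
From mathcomp Require Import all_classical all_reals all_analysis.

Set Implicit Arguments.
Unset Strict Implicit.
Unset Printing Implicit Defensive.

Import Order.TTheory GRing.Theory Num.Theory.
Import numFieldNormedType.Exports.

Local Open Scope classical_set_scope.
Local Open Scope complex_scope.
Local Open Scope ring_scope.

(* The regular-module alias [^o] is what carries the norm topology of [R[i]]. *)
Notation cplx R := (R[i]^o).
Notation cplx2 R := ((R[i]^o * R[i]^o)%type).

(* The norm takes values in [R[i]]; the order of [R[i]] compares real parts
   of numbers with equal imaginary parts, so this is the usual [|z| < 1]. *)
Definition disk (R : realType) : set (cplx R) := [set z | `|z| < 1].

Definition symmetrize (R : realType) (z : cplx2 R) : cplx2 R :=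
  (z.1 + z.2, z.1 * z.2).

Definition symm_bidisk (R : realType) : set (cplx2 R) :=
  @symmetrize R @` (@disk R `*` @disk R).

(* The scalar field of [cplx2 R] is [R[i]], so this is complex Frechet
   differentiability; on an open [D] it means that [f] is holomorphic. *)
Definition analytic_on (R : realType) (D : set (cplx2 R))
    (f : cplx2 R -> cplx R) : Prop :=
  forall z, D z -> differentiable f z.

Definition interpolant (R : realType) (N : nat)
    (lam : 'I_N -> cplx2 R) (w : 'I_N -> cplx R) (f : cplx2 R -> cplx R) :
    Prop :=
  [/\ analytic_on (@symm_bidisk R) f,
      (forall z, symm_bidisk z -> disk (f z)) &
      (forall j, f (lam j) = w j)].

Definition solvable (R : realType) (N : nat)
    (lam : 'I_N -> cplx2 R) (w : 'I_N -> cplx R) : Prop :=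
  exists f, interpolant lam w f.

Definition rational_on (R : realType) (D : set (cplx2 R))
    (f : cplx2 R -> cplx R) : Prop :=
  exists p q : {poly {poly R[i]}}, forall z : cplx2 R, D z ->
    q.[z.1, z.2] != 0 /\ f z = p.[z.1, z.2] / q.[z.1, z.2].

Definition expi (R : realType) (t : R) : cplx R := cos t +i* sin t.

(* For [b = (zeta + eta, zeta * eta)] the argument of [f] is
   [(r zeta + r eta, r^2 zeta eta)]. *)
Definition radial_limit (R : realType) (f : cplx2 R -> cplx R)
    (b : cplx2 R) (l : cplx R) : Prop :=
  f (r%:C * b.1, r%:C ^+ 2 * b.2) @[r --> (1 : R)^'-] --> l.

(* The null sets of the symmetrized torus are those of the image of the
   Lebesgue measure of the torus, which is parametrized by angles. *)
Definition ae_symm_torus (R : realType) (P : cplx2 R -> Prop) : Prop :=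
  {ae (@lebesgue_measure R \x @lebesgue_measure R)%E, forall t : R * R,
    (`[0, 2 * pi] `*` `[0, 2 * pi]) t -> P (symmetrize (expi t.1, expi t.2))}.

Definition unimodular_ae (R : realType) (f : cplx2 R -> cplx R) : Prop :=
  ae_symm_torus (fun b => exists2 l, radial_limit f b l & `|l| = 1).

(* Main.v *)
(** The solution [f0] pulls back to [F (z, w) = f0 (z + w, z w)] on the bidisk.
    At finitely many points of the bidisk, [F] satisfies von Neumann's inequality
    for pairs of commuting contractions with a common basis of eigenvectors: [F]
    is a limit of polynomials bounded by [1] on the torus (Cauchy's formula), and
    such a pair is compared with a pair of commuting unitary matrices built from
    a long cyclic shift. Separating from a closed convex cone, as Agler does,
    one gets positive semidefinite kernels with
    [1 - F F^* = (1 - z z^* ) K1 + (1 - w w^* ) K2] on the nodes and on their images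
    under the exchange of coordinates, and by averaging [K2] is the flip of [K1].
    Writing the kernels as Gram matrices of vectors [x], [y] and comparing the
    Gram matrices of the symmetric and of the antisymmetric parts separately
    yields unitary matrices [tau] and [U = [A, B; K, D]] for which
      [f (s, p) = A + g (s - 2 p tau) K],
      [g (2 - s (tau + D) + 2 p tau D) = B]
    is a rational interpolant. With [s = z + w] and [p = z w],
      [1 - |f|^2 = 2 (1 - |z|^2) |g - w g tau|^2 + 2 (1 - |w|^2) |g - z g tau|^2],
    so [|f| < 1] on the symmetrized bidisk and [|f| = 1] at the points of the
    symmetrized torus where the determinant of the pencil does not vanish; by
    Fubini almost every point is such. *)

Require Import Defs.
From HB Require Import structures.
From mathcomp Require Import all_boot all_order all_algebra all_fingroup.
From mathcomp Require Import all_field complex polyXY ring lra zify.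
From mathcomp Require Import all_classical all_reals all_analysis.
From mathcomp Require Import measurable_realfun.

Set Implicit Arguments.
Unset Strict Implicit.
Unset Printing Implicit Defensive.

Import Order.TTheory GRing.Theory Num.Theory Normc.
Import numFieldNormedType.Exports.

Local Open Scope classical_set_scope.
Local Open Scope sesquilinear_scope.
Local Open Scope ring_scope.

(** * Unitary matrices and Gram matrices *)

(** A single state [g] suffices because [(z x - w y) tau = x - y] is solved by [x = g - w g tau],
    [y = g - z g tau]: then [z x + w y = g (s - 2 p tau)] and [x + y = g (2 - s tau)], where only
    the symmetric functions [s] and [p] are left. This is the origin of the pencil and of its
    constants 2. Finitely many nodes make every Gram comparison finite dimensional, so [tau] and [U]
    are matrices and [f] is rational; their being unitary, not merely contractive, makes [f]
    unimodular on the torus. Separation needs von Neumann's inequality only for pairs that are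
    diagonal in a common, possibly oblique, basis. The usual dilation uses an infinite shift; a
    cyclic shift of length [M + 2 d] errs only in its last rows, and the error vanishes as [M] grows
    because the eigenvalues lie in the open disk. Strictness of [|f| < 1] is a separate matter:
    equality at one point makes [f] a unimodular constant, which any node excludes. *)

Section LinearAlgebra.
Variable C : numClosedFieldType.
Implicit Types m n : nat.

Lemma adjmxE m n (A : 'M[C]_(m, n)) i j : A^t* i j = (A j i)^*.
Proof. by rewrite !mxE. Qed.

Lemma adjmx_mul m n p (A : 'M[C]_(m, n)) (B : 'M[C]_(n, p)) :
  (A *m B)^t* = B^t* *m A^t*.
Proof. by rewrite trmx_mul map_mxM. Qed.

Lemma adjmxB m n (A B : 'M[C]_(m, n)) : (A - B)^t* = A^t* - B^t*.
Proof. by rewrite linearB map_mxB. Qed.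

Lemma adjmxZ m n a (A : 'M[C]_(m, n)) : (a *: A)^t* = a^* *: A^t*.
Proof. by rewrite linearZ map_mxZ. Qed.

Lemma adjmx1 n : (1%:M : 'M[C]_n)^t* = 1%:M.
Proof. by rewrite trmx1 map_mx1. Qed.

Lemma gramE m n p (A : 'M[C]_(m, n)) (B : 'M[C]_(p, n)) i j :
  (A *m B^t*) i j = \sum_l A i l * (B j l)^*.
Proof. by rewrite mxE; apply: eq_bigr => l _; rewrite adjmxE. Qed.

Lemma gram_row m n p (A : 'M[C]_(m, n)) (B : 'M[C]_(p, n)) i j :
  (row i A *m (row j B)^t*) 0 0 = (A *m B^t*) i j.
Proof. by rewrite !gramE; apply: eq_bigr => l _; rewrite !mxE. Qed.

(* The witness is the generalized Householder reflection
   [1 - k^-1 (a - b)^* (a - b)], where [k = <a, a - b>] satisfies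
   [k + k^* = |a - b|^2]. *)
Lemma householder n (a b : 'rV[C]_n) :
  a *m a^t* = b *m b^t* ->
  exists2 U, U \is unitarymx &
    a *m U = b /\ forall c : 'rV_n, c *m (a - b)^t* = 0 -> c *m U = c.
Proof.
move=> ab; move ev : (a - b) => v; set k := (a *m v^t*) 0 0.
have ek : a *m v^t* = k%:M by rewrite {1}[a *m _]mx11_scalar.
have ekb : b *m v^t* = (- k^*)%:M.
  have -> : b *m v^t* = - (a *m v^t*)^t*.
    rewrite adjmx_mul trmxCK -ev mulmxBl ab adjmxB mulmxBr /=.
    by rewrite opprB.
  by apply/matrixP => i j; rewrite ek !mxE rmorphMn /= mulNrn eq_sym.
have vv : v *m v^t* = (k + k^*)%:M.
  by rewrite -{1}ev mulmxBl ek ekb -raddfB /= opprK.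
have [k0|k0] := eqVneq k 0.
  exists 1%:M; first by apply/unitarymxP; rewrite adjmx1 mulmx1.
  split=> [|c _]; last by rewrite mulmx1.
  have : v = 0.
    apply/eqP; apply: contraT => /dotmx_is_dotmx.
    by rewrite dotmxE vv k0 rmorph0 addr0 mxE mul0rn ltxx.
  by move/eqP; rewrite -ev subr_eq0 mulmx1 => /eqP.
have kc0 : k^* != 0 by rewrite conjC_eq0.
exists (1%:M - k^-1 *: (v^t* *m v)).
  apply/unitarymxP; move eV : (v^t* *m v) => V.
  have Vh : V^t* = V by rewrite -eV adjmx_mul trmxCK.
  have VV : V *m V = (k + k^*) *: V.
    by rewrite -eV mulmxA -[X in X *m _]mulmxA vv mul_mx_scalar scalemxAl.
  rewrite adjmxB adjmx1 adjmxZ Vh mulmxBl mul1mx mulmxBr mulmx1 fmorphV.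
  rewrite -scalemxAl -scalemxAr VV -addrA -opprD -[RHS]subr0; congr (_ - _).
  rewrite !scalerA -scalerBl -scalerDl.
  rewrite [X in X *: _](_ : _ = 0) ?scale0r //.
  by field; apply/andP.
split=> [|c cv]; rewrite mulmxBr mulmx1 -scalemxAr mulmxA ?cv ?mul0mx ?scaler0
  ?subr0 //.
by rewrite ek mul_scalar_mx scalerA mulVf // scale1r -ev opprB addrC subrK.
Qed.

(** Induction on the rows: once [U] matches all rows but the first, a Householder reflection moves
    the image of the first row to its target. It fixes the rows already in place, since equality of
    the Gram matrices makes them orthogonal to the difference. *)
Lemma unitary_extension m n (A B : 'M[C]_(n, m)) :
  A *m A^t* = B *m B^t* -> exists2 U, U \is unitarymx & A *m U = B.
Proof.
elim: n => [|n IHn] in A B *.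
  move=> _; exists 1%:M; last by rewrite !flatmx0.
  by apply/unitarymxP; rewrite adjmx1 mulmx1.
move=> AB.
pose A1 := \matrix_(i < n) row (lift ord0 i) A.
pose B1 := \matrix_(i < n) row (lift ord0 i) B.
have [|U Uu A1U] := IHn A1 B1.
  apply/matrixP => i j; rewrite -[LHS]gram_row -[RHS]gram_row !rowK.
  by rewrite !gram_row AB.
have UU : U *m U^t* = 1%:M by apply/unitarymxP.
have [|V Vu [AV VB]] := householder (a := row ord0 A *m U) (b := row ord0 B).
  rewrite adjmx_mul -mulmxA [U *m _]mulmxA UU mul1mx.
  by rewrite [LHS]mx11_scalar [RHS]mx11_scalar !gram_row AB.
exists (U *m V); first exact: mul_unitarymx.
apply/row_matrixP => i; rewrite row_mul mulmxA.
case: (unliftP ord0 i) => [j ->|->] //.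
have Bj : row (lift ord0 j) B = row (lift ord0 j) A *m U.
  by move/row_matrixP: A1U => /(_ j); rewrite row_mul !rowK.
rewrite -Bj VB // adjmxB mulmxBr {1}Bj adjmx_mul -mulmxA.
rewrite [U *m _]mulmxA UU mul1mx [X in X - _]mx11_scalar [X in _ - X]mx11_scalar.
by rewrite !gram_row AB subrr.
Qed.

Lemma psd_factor n (K : 'M[C]_n) : K^t* = K ->
  (forall v : 'rV_n, 0 <= (v *m K *m v^t*) 0 0) -> exists X : 'M[C]_n,
    K = X *m X^t*.
Proof.
move=> Kh Kpos.
have /orthomx_spectralP : K \is normalmx by apply/normalmxP; rewrite Kh.
set P := spectralmx K; set s := spectral_diag K => eK.
have Pu : P \is unitarymx := spectral_unitarymx K.
have PP : P *m P^t* = 1%:M by apply/unitarymxP.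
rewrite invmx_unitary // in eK.
have s_ge0 i : 0 <= s 0 i.
  (* Evaluated at a row of [P], an eigenvector, the form gives the eigenvalue. *)
  have := Kpos (row i P); rewrite -row_mul gram_row eK !mulmxA PP mul1mx.
  by rewrite -mulmxA PP mulmx1 mxE eqxx mulr1n.
exists (P^t* *m diag_mx (\row_i sqrtC (s 0 i))).
rewrite adjmx_mul trmxCK {1}eK !mulmxA; congr (_ *m _); rewrite -!mulmxA.
congr (_ *m _); rewrite tr_diag_mx map_diag_mx mulmx_diag.
congr diag_mx; apply/rowP => i; rewrite !mxE /= geC0_conj ?sqrtC_ge0 //.
by rewrite -expr2 sqrtCK.
Qed.

End LinearAlgebra.

(** * Von Neumann's inequality at finitely many points *)

Section VonNeumann.
Variable C : numClosedFieldType.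
Implicit Types m n : nat.

Lemma unitary_diag n (U : 'M[C]_n) : U \is unitarymx ->
  exists Q : 'M[C]_n, exists z : 'rV[C]_n,
    [/\ Q \is unitarymx, forall l, `|z 0 l| = 1 & U = Q^t* *m diag_mx z *m Q].
Proof.
move=> Uu; have UU : U *m U^t* = 1%:M by apply/unitarymxP.
have /orthomx_spectralP : U \is normalmx.
  by apply/normalmxP; rewrite UU (mulmx1C UU).
set Q := spectralmx U; set z := spectral_diag U => eU.
have Qu : Q \is unitarymx := spectral_unitarymx U.
rewrite invmx_unitary // in eU.
exists Q, z; split=> // l.
have eD : diag_mx z = Q *m U *m Q^t*.
  by rewrite eU !mulmxA (unitarymxP Qu) mul1mx mulmxtVK.
have /unitarymxP/matrixP/(_ l l) : diag_mx z \is unitarymx.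
  by rewrite eD !mul_unitarymx ?trmxC_unitary.
rewrite tr_diag_mx map_diag_mx mulmx_diag !mxE eqxx !mulr1n -normCK => /eqP.
by rewrite sqrp_eq1 // => /eqP.
Qed.

(** The squared Frobenius norm. *)
Definition sqnorm m n (X : 'M[C]_(m, n)) := \sum_i \sum_j `|X i j| ^+ 2.

Lemma sqnormE m n (X : 'M[C]_(m, n)) : sqnorm X = \tr (X *m X^t*).
Proof.
by apply: eq_bigr => i _; rewrite gramE; apply: eq_bigr => j _; rewrite normCK.
Qed.

Lemma sqnorm_unitaryl m n (U : 'M[C]_m) (X : 'M[C]_(m, n)) :
  U \is unitarymx -> sqnorm (U *m X) = sqnorm X.
Proof.
move=> Uu; rewrite !sqnormE adjmx_mul mulmxA mxtrace_mulC !mulmxA.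
by rewrite (mulmx1C (unitarymxP Uu)) mul1mx.
Qed.

Lemma sqnorm_unitaryr m n (U : 'M[C]_n) (X : 'M[C]_(m, n)) :
  U \is unitarymx -> sqnorm (X *m U) = sqnorm X.
Proof. by move=> Uu; rewrite !sqnormE adjmx_mul mulmxA mulmxtVK. Qed.

Lemma sqnorm_rows m n (X : 'M[C]_(m, n)) : sqnorm X = \sum_i sqnorm (row i X).
Proof.
apply: eq_bigr => i _; rewrite /sqnorm big_ord1.
by apply: eq_bigr => j _; rewrite mxE.
Qed.

Section Shift.
Variables (m n1 n2 : nat) (S : 'M[C]_m) (G : 'M[C]_(n1 + n2)).
Hypotheses (Su : S \is unitarymx) (Gu : G \is unitarymx).

(* Berger-Coburn-Lebow model: on an eigenvector of [S] with eigenvalue [t],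
   [shift1] and [shift2] act by the right multiplications by the unitary matrices
   [(t E + E') G^*] and [G (E + t E')], where [E] and [E'] are the projections
   on the two blocks; these commute and have product [t]. *)
Definition shift1 (X : 'M[C]_(m, n1 + n2)) : 'M[C]_(m, n1 + n2) :=
  row_mx (S *m lsubmx X) (rsubmx X) *m G^t*.

Definition shift2 (X : 'M[C]_(m, n1 + n2)) : 'M[C]_(m, n1 + n2) :=
  row_mx (lsubmx (X *m G)) (S *m rsubmx (X *m G)).

(** Diagonalizing [S] reduces the shifts to right multiplications by [F1 i] and [F2 i] on the rows
    of [P *m X]. As [F2 i] is the scalar [d 0 i] times the adjoint of [F1 i], one unitary basis
    [Qz i] diagonalizes both; [T] passes to these bases. *)
Lemma shift_diag : exists T : 'M[C]_(m, n1 + n2) -> 'M[C]_(m, n1 + n2),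
  exists z w : 'I_m -> 'I_(n1 + n2) -> C,
  [/\ linear T, forall X, sqnorm (T X) = sqnorm X,
      forall i l, `|z i l| = 1 /\ `|w i l| = 1,
      forall X i l, T (shift1 X) i l = z i l * T X i l &
      forall X i l, T (shift2 X) i l = w i l * T X i l].
Proof.
have [P [d [Pu d1 eS]]] := unitary_diag Su.
have PS : P *m S = diag_mx d *m P by rewrite eS !mulmxA (unitarymxP Pu) mul1mx.
pose F1 i := block_mx (d 0 i)%:M 0 0 1%:M *m G^t*.
pose F2 i := G *m block_mx 1%:M 0 0 (d 0 i)%:M.
have dd i : d 0 i * (d 0 i)^* = 1 by rewrite -normCK d1 expr1n.
have adjs k (a : C) : (a%:M : 'M[C]_k)^t* = (a^*)%:M.
  by rewrite tr_scalar_mx map_scalar_mx.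
have F1u i : F1 i \is unitarymx.
  rewrite mul_unitarymx ?trmxC_unitary //; apply/unitarymxP.
  rewrite tr_block_mx map_block_mx mulmx_block !adjs !trmx0 !map_mx0.
  rewrite !mulmx0 !mul0mx ?add0r ?addr0 conjC1 mulmx1 -scalar_mxM dd.
  by rewrite -scalar_mx_block.
have [Qz Qzs] := fin_all_exists (fun i => unitary_diag (F1u i)).
have [zz zzs] := fin_all_exists Qzs.
have F2E i : F2 i = d 0 i *: (F1 i)^t*.
  rewrite /F1 adjmx_mul trmxCK /F2 scalemxAr; congr (_ *m _).
  rewrite tr_block_mx map_block_mx !adjs !trmx0 !map_mx0 scale_block_mx.
  by rewrite !scaler0 !scale_scalar_mx dd conjC1 mulr1.
pose T X : 'M[C]_(m, n1 + n2) := \matrix_i (row i (P *m X) *m (Qz i)^t*).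
have TE X i l : T X i l = (row i (P *m X) *m (Qz i)^t*) 0 l.
  by rewrite [LHS]mxE.
exists T, (fun i l => zz i 0 l), (fun i l => d 0 i * (zz i 0 l)^*); split.
- move=> a X Y; apply/row_matrixP => i; rewrite linearD linearZ /= !rowK.
  by rewrite mulmxDr -scalemxAr linearD linearZ /= mulmxDl scalemxAl.
- move=> X; rewrite sqnorm_rows -(sqnorm_unitaryl X Pu) [RHS]sqnorm_rows.
  apply: eq_bigr => i _; rewrite rowK sqnorm_unitaryr ?trmxC_unitary //.
  by have [] := zzs i.
- move=> i l; have [_ z1 _] := zzs i.
  by rewrite normrM norm_conjC z1 d1 mulr1.
- move=> X i l; rewrite !TE.
  have -> : row i (P *m shift1 X) = row i (P *m X) *m F1 i.
    rewrite /shift1 mulmxA mul_mx_row mulmxA PS row_mul /F1 mulmxA.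
    congr (_ *m _); rewrite -{3}[X]hsubmxK mul_mx_row !row_row_mx.
    rewrite mul_row_block !mulmx0 addr0 add0r mulmx1 -mulmxA row_mul.
    by rewrite row_diag_mx -scalemxAl -rowE mul_mx_scalar.
  have [Qu z1 eF] := zzs i.
  rewrite eF -!mulmxA (unitarymxP Qu) mulmx1 mulmxA.
  by rewrite mul_mx_diag mxE mulrC.
- move=> X i l; rewrite !TE.
  have -> : row i (P *m shift2 X) = row i (P *m X) *m F2 i.
    rewrite /shift2 mul_mx_row mulmxA PS /F2 mulmxA -row_mul.
    rewrite -[P *m X *m G]mulmxA; move: (X *m G) => Z.
    rewrite -{3}[Z]hsubmxK mul_mx_row !row_row_mx.
    rewrite mul_row_block !mulmx0 addr0 add0r mulmx1 -mulmxA [X in row_mx _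
      X]row_mul.
    by rewrite row_diag_mx -scalemxAl -rowE mul_mx_scalar.
  have [Qu z1 eF] := zzs i.
  rewrite F2E eF !adjmx_mul trmxCK -scalemxAr -scalemxAl mxE -!mulmxA.
  rewrite (unitarymxP Qu) mulmx1 mulmxA tr_diag_mx map_diag_mx mul_mx_diag !mxE.
  by rewrite mulrCA mulrA [X in X * _]mulrC [RHS]mulrAC.
Qed.

Definition shift_poly d (c : nat -> nat -> C) (X : 'M[C]_(m, n1 + n2)) :=
  \sum_(i < d) \sum_(j < d) c i j *: iter i shift1 (iter j shift2 X).

(** In the coordinates of [shift_diag] the polynomial multiplies each entry by its value at a point
    of the torus. *)
Lemma shift_poly_contractive d (c : nat -> nat -> C) X :
  (forall z w : C, `|z| = 1 -> `|w| = 1 ->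
     `|\sum_(i < d) \sum_(j < d) c i j * z ^+ i * w ^+ j| <= 1) ->
  sqnorm (shift_poly d c X) <= sqnorm X.
Proof.
move=> c1; have [T [z [w [Tlin Tn zw1 T1 T2]]]] := shift_diag.
pose TL : {linear 'M[C]_(m, n1 + n2) -> 'M[C]_(m, n1 + n2)} :=
  HB.pack T (GRing.isLinear.Build _ _ _ _ T Tlin).
rewrite -Tn -(Tn X); apply: ler_sum => k _; apply: ler_sum => l _.
have -> : T (shift_poly d c X) k l =
    (\sum_(i < d) \sum_(j < d) c i j * z k l ^+ i * w k l ^+ j) * T X k l.
  rewrite -[T _]/(TL _) linear_sum summxE mulr_suml; apply: eq_bigr => i _.
  rewrite linear_sum summxE mulr_suml; apply: eq_bigr => j _.
  rewrite linearZ mxE -!mulrA; congr (_ * _).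
  elim: (nat_of_ord i) => [|p IH] /=.
    rewrite mul1r; elim: (nat_of_ord j) => [|p IH] /=; first by rewrite mul1r.
    by rewrite T2 IH exprS mulrA.
  by rewrite T1 IH exprS -!mulrA.
rewrite normrM exprMn ler_piMl ?exprn_ge0 // exprn_ile1 //.
by have [zk wk] := zw1 k l; exact: c1.
Qed.

End Shift.
End VonNeumann.

(** * Contractions with prescribed joint eigenvalues *)

Section NodeVonNeumann.
Variable C : numClosedFieldType.

Lemma perm_mx_unitary n (s : 'S_n) : (perm_mx s : 'M[C]_n) \is unitarymx.
Proof.
by apply/unitarymxP; rewrite tr_perm_mx map_perm_mx -perm_mxM mulgV perm_mx1.
Qed.

Variables (n : nat) (a b : 'rV[C]_n) (L : 'M[C]_n) (D E : 'M[C]_n).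
(** If [L] is read as the Gram matrix of joint eigenvectors, [LD] and [LE] say that the operators
    with eigenvalues [a] and [b] are contractions, [D] and [E] standing for their defect
    operators. *)
Hypothesis LD : forall j k, L j k * (1 - a 0 j * (a 0 k)^*) = (D *m D^t*) j k.
Hypothesis LE : forall j k, L j k * (1 - b 0 j * (b 0 k)^*) = (E *m E^t*) j k.

Let t j := a 0 j * b 0 j.
Let Y := row_mx D (diag_mx a *m E).
Let Y' := row_mx (diag_mx b *m D) E.

Lemma diag_gram (x : 'rV[C]_n) (K : 'M[C]_n) j k :
  ((diag_mx x *m K) *m (diag_mx x *m K)^t*) j k =
  x 0 j * (x 0 k)^* * (K *m K^t*) j k.
Proof.
rewrite !gramE mulr_sumr; apply: eq_bigr => l _.
by rewrite !mul_diag_mx !mxE rmorphM /= mulrACA.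
Qed.

(** [1 - t t^* = (1 - a a^* ) + a a^* (1 - b b^* )], and likewise with [a] and [b] exchanged: the
    defect of the product splits in two ways. [Y] and [Y'] record the two splittings, so some
    unitary matrix carries one to the other. *)
Lemma gramY j k : (Y *m Y^t*) j k = L j k * (1 - t j * (t k)^*).
Proof.
rewrite tr_row_mx map_col_mx mul_row_col mxE diag_gram -LD -LE /t rmorphM /=.
ring.
Qed.

Lemma gramY' j k : (Y' *m Y'^t*) j k = L j k * (1 - t j * (t k)^*).
Proof.
rewrite tr_row_mx map_col_mx mul_row_col mxE diag_gram -LD -LE /t rmorphM /=.
ring.
Qed.

Lemma sqnorm_row_gram m (v : 'rV[C]_n) (Z : 'M[C]_(n, m)) :
  sqnorm (v *m Z) = \sum_j \sum_k v 0 j * (v 0 k)^* * (Z *m Z^t*) j k.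
Proof.
rewrite sqnormE adjmx_mul mulmxA -[v *m Z *m _]mulmxA; move: (Z *m _) => K.
rewrite trace_mx11 mxE exchange_big; apply: eq_bigr => k _.
rewrite mxE mulr_suml; apply: eq_bigr => j _; rewrite !mxE /=; ring.
Qed.

Definition vrow (m : nat) : 'rV[C]_n := \row_j t j ^+ m.

Lemma vrowS m : vrow m.+1 = vrow m *m diag_mx (\row_j t j).
Proof. by apply/rowP => j; rewrite mul_mx_diag !mxE exprSr. Qed.

Section Agree.
Variables (M : nat) (G : 'M[C]_(n + n)).
Hypotheses (Gu : G \is unitarymx) (YG : Y *m G = Y').

Let S : 'M[C]_M := perm_mx (perm (@ordS_inj M)).

Let rowS p (X : 'M[C]_(M, p)) i : row i (S *m X) = row (ordS i) X.
Proof. by rewrite -row_permE; apply/rowP => j; rewrite !mxE permE. Qed.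

(* Since the cyclic shift wraps around only in the last row, the matrix with
   rows [t_j ^ i Y_j], [i < M], is up to its last rows a joint eigenvector of
   [shift1] and [shift2], with eigenvalues [a_j] and [b_j]. *)
Definition agree k (w : 'rV[C]_n) (X : 'M[C]_(M, n + n)) :=
  forall i : 'I_M, (i < k)%N -> row i X = vrow i *m diag_mx w *m Y.

Let dmul (x y : 'rV[C]_n) : 'rV[C]_n := \row_j (x 0 j * y 0 j).

Let dmulE x y : diag_mx (dmul x y) = diag_mx x *m diag_mx y.
Proof. by rewrite mulmx_diag; congr diag_mx; apply/rowP => j; rewrite !mxE. Qed.

Let diag_t : diag_mx (\row_j t j) = diag_mx a *m diag_mx b.
Proof. by rewrite -dmulE; congr diag_mx; apply/rowP => j; rewrite !mxE. Qed.

Let row_l (X : 'M[C]_(M, n + n)) i : row i (lsubmx X) = lsubmx (row i X).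
Proof. by apply/rowP => j; rewrite !mxE. Qed.

Let row_r (X : 'M[C]_(M, n + n)) i : row i (rsubmx X) = rsubmx (row i X).
Proof. by apply/rowP => j; rewrite !mxE. Qed.

(** One row is lost because row [i] of the shifted block is read off row [i + 1], which brings in a
    factor [t = a b]. *)
Lemma agree_shift1 k w X : (k < M)%N ->
  agree k.+1 w X -> agree k (dmul a w) (shift1 S G X).
Proof.
move=> kM Xk i ik; have iS : (i.+1 < M)%N by rewrite (leq_ltn_trans ik).
rewrite row_mul row_row_mx rowS row_l row_r !Xk /= ?modn_small ?ltnS ?(ltnW ik) //.
rewrite vrowS !mul_mx_row row_mxKl row_mxKr.
(* The left block is [t w D = (a w) (b D)], the right one [w (a E) = (a w) E]: together [a w] times
   [Y'], which [G^*] turns into [Y]. *)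
have -> : row_mx (vrow i *m diag_mx (\row_j t j) *m diag_mx w *m D)
    (vrow i *m diag_mx w *m (diag_mx a *m E)) =
    vrow i *m diag_mx (dmul a w) *m Y'.
  rewrite /Y' mul_mx_row dmulE diag_t !mulmxA. congr row_mx; congr (_ *m _).
    by rewrite -!mulmxA; congr (_ *m _); rewrite [in LHS]diag_mxC.
  by rewrite -!mulmxA; congr (_ *m _); rewrite diag_mxC.
by rewrite -YG mulmxA mulmxtVK // -mul_mx_row.
Qed.

Lemma agree_shift2 k w X : (k < M)%N ->
  agree k.+1 w X -> agree k (dmul b w) (shift2 S G X).
Proof.
move=> kM Xk i ik; have iS : (i.+1 < M)%N by rewrite (leq_ltn_trans ik).
rewrite row_row_mx rowS row_l row_r !row_mul !Xk /= ?modn_small ?ltnS ?(ltnW ik) //.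
rewrite -!mulmxA YG !mulmxA vrowS !mul_mx_row row_mxKl row_mxKr dmulE diag_t.
congr row_mx; rewrite -!mulmxA; congr (_ *m _).
  by rewrite !mulmxA diag_mxC.
rewrite !mulmxA; congr (_ *m _); rewrite -[RHS]mulmxA [diag_mx w *m _]diag_mxC.
by rewrite mulmxA [diag_mx b *m _]diag_mxC.
Qed.

End Agree.

(** The rows [sum_j t_j^i Y_j] of [X] form a sum of approximate joint eigenvectors, so in the first
    [M] rows the polynomial multiplies the [j]-th summand by [p j]; contractivity compares these
    rows with all of [X]. Both squared norms are geometric sums, which cancel the factor [1 - t t^*]
    of [gramY]. *)
Lemma truncated_von_neumann d (c : nat -> nat -> C) (p : 'I_n -> C) M :
  (forall z w : C, `|z| = 1 -> `|w| = 1 ->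
     `|\sum_(i < d) \sum_(j < d) c i j * z ^+ i * w ^+ j| <= 1) ->
  (forall k, p k = \sum_(i < d) \sum_(j < d) c i j * a 0 k ^+ i * b 0 k ^+ j) ->
  \sum_j \sum_k L j k * p j * (p k)^* * (1 - (t j * (t k)^*) ^+ M) <=
  \sum_j \sum_k L j k * (1 - (t j * (t k)^*) ^+ (M + d.*2)).
Proof.
move=> c1 pE.
have [|G Gu YG] := @unitary_extension C (n + n) n Y Y'.
  by apply/matrixP => j k; rewrite gramY gramY'.
(* A monomial applies fewer than [d] shifts of each kind and each costs one row, so at least [M]
   rows survive. *)
set M' := (M + d.*2)%N.
pose S : 'M[C]_M' := perm_mx (perm (@ordS_inj M')).
have Su : S \is unitarymx := perm_mx_unitary _.
have geo (j k : 'I_n) q : \sum_(m < q) vrow m 0 j * (vrow m 0 k)^* * (L j k *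
  (1 - t j * (t k)^*))
    = L j k * (1 - (t j * (t k)^*) ^+ q).
  rewrite -mulr_suml mulrCA; congr (_ * _).
  rewrite -[RHS]opprB subrX1 -[RHS]mulNr opprB [RHS]mulrC; congr (_ * _).
  by apply: eq_bigr => m _; rewrite !mxE [RHS]exprMn; congr (_ * _);
    rewrite rmorphXn.
pose X : 'M[C]_(M', n + n) := \matrix_(i < M') (vrow i *m Y).
have X0 : agree M' (const_mx 1) X.
  by move=> i _; rewrite rowK diag_const_mx mulmx1.
have -> : \sum_j \sum_k L j k * (1 - (t j * (t k)^*) ^+ M') = sqnorm X.
  rewrite sqnorm_rows; under [RHS]eq_bigr => i _ do rewrite rowK sqnorm_row_gram.
  rewrite [RHS]exchange_big; apply: eq_bigr => j _.
  rewrite [RHS]exchange_big; apply: eq_bigr => k _.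
  by rewrite -geo; apply: eq_bigr => m _; rewrite gramY.
apply: le_trans (shift_poly_contractive Su Gu X c1).
have agj q : (q <= d)%N ->
  agree (M' - q) (\row_k b 0 k ^+ q) (iter q (shift2 S G) X).
  elim: q => [_|q IH qd].
    by rewrite subn0 (_ : \row_k _ = const_mx 1) //; apply/rowP => k; rewrite !mxE.
  have qM : (q < M')%N by rewrite /M'; lia.
  rewrite (_ : \row_k _ = \row_k (b 0 k * (\row_l b 0 l ^+ q) 0 k)); last first.
    by apply/rowP => k; rewrite !mxE exprS.
  apply: agree_shift2 => //; first by lia.
  by rewrite subnSK //; apply: IH; exact: ltnW.
have agij q j : (q <= d)%N -> (j <= d)%N ->
    agree (M' - j - q) (\row_k (a 0 k ^+ q * b 0 k ^+ j))
    (iter q (shift1 S G) (iter j (shift2 S G) X)).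
  move=> + jd; elim: q => [_|q IH qd].
    rewrite subn0 (_ : \row_k _ = \row_k b 0 k ^+ j); first exact: agj.
    by apply/rowP => k; rewrite !mxE mul1r.
  have qM : (q < M' - j)%N by rewrite /M'; lia.
  rewrite (_ : \row_k _ = \row_k (a 0 k * (\row_l (a 0 l ^+ q * b 0 l ^+ j)) 0 k)).
    apply: agree_shift1 => //; first by lia.
    by rewrite subnSK //; apply: IH; exact: ltnW.
  by apply/rowP => k; rewrite !mxE exprS mulrA.
have rowX (m : 'I_M) : row (lshift d.*2 m) (shift_poly S G d c X) =
    vrow m *m diag_mx (\row_k p k) *m Y.
  have -> : diag_mx (\row_k p k) = \sum_(i < d) \sum_(j < d)
      c i j *: diag_mx (\row_k (a 0 k ^+ i * b 0 k ^+ j)).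
    under eq_bigr => i _ do under eq_bigr => j _ do rewrite -linearZ.
    under eq_bigr => i _ do rewrite -linear_sum.
    rewrite -linear_sum; congr diag_mx; apply/rowP => k; rewrite mxE pE summxE.
    apply: eq_bigr => i _; rewrite summxE; apply: eq_bigr => j _.
    by rewrite !mxE mulrA.
  rewrite linear_sum mulmx_sumr mulmx_suml; apply: eq_bigr => i _.
  rewrite linear_sum mulmx_sumr mulmx_suml; apply: eq_bigr => j _.
  rewrite linearZ /= -scalemxAr -scalemxAl; congr (_ *: _).
  apply: (agij i j (ltnW (ltn_ord i)) (ltnW (ltn_ord j))) => /=.
  by move: (ltn_ord i) (ltn_ord j) (ltn_ord m); rewrite /M'; lia.
rewrite sqnorm_rows big_split_ord /=.
(* The last [2 d] rows, which the wrap-around may have spoilt, are discarded. *)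
apply: (@le_trans _ _ (\sum_(i < M) sqnorm (row (lshift d.*2 i)
  (shift_poly S G d c X)))); last first.
  rewrite lerDl sumr_ge0 // => i _; apply: sumr_ge0 => k _.
  by apply: sumr_ge0 => l _; rewrite exprn_ge0.
under [leRHS]eq_bigr => i _ do rewrite rowX sqnorm_row_gram.
rewrite [leRHS]exchange_big le_eqVlt (_ : _ == _) //; apply/eqP.
apply: eq_bigr => j _; rewrite [RHS]exchange_big; apply: eq_bigr => k _.
transitivity (p j * (p k)^* * (L j k * (1 - (t j * (t k)^*) ^+ M))).
  ring.
rewrite -geo mulr_sumr; apply: eq_bigr => m _; rewrite gramY.
by rewrite !mul_mx_diag !mxE rmorphM /=; ring.
Qed.

End NodeVonNeumann.

(** * Transfer functions on the symmetrized bidisk *)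

Section Sqnorm.
Variable C : numClosedFieldType.
Implicit Types m n : nat.

Lemma sqnorm_ge0 m n (X : 'M[C]_(m, n)) : 0 <= sqnorm X.
Proof. by rewrite !sumr_ge0 // => i _; rewrite sumr_ge0 // => j _;
  rewrite exprn_ge0. Qed.

Lemma sqnorm_eq0 m n (X : 'M[C]_(m, n)) : sqnorm X = 0 -> X = 0.
Proof.
move=> /eqP; rewrite psumr_eq0 => [/allP X0|i _]; last first.
  by rewrite sumr_ge0 // => j _; rewrite exprn_ge0.
apply/matrixP => i j; have := X0 i (mem_index_enum i).
rewrite psumr_eq0 => [/allP/(_ j (mem_index_enum j))|k _];
  last by rewrite exprn_ge0.
by rewrite expf_eq0 /= normr_eq0 mxE => /eqP.
Qed.

Lemma sqnormZ m n a (X : 'M[C]_(m, n)) : sqnorm (a *: X) = `|a| ^+ 2 * sqnorm X.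
Proof.
rewrite /sqnorm mulr_sumr; apply: eq_bigr => i _; rewrite mulr_sumr.
by apply: eq_bigr => j _; rewrite mxE normrM exprMn.
Qed.

Lemma sqnorm_row_mx m n1 n2 (X : 'M[C]_(m, n1)) (Y : 'M[C]_(m, n2)) :
  sqnorm (row_mx X Y) = sqnorm X + sqnorm Y.
Proof.
rewrite /sqnorm -big_split; apply: eq_bigr => i _; rewrite big_split_ord /=.
by congr (_ + _); apply: eq_bigr => j _; rewrite ?row_mxEl ?row_mxEr.
Qed.

Lemma sqnorm_parallelogram m n (X Y : 'M[C]_(m, n)) :
  sqnorm (X + Y) + sqnorm (X - Y) = 2 * (sqnorm X + sqnorm Y).
Proof.
rewrite /sqnorm -!big_split mulr_sumr; apply: eq_bigr => i _ /=.
rewrite -!big_split mulr_sumr; apply: eq_bigr => j _ /=.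
by rewrite !mxE !normCK !(rmorphD, rmorphN) /=; ring.
Qed.

Lemma sqnorm11 (X : 'M[C]_1) : sqnorm X = `|X 0 0| ^+ 2.
Proof. by rewrite /sqnorm !big_ord1. Qed.

End Sqnorm.

Section Realization.
Variables (C : numClosedFieldType) (m : nat) (tau : 'M[C]_m) (U : 'M[C]_(1 + m)).
Hypotheses (tauU : tau \is unitarymx) (UU : U \is unitarymx).
Implicit Types (s p : C) (g : 'rV[C]_m).

Let A : 'M[C]_1 := ulsubmx U.
Let B : 'rV[C]_m := ursubmx U.
Let K : 'cV[C]_m := dlsubmx U.
Let D : 'M[C]_m := drsubmx U.

(** [U] is to map the row [(1, g (s - 2 p tau))] to [(f, g (2 - s tau))]; the second block of this
    equation reads [g *m pencil s p = B], the first one is [transfer]. *)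
Definition pencil s p : 'M[C]_m :=
  2%:M - s *: (tau + D) + (2 * p) *: (tau *m D).

Definition numer s p : 'M[C]_m := s%:M - (2 * p) *: tau.

Lemma pencilE s p : pencil s p = (2%:M - s *: tau) - numer s p *m D.
Proof.
rewrite /pencil /numer mulmxBl mul_scalar_mx -scalemxAl.
move: (tau *m D) => T; apply/matrixP => i j; rewrite !mxE; ring.
Qed.

Definition transfer s p g : C := (A + g *m numer s p *m K) 0 0.

Lemma sqnorm_transfer s p g : g *m pencil s p = B ->
  1 + sqnorm (g *m numer s p) =
    `|transfer s p g| ^+ 2 + sqnorm (g *m (2%:M - s *: tau)).
Proof.
move=> gE; rewrite /transfer -sqnorm11 -sqnorm_row_mx.
have -> : row_mx (A + g *m numer s p *m K) (g *m (2%:M - s *: tau)) =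
    row_mx 1%:M (g *m numer s p) *m U.
  rewrite -[U]submxK mul_row_block !mul1mx -/A -/B -/K -/D; congr row_mx.
  by move: gE; rewrite pencilE mulmxBr mulmxA => /eqP; rewrite subr_eq => /eqP.
by rewrite (sqnorm_unitaryr _ UU) sqnorm_row_mx sqnorm11 mxE eqxx normr1 expr1n.
Qed.

(** Put [X = g - w g tau] and [Y = g - z g tau]. The two rows on the left are [X + Y] and
    [z X + w Y], while [X - Y = (z - w) g tau] and [z X - w Y = (z - w) g] have equal norms because
    [tau] is unitary. Subtracting two parallelogram laws gives the identity. *)
Lemma sqnorm_numer z w g :
  sqnorm (g *m (2%:M - (z + w) *: tau)) - sqnorm (g *m numer (z + w) (z * w)) =
  2 * (1 - `|z| ^+ 2) * sqnorm (g - w *: (g *m tau)) +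
  2 * (1 - `|w| ^+ 2) * sqnorm (g - z *: (g *m tau)).
Proof.
have -> : g *m (2%:M - (z + w) *: tau) =
    (g - w *: (g *m tau)) + (g - z *: (g *m tau)).
  rewrite mulmxBr mul_mx_scalar -scalemxAr; apply/rowP => i; rewrite !mxE; ring.
have -> : g *m numer (z + w) (z * w) =
    z *: (g - w *: (g *m tau)) + w *: (g - z *: (g *m tau)).
  rewrite /numer mulmxBr mul_mx_scalar -scalemxAr; apply/rowP => i; rewrite !mxE;
    ring.
have e1 : sqnorm (g - w *: (g *m tau) - (g - z *: (g *m tau))) =
    sqnorm (z *: (g - w *: (g *m tau)) - w *: (g - z *: (g *m tau))).
  have -> : g - w *: (g *m tau) - (g - z *: (g *m tau)) = ((z - w) *: g) *m tau.
    rewrite -scalemxAl; apply/rowP => i; rewrite !mxE; ring.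
  rewrite sqnorm_unitaryr //; congr sqnorm; apply/rowP => i; rewrite !mxE; ring.
move: (g - w *: _) (g - z *: _) e1 => X Y e1.
have := sqnorm_parallelogram X Y; have := sqnorm_parallelogram (z *: X) (w *: Y).
rewrite !sqnormZ -e1; move: (sqnorm (X - Y)) (sqnorm (X + Y)) (sqnorm (_ + _)).
move=> x y t h1 h2.
have -> : y = 2 * (sqnorm X + sqnorm Y) - x by rewrite -h2 addrK.
have -> : t = 2 * (`|z| ^+ 2 * sqnorm X +
  `|w| ^+ 2 * sqnorm Y) - x by rewrite -h1 addrK.
ring.
Qed.

Lemma transfer_norm z w g : g *m pencil (z + w) (z * w) = B ->
  1 - `|transfer (z + w) (z * w) g| ^+ 2 =
  2 * (1 - `|z| ^+ 2) * sqnorm (g - w *: (g *m tau)) +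
  2 * (1 - `|w| ^+ 2) * sqnorm (g - z *: (g *m tau)).
Proof.
move=> /sqnorm_transfer h; rewrite -sqnorm_numer.
have -> : sqnorm (g *m (2%:M - (z + w) *: tau)) =
  1 + sqnorm (g *m numer (z + w) (z * w)) - `|transfer (z + w) (z * w) g| ^+ 2.
  by rewrite h [RHS]addrAC subrr add0r.
ring.
Qed.

Lemma transfer_torus z w g : `|z| = 1 -> `|w| = 1 ->
  g *m pencil (z + w) (z * w) = B -> `|transfer (z + w) (z * w) g| = 1.
Proof.
move=> z1 w1 /transfer_norm; rewrite z1 w1 expr1n subrr mulr0 !mul0r addr0 => /eqP.
by rewrite subr_eq0 eq_sym sqrp_eq1 // => /eqP.
Qed.

Lemma unit_shift_inj (z : C) g : `|z| < 1 -> g = z *: (g *m tau) -> g = 0.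
Proof.
move=> z1 gz; apply: sqnorm_eq0; apply/eqP.
have : sqnorm g = `|z| ^+ 2 * sqnorm g.
  by rewrite {1}gz sqnormZ sqnorm_unitaryr.
move/eqP; rewrite -subr_eq0 -{1}[sqnorm g]mul1r -mulrBl mulf_eq0 subr_eq0.
by rewrite eq_sym lt_eqF // exprn_ilt1.
Qed.

(** In the kernel [g (2 - s tau) = g numer D], and [D] is a contraction as a block of [U]; so the
    left side of [sqnorm_numer] is at most 0, the right side vanishes termwise, and [g = w g tau]
    forces [g = 0]. *)
Lemma pencil_inj z w g : `|z| < 1 -> `|w| < 1 -> g *m pencil (z + w) (z * w) = 0 ->
  g = 0.
Proof.
move=> z1 w1 g0.
have le : sqnorm (g *m (2%:M - (z + w) *: tau)) <=
  sqnorm (g *m numer (z + w) (z * w)).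
  have -> : g *m (2%:M - (z + w) *: tau) = g *m numer (z + w) (z * w) *m D.
    by move: g0; rewrite pencilE mulmxBr mulmxA => /eqP; rewrite subr_eq0 => /eqP.
  move: (g *m numer _ _) => r.
  (* Padding [r] to [(0, r)] exhibits [r D] as a block of [(0, r) U], whose norm is that of [r]. *)
  rewrite -[leRHS]add0r -(_ : sqnorm (0 : 'M[C]_1) = 0); last first.
    by rewrite sqnorm11 mxE normr0 expr0n.
  rewrite -sqnorm_row_mx -(sqnorm_unitaryr _ UU) -[U in leRHS]submxK.
  by rewrite mul_row_block !mul0mx !add0r sqnorm_row_mx lerDr sqnorm_ge0.
have z2 : 0 < 1 - `|z| ^+ 2 by rewrite subr_gt0 exprn_ilt1.
have w2 : 0 < 1 - `|w| ^+ 2 by rewrite subr_gt0 exprn_ilt1.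
have := sqnorm_numer z w g; set X := g - w *: _; set Y := g - z *: _ => e.
have : 2 * (1 - `|z| ^+ 2) * sqnorm X + 2 * (1 - `|w| ^+ 2) * sqnorm Y <= 0.
  by rewrite -e subr_le0.
have x0 : 0 <= 2 * (1 - `|z| ^+ 2) * sqnorm X.
  by rewrite !mulr_ge0 ?sqnorm_ge0 ?ltW.
have y0 : 0 <= 2 * (1 - `|w| ^+ 2) * sqnorm Y.
  by rewrite !mulr_ge0 ?sqnorm_ge0 ?ltW.
move=> xy; have : 2 * (1 - `|z| ^+ 2) * sqnorm X = 0.
  by apply/eqP; rewrite eq_le x0 andbT (le_trans _ xy) // lerDl.
move/eqP; rewrite !mulf_eq0 pnatr_eq0 (gt_eqF z2) /= => /eqP/sqnorm_eq0/eqP.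
by rewrite subr_eq0 => /eqP; exact: unit_shift_inj.
Qed.

(** Both terms of [transfer_norm] are nonnegative. The equality case serves for strictness: a
    vanishing state means [B = 0], hence a constant function. *)
Lemma transfer_le1 z w g : `|z| < 1 -> `|w| < 1 ->
  g *m pencil (z + w) (z * w) = B ->
  `|transfer (z + w) (z * w) g| <= 1 /\
  (`|transfer (z + w) (z * w) g| = 1 -> g = 0).
Proof.
move=> z1 w1 gE; have := transfer_norm gE.
set X := g - w *: _; set Y := g - z *: _ => e.
have z2 : 0 < 1 - `|z| ^+ 2 by rewrite subr_gt0 exprn_ilt1.
have w2 : 0 < 1 - `|w| ^+ 2 by rewrite subr_gt0 exprn_ilt1.
have x0 : 0 <= 2 * (1 - `|z| ^+ 2) * sqnorm X.
  by rewrite !mulr_ge0 ?sqnorm_ge0 ?ltW.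
have y0 : 0 <= 2 * (1 - `|w| ^+ 2) * sqnorm Y.
  by rewrite !mulr_ge0 ?sqnorm_ge0 ?ltW.
split.
  rewrite -(@ler_pXn2r _ 2) ?nnegrE // expr1n -subr_ge0 e addr_ge0 //.
move=> f1; move: e; rewrite f1 expr1n subrr => /esym/eqP.
rewrite paddr_eq0 // => /andP[+ _].
rewrite !mulf_eq0 pnatr_eq0 (gt_eqF z2) /= => /eqP/sqnorm_eq0/eqP.
by rewrite subr_eq0 => /eqP; exact: unit_shift_inj.
Qed.

Lemma pencil_unit z w : `|z| < 1 -> `|w| < 1 -> pencil (z + w) (z * w) \in unitmx.
Proof.
move=> z1 w1; rewrite -row_free_unit -kermx_eq0; apply/eqP/row_matrixP => i.
by rewrite row0; apply: (pencil_inj z1 w1); rewrite -row_mul mulmx_ker row0.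
Qed.

Lemma pencil00 : pencil 0 0 = 2%:M.
Proof. by rewrite /pencil mulr0 !scale0r subr0 addr0. Qed.

(* The state [g] is recovered from [x + y = g (2 - s tau)], whose factor is
   invertible because [|s| < 2]. *)
Lemma transfer_node z w (x y : 'rV[C]_m) (c : C) : `|z| < 1 -> `|w| < 1 ->
  (z *: x - w *: y) *m tau = x - y ->
  row_mx 1%:M (z *: x + w *: y) *m U = row_mx c%:M (x + y) ->
  exists2 g, g *m pencil (z + w) (z * w) = B & transfer (z + w) (z * w) g = c.
Proof.
move=> z1 w1 qv ru; set s := z + w; set p := z * w; set d := z - w.
have s2 : `|s| < 2.
  apply: le_lt_trans (ler_normD _ _) _.
  by rewrite (_ : 2 = 1 + 1) // ltrD.
have inv2 : 2%:M - s *: tau \in unitmx.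
  rewrite -row_free_unit -kermx_eq0; apply/eqP/row_matrixP => i; rewrite row0.
  have : row i (kermx (2%:M - s *: tau)) *m (2%:M - s *: tau) = 0.
    by rewrite -row_mul mulmx_ker row0.
  move: (row i _) => g g0; apply: (@unit_shift_inj (s / 2)).
    by rewrite normrM normfV normr_nat ltr_pdivrMr ?ltr0n // mul1r.
  move: g0; rewrite mulmxBr mul_mx_scalar -scalemxAr => /eqP.
  rewrite subr_eq0 => /eqP e;
    rewrite mulrC -scalerA -e scalerA mulVf ?scale1r ?pnatr_eq0 //.
pose g := (x + y) *m invmx (2%:M - s *: tau).
have gu : g *m (2%:M - s *: tau) = x + y by rewrite /g mulmxKV.
have comm : tau *m (2%:M - s *: tau) = (2%:M - s *: tau) *m tau.
  by rewrite mulmxBr mulmxBl mul_mx_scalar mul_scalar_mx -scalemxAr -scalemxAl.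
(* It suffices to compare after multiplication by [2 - s tau], which is invertible and commutes with
   [tau]; there it follows from [(z - w) (x + y) = 2 (z x - w y) - s (x - y)]. *)
have gv : d *: (g *m tau) = x - y.
  apply: (can_inj (mulmxK inv2)); rewrite -scalemxAl -mulmxA comm mulmxA gu.
  transitivity ((2 *: (z *: x - w *: y) - s *: (x - y)) *m tau).
    rewrite scalemxAl; congr (_ *m _); apply/rowP => i; rewrite !mxE /s /d; ring.
  by rewrite mulmxBl -!scalemxAl qv mulmxBr mul_mx_scalar -scalemxAr.
have two0 : (2 : C) != 0 by rewrite pnatr_eq0.
have xE : x = g - w *: (g *m tau).
  apply: (scalerI two0); transitivity ((x + y) + (x - y)).
    by apply/rowP => i; rewrite !mxE; ring.
  rewrite -gu -gv mulmxBr mul_mx_scalar -scalemxAr.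
  by apply/rowP => i; rewrite !mxE /s /d; ring.
have yE : y = g - z *: (g *m tau).
  apply: (scalerI two0); transitivity ((x + y) - (x - y)).
    by apply/rowP => i; rewrite !mxE; ring.
  rewrite -gu -gv mulmxBr mul_mx_scalar -scalemxAr.
  by apply/rowP => i; rewrite !mxE /s /d; ring.
have gr : g *m numer s p = z *: x + w *: y.
  rewrite xE yE /numer mulmxBr mul_mx_scalar -scalemxAr.
  by apply/rowP => i; rewrite !mxE /s /p; ring.
move: ru; rewrite -[U]submxK mul_row_block !mul1mx -/A -/B -/K -/D =>
  /eq_row_mx[e1 e2].
exists g; last by rewrite /transfer gr e1 mxE eqxx.
by rewrite pencilE mulmxBr mulmxA gr gu -e2 addrK.
Qed.

End Realization.

Local Open Scope complex_scope.
Local Open Scope ring_scope.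
Local Notation Re := complex.Re.
Local Notation Im := complex.Im.

(** * Complex integrals over real intervals *)

Section ComplexIntegral.
Variable R : realType.
Implicit Types (f g F c : R -> R[i]) (a b x : R).
Local Notation mu := (@lebesgue_measure R).

Lemma normcE (z : R[i]) : `|z| = (normc z)%:C. Proof.
by []. Qed.

Lemma normc_ge0 (z : R[i]) : 0 <= normc z.
Proof. by case: z => u v; exact: sqrtr_ge0. Qed.

Lemma normcD (z w : R[i]) : normc (z + w) <= normc z + normc w.
Proof. by rewrite -lecR rmorphD /=; exact: (ler_normD z w). Qed.

Lemma normcN (z : R[i]) : normc (- z) = normc z.
Proof. by case: z => u v /=; rewrite !sqrrN. Qed.

Lemma normcB (z w : R[i]) : normc (z - w) = normc (w - z).
Proof. by rewrite -normcN opprB. Qed.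

Lemma normcX (z : R[i]) k : normc (z ^+ k) = normc z ^+ k.
Proof. by elim: k => [|k IH]; rewrite ?expr0 ?normc1 // !exprS normcM IH. Qed.

Lemma normc_sum (I : Type) (r : seq I) (P : pred I) (h : I -> R[i]) :
  normc (\sum_(i <- r | P i) h i) <= \sum_(i <- r | P i) normc (h i).
Proof.
apply: (big_ind2 (fun z x => normc z <= x)) => [|z x w y zx wy|//].
  by rewrite normc0.
by apply: le_trans (normcD _ _) _; exact: lerD.
Qed.

Lemma normc_real (x : R) : normc x%:C = `|x|.
Proof. by rewrite /= expr0n /= addr0 sqrtr_sqr. Qed.

Lemma normc_eq0 (z : R[i]) : (normc z == 0) = (z == 0).
Proof. by apply/eqP/eqP => [/eq0_normc//|->]; rewrite normc0. Qed.

Lemma normc_gt0 (z : R[i]) : (0 < normc z) = (z != 0).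
Proof. by rewrite lt_def normc_eq0 normc_ge0 andbT. Qed.

Lemma ge_Re_normc (z : R[i]) : `|Re z| <= normc z.
Proof.
case: z => u v /=; rewrite -sqrtr_sqr ler_wsqrtr // lerDl; exact: sqr_ge0.
Qed.

Lemma ge_Im_normc (z : R[i]) : `|Im z| <= normc z.
Proof.
case: z => u v /=; rewrite -sqrtr_sqr ler_wsqrtr // lerDr; exact: sqr_ge0.
Qed.

Lemma normc_le_ReIm (z : R[i]) : normc z <= `|Re z| + `|Im z|.
Proof.
case: z => u v /=; rewrite -[leRHS]ger0_norm ?addr_ge0 // -sqrtr_sqr.
rewrite ler_wsqrtr // sqrrD !real_normK ?num_real // -addrA (addrC
  (_ *+ 2)) addrA lerDl.
by rewrite mulrn_wge0 // mulr_ge0.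
Qed.

Lemma re_add (z w : R[i]) : Re (z + w) = Re z + Re w.
Proof. by case: z w => [? ?] [? ?]. Qed.

Lemma im_add (z w : R[i]) : Im (z + w) = Im z + Im w.
Proof. by case: z w => [? ?] [? ?]. Qed.

Lemma re_mul (z w : R[i]) : Re (z * w) = Re z * Re w - Im z * Im w.
Proof. by case: z w => [? ?] [? ?]. Qed.

Lemma im_mul (z w : R[i]) : Im (z * w) = Re z * Im w + Im z * Re w.
Proof. by case: z w => [? ?] [? ?]. Qed.

Lemma eq_ReIm (z w : R[i]) : Re z = Re w -> Im z = Im w -> z = w.
Proof. by case: z w => [? ?] [? ?] /= -> ->. Qed.

(* [R[i]^o] is a normed module over [R[i]] and not over [R]: continuity,
   derivatives and integrals of complex functions of real variables are taken
   componentwise. *)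
Definition rcts (T : topologicalType) (u : T -> R) (x : T) :=
  {for x, continuous u}.

Definition ccts (T : topologicalType) (f : T -> R[i]) (x : T) :=
  rcts (fun y => Re (f y)) x /\ rcts (fun y => Im (f y)) x.

Lemma eq_rcts (T : topologicalType) (u v : T -> R) (x : T) :
  (forall y, v y = u y) -> rcts u x -> rcts v x.
Proof. by move=> uv; rewrite (_ : v = u) //; apply/funext. Qed.

Lemma eq_ccts (T : topologicalType) (f g : T -> R[i]) (x : T) :
  (forall y, g y = f y) -> ccts f x -> ccts g x.
Proof. by move=> uv; rewrite (_ : g = f) //; apply/funext. Qed.

Lemma rctsD (T : topologicalType) (u v : T -> R) (x : T) :
  rcts u x -> rcts v x -> rcts (fun y => u y + v y) x.
Proof. by move=> cu cv; exact: (@continuousD _ R T u v x cu cv). Qed.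

Lemma rctsB (T : topologicalType) (u v : T -> R) (x : T) :
  rcts u x -> rcts v x -> rcts (fun y => u y - v y) x.
Proof. by move=> cu cv; exact: (@continuousB _ R T u v x cu cv). Qed.

Lemma rctsM (T : topologicalType) (u v : T -> R) (x : T) :
  rcts u x -> rcts v x -> rcts (fun y => u y * v y) x.
Proof. by move=> cu cv; exact: (@continuousM _ T u v x cu cv). Qed.

Lemma cctsD (T : topologicalType) (f g : T -> R[i]) (x : T) :
  ccts f x -> ccts g x -> ccts (fun y => f y + g y) x.
Proof.
move=> [fr fi] [gr gi]; split.
  apply: eq_rcts => [y|]; first exact: re_add.
  exact: rctsD.
apply: eq_rcts => [y|]; first exact: im_add.
exact: rctsD.
Qed.

Lemma cctsM (T : topologicalType) (f g : T -> R[i]) (x : T) :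
  ccts f x -> ccts g x -> ccts (fun y => f y * g y) x.
Proof.
move=> [fr fi] [gr gi]; split.
  apply: eq_rcts => [y|]; first exact: re_mul.
  apply: rctsB; exact: rctsM.
apply: eq_rcts => [y|]; first exact: im_mul.
apply: rctsD; exact: rctsM.
Qed.

Lemma ccts_cst (T : topologicalType) (z : R[i]) (x : T) : ccts (fun=> z) x.
Proof. by split; exact: cst_continuous. Qed.

Lemma ccts_sum (T : topologicalType) (I : Type) (r : seq I) (h : I -> T -> R[i])
    (x : T) :
  (forall i, ccts (h i) x) -> ccts (fun y => \sum_(i <- r) h i y) x.
Proof.
move=> hx; elim: r => [|i r IH].
  apply: eq_ccts => [y|]; first exact: big_nil.
  exact: ccts_cst.
apply: eq_ccts => [y|]; first exact: big_cons.
exact: cctsD.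
Qed.

Lemma cctsX (T : topologicalType) (f : T -> R[i]) k (x : T) :
  ccts f x -> ccts (fun y => f y ^+ k) x.
Proof.
move=> fx; elim: k => [|k IH]; first exact: ccts_cst.
apply: eq_ccts => [y|]; first exact: exprS.
exact: cctsM.
Qed.

Definition rint a b (f : R -> R) : R := \int[mu]_(x in `[a, b]) f x.

Definition cint a b f : R[i] :=
  rint a b (fun x => Re (f x)) +i* rint a b (fun x => Im (f x)).

Section Real.
Implicit Types u v : R -> R.

Lemma rcts_integrable a b u : (forall x, a <= x <= b -> {for x, continuous u}) ->
  mu.-integrable `[a, b] (EFin \o u).
Proof.
move=> cu; apply: continuous_compact_integrable; first exact: segment_compact.
by apply: continuous_in_subspaceT => x; rewrite inE /= in_itv /=; exact: cu.
Qed.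

Lemma rint_split a m b u : a <= m <= b ->
  (forall x, a <= x <= b -> {for x, continuous u}) ->
  rint a b u = rint a m u + rint m b u.
Proof.
move=> /andP[am mb] cu.
have iu := rcts_integrable cu.
have := Rintegral_itvB iu (x := m); rewrite !bnd_simp => /(_ am mb).
rewrite /rint Rintegral_itv_obnd_cbnd => [<-|]; first by rewrite addrC subrK.
apply: integrableS iu => //; apply: subset_itv => //.
Qed.

Lemma rint_bound a b u K : a <= b ->
  (forall x, a <= x <= b -> {for x, continuous u}) ->
  (forall x, a <= x <= b -> `|u x| <= K) -> `|rint a b u| <= K * (b - a).
Proof.
move=> ab cu uK.
apply: le_trans (le_normr_Rintegral _ (rcts_integrable cu)) _ => //.
have -> : K * (b - a) = rint a b (fun=> K).
  rewrite /rint Rintegral_cst //= lebesgue_measure_itv /= lte_fin.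
  by case: ltP => // ba; rewrite (le_anti (_ : a <= b <= a)) ?ab // subrr.
apply: le_Rintegral => //.
- apply: rcts_integrable => x /cu cux.
  by apply: (@continuous_comp _ _ _ u (fun y => `|y|)) => //;
    exact: norm_continuous.
- by apply: rcts_integrable => x _; exact: cst_continuous.
Qed.

Lemma rint_FTC a b u (U : R -> R) : a <= b ->
  (forall x, {for x, continuous u}) -> (forall x, is_derive x (1 : R) U (u x)) ->
  rint a b u = U b - U a.
Proof.
move=> ab cu dF; have [->|ba] := eqVneq a b.
  by rewrite subrr /rint set_itv1 Rintegral_set1.
have {ba}ab : a < b by rewrite lt_neqAle ba.
have cF x : {for x, continuous U}.
  by apply/differentiable_continuous/derivable1_diffP;
    exact: (@ex_derive _ _ _ _ _ _ _ (dF x)).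
rewrite /rint /Rintegral (@continuous_FTC2 _ u U a b) //.
- exact: continuous_subspaceT.
- split=> [x _||].
  + exact: (@ex_derive _ _ _ _ _ _ _ (dF x)).
  + exact/cvg_at_right_filter/cF.
  + exact/cvg_at_left_filter/cF.
- by move=> x _; rewrite derive1E; exact: derive_val.
Qed.

End Real.

Lemma eq_cint a b f g : (forall x,
  a <= x <= b -> f x = g x) -> cint a b f = cint a b g.
Proof.
move=> fg; rewrite /cint; congr (_ +i* _); apply: eq_Rintegral => x;
  by rewrite inE /= in_itv /= => /fg ->.
Qed.

Lemma cint_split a m b f : a <= m <= b ->
  (forall x, a <= x <= b -> ccts f x) -> cint a b f = cint a m f + cint m b f.
Proof.
by move=> amb cf; rewrite /cint !(rint_split amb) // => x /cf[].
Qed.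

Lemma cintD a b f g : (forall x, a <= x <= b -> ccts f x) ->
  (forall x, a <= x <= b -> ccts g x) ->
  cint a b (fun x => f x + g x) = cint a b f + cint a b g.
Proof.
move=> cf cg.
have ri : mu.-integrable `[a, b] (EFin \o (fun x => Re (f x))).
  by apply: rcts_integrable => x /cf[].
have ii : mu.-integrable `[a, b] (EFin \o (fun x => Im (f x))).
  by apply: rcts_integrable => x /cf[].
have rj : mu.-integrable `[a, b] (EFin \o (fun x => Re (g x))).
  by apply: rcts_integrable => x /cg[].
have ij : mu.-integrable `[a, b] (EFin \o (fun x => Im (g x))).
  by apply: rcts_integrable => x /cg[].
apply: eq_ReIm; [rewrite re_add|rewrite im_add];
  rewrite [RHS]/= [LHS]/= /rint -RintegralD //;
  by apply: eq_Rintegral => x _; rewrite ?re_add ?im_add.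
Qed.

Lemma cintZ a b z f : (forall x, a <= x <= b -> ccts f x) ->
  cint a b (fun x => z * f x) = z * cint a b f.
Proof.
move=> cf.
have cr : mu.-integrable `[a, b] (EFin \o (fun x => Re (f x))).
  by apply: rcts_integrable => x /cf[].
have ci : mu.-integrable `[a, b] (EFin \o (fun x => Im (f x))).
  by apply: rcts_integrable => x /cf[].
have iZ (k : R) (u : R -> R) : mu.-integrable `[a, b] (EFin \o u) ->
    mu.-integrable `[a, b] (EFin \o (fun x => k * u x)).
  by move=> iu; have := integrableZl _ k iu; exact.
apply: eq_ReIm; [rewrite re_mul|rewrite im_mul];
  rewrite [RHS]/= [LHS]/= /rint -!RintegralZl //.
  rewrite -RintegralB; [|by []|exact: iZ..].
  by apply: eq_Rintegral => x _; rewrite re_mul.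
rewrite -RintegralD; [|by []|exact: iZ..].
by apply: eq_Rintegral => x _; rewrite im_mul.
Qed.

Lemma cint_sum a b n (h : nat -> R -> R[i]) :
  (forall k x, a <= x <= b -> ccts (h k) x) ->
  cint a b (fun x => \sum_(k < n) h k x) = \sum_(k < n) cint a b (h k).
Proof.
move=> ch; elim: n => [|n IH].
  rewrite big_ord0 (@eq_cint _ _ _ (fun x => 0 * 0)) => [|x _].
    by rewrite cintZ ?mul0r // => x _; exact: ccts_cst.
  by rewrite big_ord0 mul0r.
rewrite big_ord_recr /= -IH -cintD => [||x xab].
- by apply: eq_cint => x _; rewrite big_ord_recr.
- move=> x xab; apply: ccts_sum => k; exact: ch.
- exact: ch.
Qed.

(** The factor 2 comes from bounding real and imaginary parts separately; the later estimates can
    afford it. *)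
Lemma cint_bound a b f K : a <= b -> (forall x, a <= x <= b -> ccts f x) ->
  (forall x, a <= x <= b -> normc (f x) <= K) ->
  normc (cint a b f) <= 2 * K * (b - a).
Proof.
move=> ab cf fK; apply: le_trans (normc_le_ReIm _) _ => /=.
rewrite -mulrA mulr_natl mulr2n; apply: lerD.
  by apply: rint_bound => // x xab;
    [case: (cf x xab)|exact: le_trans (ge_Re_normc _) (fK _ xab)].
by apply: rint_bound => // x xab;
  [case: (cf x xab)|exact: le_trans (ge_Im_normc _) (fK _ xab)].
Qed.

Definition cder (F f : R -> R[i]) x :=
  is_derive x (1 : R) (fun y => Re (F y)) (Re (f x)) /\
  is_derive x (1 : R) (fun y => Im (F y)) (Im (f x)).

Lemma cint_FTC a b F f : a <= b -> (forall x, ccts f x) ->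
  (forall x, cder F f x) -> cint a b f = F b - F a.
Proof.
move=> ab cf dF; apply: eq_ReIm => /=.
  transitivity (Re (F b) - Re (F a)); last by case: (F b) (F a) => [? ?] [? ?].
  apply: (rint_FTC (U := fun y => Re (F y))) => // x;
    [by case: (cf x)|by case: (dF x)].
transitivity (Im (F b) - Im (F a)); last by case: (F b) (F a) => [? ?] [? ?].
apply: (rint_FTC (U := fun y => Im (F y))) => // x;
  [by case: (cf x)|by case: (dF x)].
Qed.

Lemma eq_cder F f g x : (forall y, g y = F y) -> cder F f x -> cder g f x.
Proof. by move=> uv; rewrite (_ : g = F) //; apply/funext. Qed.

Lemma cderD F G f g x : cder F f x -> cder G g x ->
  cder (fun y => F y + G y) (fun y => f y + g y) x.
Proof.
move=> [Fr Fi] [Gr Gi]; split.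
  rewrite (_ : (fun y => _) = (fun y => Re (F y)) + (fun y => Re (G y))) ?re_add;
    last by apply/funext => y; rewrite re_add.
  exact: is_deriveD.
rewrite (_ : (fun y => _) = (fun y => Im (F y)) + (fun y => Im (G y))) ?im_add;
  last by apply/funext => y; rewrite im_add.
  exact: is_deriveD.
Qed.

Lemma cder_eq F f g x : f x = g x -> cder F f x -> cder F g x.
Proof. by move=> e; rewrite /cder e. Qed.

Lemma cder_cst z x : cder (fun=> z) (fun=> 0) x.
Proof. by split; exact: is_derive_cst. Qed.

Lemma cderM F G f g x : cder F f x -> cder G g x ->
  cder (fun y => F y * G y) (fun y => f y * G y + F y * g y) x.
Proof.
move=> [Fr Fi] [Gr Gi]; split.
  rewrite (_ : (fun y => _) = (fun y => Re (F y)) * (fun y => Re (G y)) -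
      (fun y => Im (F y)) * (fun y => Im (G y))); last by apply/funext => y;
        rewrite re_mul.
  rewrite re_add !re_mul.
  by apply: (is_derive_eq (is_deriveB (is_deriveM Fr Gr) (is_deriveM Fi Gi)));
    rewrite /GRing.scale /=; ring.
rewrite (_ : (fun y => _) = (fun y => Re (F y)) * (fun y => Im (G y)) +
    (fun y => Im (F y)) * (fun y => Re (G y))); last by apply/funext => y;
      rewrite im_mul.
rewrite im_add !im_mul.
by apply: (is_derive_eq (is_deriveD (is_deriveM Fr Gi) (is_deriveM Fi Gr)));
  rewrite /GRing.scale /=; ring.
Qed.

Lemma cder_ccts F f x : cder F f x -> ccts F x.
Proof.
by move=> [Fr Fi]; split;
  apply/differentiable_continuous/derivable1_diffP; apply: ex_derive.
Qed.

(** Complex differentiability with real epsilons, in the linear approximation form that Goursat's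
    argument consumes. *)
Definition cdiff (g : R[i] -> R[i]) (z : R[i]) := exists b : R[i], forall e : R,
  0 < e ->
  exists2 d : R, 0 < d & forall y : R[i], normc (y - z) < d ->
    normc (g y - g z - b * (y - z)) <= e * normc (y - z).

Lemma cdiff_cts (g : R[i] -> R[i]) z : cdiff g z -> forall e : R, 0 < e ->
  exists2 d : R, 0 < d & forall y : R[i],
    normc (y - z) < d -> normc (g y - g z) < e.
Proof.
move=> [b gb] e e0; have [d d0 dg] := gb 1 ltr01.
have k0 : 0 < 1 + normc b by rewrite ltr_pwDl // normc_ge0.
exists (Num.min d (e / (1 + normc b))).
  by rewrite lt_min d0 divr_gt0.
move=> y; rewrite lt_min => /andP[yd ye].
rewrite -[g y - g z](subrK (b * (y - z))).
apply: le_lt_trans (normcD _ _) _; rewrite normcM.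
apply: le_lt_trans (lerD (dg _ yd) (lexx _)) _.
by rewrite -mulrDl mulrC -ltr_pdivlMr.
Qed.

Lemma cctsP (f : R -> R[i]) x : ccts f x <-> forall e : R, 0 < e ->
  exists2 d : R, 0 < d & forall y, `|y - x| < d -> normc (f y - f x) < e.
Proof.
split=> [[/cvgrPdist_lt fr /cvgrPdist_lt fi] e e0|fe].
  have e2 : 0 < e / 2 by rewrite divr_gt0.
  have /nbhs_ballP[d1 /= d10 h1] := fr _ e2.
  have /nbhs_ballP[d2 /= d20 h2] := fi _ e2.
  exists (Num.min d1 d2); first by rewrite lt_min d10.
  move=> y; rewrite lt_min => /andP[y1 y2].
  rewrite normcB; apply: le_lt_trans (normc_le_ReIm _) _.
  rewrite [e]splitr; have := h1 y; have := h2 y.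
  rewrite /ball /= (distrC x y) => /(_ y2) H2 /(_ y1) H1.
  apply: ltrD.
    by move: H1; case: (f x) (f y) => [? ?] [? ?].
  by move: H2; case: (f x) (f y) => [? ?] [? ?].
split; apply/cvgrPdist_lt => e /fe[d d0 dy]; apply/nbhs_ballP; exists d => //= y;
  rewrite /ball /= (distrC x y) => /dy; rewrite normcB.
  apply: le_lt_trans; have := ge_Re_normc (f x - f y).
  by case: (f x) (f y) => [? ?] [? ?].
apply: le_lt_trans; have := ge_Im_normc (f x - f y).
by case: (f x) (f y) => [? ?] [? ?].
Qed.

Lemma ccts_comp (g : R[i] -> R[i]) (c : R -> R[i]) x :
  cdiff g (c x) -> ccts c x -> ccts (fun y => g (c y)) x.
Proof.
move=> gx /cctsP cx; apply/cctsP => e /(cdiff_cts gx)[d d0 dg].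
have [d' d'0 dc] := cx _ d0.
by exists d' => // y /dc /dg.
Qed.

End ComplexIntegral.

(** * Goursat's lemma *)

Section Goursat.
Variable R : realType.

Lemma nested_intervals (a b : nat -> R) : (forall n, a n <= a n.+1) ->
  (forall n, b n.+1 <= b n) -> (forall n, a n <= b n) ->
  exists x, forall n, a n <= x <= b n.
Proof.
move=> ha hb ab.
have am m k : a m <= a (m + k)%N.
  by elim: k => [|k IH]; rewrite ?addn0 // addnS (le_trans IH).
have bm m k : b (m + k)%N <= b m.
  by elim: k => [|k IH]; rewrite ?addn0 // addnS (le_trans _ IH).
have abmn m n : a m <= b n.
  apply: le_trans (am m n) _; apply: le_trans (ab _) _.
  by rewrite addnC.
exists (sup (range a)) => n; apply/andP; split.
  apply: ub_le_sup; last by exists n.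
  by exists (b 0%N) => _ [m _ <-].
apply: ge_sup; first by exists (a 0%N), 0%N.
by move=> _ [m _ <-].
Qed.

Lemma pow2_small (x d : R) : 0 < d ->
  exists N, forall n, (N <= n)%N -> x / 2 ^+ n < d.
Proof.
move=> d0; exists (Num.bound (x / d)) => n /upper_nthrootP.
by rewrite ltr_pdivrMr // ltr_pdivrMr ?exprn_gt0 // mulrC.
Qed.

Lemma half_split (h : R) n : h / 2 ^+ n = h / 2 ^+ n.+1 + h / 2 ^+ n.+1.
Proof. by rewrite exprSr invfM mulrA -splitr. Qed.

Section Bisection.
Variables (h k x0 y0 : R) (K : nat -> R -> R -> R[i]).
Hypotheses (h0 : 0 <= h) (k0 : 0 <= k).

Definition dyadic_in n (p : R * R) :=
  [/\ x0 <= p.1, p.1 + h / 2 ^+ n <= x0 + h, y0 <= p.2 &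
      p.2 + k / 2 ^+ n <= y0 + k].

Definition dyadic_sub n (p q : R * R) :=
  [/\ p.1 <= q.1, q.1 + h / 2 ^+ n.+1 <= p.1 + h / 2 ^+ n, p.2 <= q.2 &
      q.2 + k / 2 ^+ n.+1 <= p.2 + k / 2 ^+ n].

Hypothesis K_split : forall n p, dyadic_in n p ->
  K n p.1 p.2 = K n.+1 p.1 p.2 + K n.+1 (p.1 + h / 2 ^+ n.+1) p.2 +
    (K n.+1 p.1 (p.2 + k / 2 ^+ n.+1) +
     K n.+1 (p.1 + h / 2 ^+ n.+1) (p.2 + k / 2 ^+ n.+1)).

Hypothesis K_local : forall x y (e : R), x0 <= x <= x0 + h -> y0 <= y <= y0 + k ->
  0 < e -> exists N, forall n p, (N <= n)%N -> dyadic_in n p ->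
    p.1 <= x <= p.1 + h / 2 ^+ n -> p.2 <= y <= p.2 + k / 2 ^+ n ->
    normc (K n p.1 p.2) <= e / 4 ^+ n.

(** Goursat's argument for an abstract additive rectangle function: a value of modulus [M] at the
    start leaves a quarter with at least [M / 4], and so on; the nested rectangles share a point,
    where [K_local] with [e = M / 2] is violated. *)
Lemma bisection : K 0 x0 y0 = 0.
Proof.
set M := normc (K 0 x0 y0); apply/eqP; rewrite -normc_eq0 -/M.
apply: contraT => M0; have {M0}M0 : 0 < M by rewrite lt_def M0 normc_ge0.
pose good n p := dyadic_in n p /\ M / 4 ^+ n <= normc (K n p.1 p.2).
have step n p : good n p -> exists q, good n.+1 q /\ dyadic_sub n p q.
  move=> [pin Kp].
  have hn : 0 <= h / 2 ^+ n.+1 by rewrite divr_ge0 ?exprn_ge0.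
  have kn : 0 <= k / 2 ^+ n.+1 by rewrite divr_ge0 ?exprn_ge0.
  have sub q : (q.1 = p.1 \/ q.1 = p.1 + h / 2 ^+ n.+1) ->
      (q.2 = p.2 \/ q.2 = p.2 + k / 2 ^+ n.+1) -> dyadic_sub n p q.
    rewrite /dyadic_sub !(half_split _ n) => q1 q2.
    split; [case: q1|case: q1|case: q2|case: q2] => ->; lra.
  have ind q : dyadic_sub n p q -> dyadic_in n.+1 q.
    case: pin => p1 p2 p3 p4 [q1 q2 q3 q4]; split; lra.
  have [q [qs Kq]] : exists q,
    dyadic_sub n p q /\ M / 4 ^+ n.+1 <= normc (K n.+1 q.1 q.2).
    (* Otherwise the four quarters would add up to less than [M / 4 ^ n]. *)
    apply: contrapT => /forallNP noq.
    have lt q : dyadic_sub n p q -> normc (K n.+1 q.1 q.2) < M / 4 ^+ n.+1.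
      by move=> qs; have /not_andP[//|/negP] := noq q; rewrite -ltNge.
    have := Kp; rewrite leNgt => /negP; apply.
    rewrite K_split // exprSr invfM in lt *.
    have := lt (p.1, p.2) (sub (p.1, p.2) (or_introl erefl) (or_introl erefl)).
    have := lt (p.1 + h / 2 ^+ n.+1, p.2) (sub (_,
      _) (or_intror erefl) (or_introl erefl)).
    have := lt (p.1, p.2 + k / 2 ^+ n.+1) (sub (_,
      _) (or_introl erefl) (or_intror erefl)).
    have := lt (_, _) (sub (_, _) (or_intror erefl) (or_intror erefl)).
    rewrite /= => l4 l3 l2 l1.
    apply: le_lt_trans (normcD _ _) _.
    apply: le_lt_trans (lerD (normcD _ _) (normcD _ _)) _.
    lra.
  by exists q; split=> //; split=> //; exact: ind.
have good0 : good 0%N (x0, y0).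
  by split; rewrite ?expr0 ?divr1 //; split; rewrite /= ?expr0 ?divr1.
pose next n (p : {p | good n p}) : {q | good n.+1 q /\ dyadic_sub n (sval p) q} :=
  cid (step n (sval p) (svalP p)).
pose fix s n : {p | good n p} :=
  if n is m.+1 then exist _ (sval (next m (s m))) (proj1 (svalP (next m (s m))))
  else exist _ (x0, y0) good0.
pose p n := sval (s n).
have pg n : good n (p n) := svalP (s n).
have ps n : dyadic_sub n (p n) (p n.+1) := proj2 (svalP (next n (s n))).
have [||n|x xp] := @nested_intervals (fun n => (p n).1) (fun n =>
  (p n).1 + h / 2 ^+ n).
- by move=> n; case: (ps n).
- by move=> n; case: (ps n).
- by rewrite lerDl divr_ge0 ?exprn_ge0.
have [||n|y yp] := @nested_intervals (fun n => (p n).2) (fun n =>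
  (p n).2 + k / 2 ^+ n).
- by move=> n; case: (ps n).
- by move=> n; case: (ps n).
- by rewrite lerDl divr_ge0 ?exprn_ge0.
have [|||N KN] := K_local (x := x) (y := y) (e := M / 2).
- by have := xp 0%N; rewrite /= expr0 divr1.
- by have := yp 0%N; rewrite /= expr0 divr1.
- lra.
have [pin Mp] := pg N; have := KN N (p N) (leqnn N) pin (xp N) (yp N).
move=> /(le_trans Mp); rewrite ler_pM2r ?invr_gt0 ?exprn_gt0 //; lra.
Qed.

End Bisection.

End Goursat.

Section FormIntegral.
Variable R : realType.
Variables (w : R[i]) (y y' : R -> R[i]) (B : R).
Hypothesis dy : forall x, cder y y' x.
Hypothesis cy' : forall x, ccts y' x.
Hypothesis yB : forall x, normc (y x) <= B.
Hypothesis y'B : forall x, normc (y' x) <= B.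

(** The linear homotopy from the apex [w] at [t = 0] to the curve [w + y] at [t = 1]. Working on the
    parameter rectangle avoids any topology of the region enclosed. *)
Definition cone (t x : R) : R[i] := w + t%:C * y x.

(* The integral of the form [f dz] over the image under [cone] of the oriented
   boundary of the rectangle [a, b] * [c, d]. *)
Definition bdint (f : R[i] -> R[i]) (a b c d : R) : R[i] :=
  cint c d (fun x => b%:C * y' x * f (cone b x))
  - cint c d (fun x => a%:C * y' x * f (cone a x))
  - cint a b (fun t => y d * f (cone t d))
  + cint a b (fun t => y c * f (cone t c)).

(** Separate continuity is enough, since every integral runs along a side, where one parameter is
    fixed. *)
Definition pcts (f : R[i] -> R[i]) (a b c d : R) := forall t x,
  a <= t <= b -> c <= x <= d ->
  ccts (fun s => f (cone s x)) t /\ ccts (fun z => f (cone t z)) x.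

Lemma real_cder t : cder (fun s : R => s%:C) (fun=> 1) t.
Proof. by split; rewrite /=; [exact: is_derive_id|exact: is_derive_cst]. Qed.

Lemma cone_cder_t t x : cder (fun s => cone s x) (fun=> y x) t.
Proof.
apply: (@cder_eq _ _ (fun s => 0 + (1 * y x + s%:C * 0)));
  first by rewrite mulr0 mul1r add0r addr0.
apply: cderD; first exact: cder_cst.
by apply: cderM; [exact: real_cder|exact: cder_cst].
Qed.

Lemma cone_cder_x t x : cder (cone t) (fun z => t%:C * y' z) x.
Proof.
apply: (@cder_eq _ _ (fun s => 0 + (0 * y s + t%:C * y' s)));
  first by rewrite mul0r !add0r.
apply: cderD; first exact: cder_cst.
by apply: cderM; [exact: cder_cst|exact: dy].
Qed.

Lemma pcts_sub f a b c d a' b' c' d' : a <= a' -> b' <= b -> c <= c' -> d' <= d ->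
  pcts f a b c d -> pcts f a' b' c' d'.
Proof.
move=> aa bb cc dd fp t x /andP[a't tb'] /andP[c'x xd'].
by apply: fp; apply/andP; split; lra.
Qed.

Lemma pctsD f g a b c d : pcts f a b c d -> pcts g a b c d ->
  pcts (fun z => f z + g z) a b c d.
Proof.
move=> fp gp t x tab xcd; have [f1 f2] := fp t x tab xcd.
by have [g1 g2] := gp t x tab xcd; split; exact: cctsD.
Qed.

Lemma pcts_affine A E z0 a b c d : pcts (fun z => A + E * (z - z0)) a b c d.
Proof.
move=> t x _ _; have c1 := cder_ccts (cone_cder_t t x).
have c2 := cder_ccts (cone_cder_x t x).
split; apply: cctsD; do ?[exact: ccts_cst]; apply: cctsM;
  do ?[exact: ccts_cst]; apply: cctsD => //; exact: ccts_cst.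
Qed.

Lemma pcts_cdiff f a b c d :
  (forall t x, a <= t <= b -> c <= x <= d -> cdiff f (cone t x)) -> pcts f a b c d.
Proof.
move=> fd t x tab xcd; have ft := fd t x tab xcd.
split; first exact: (ccts_comp (c := fun s =>
  cone s x) ft (cder_ccts (cone_cder_t t x))).
exact: (ccts_comp (c := cone t) ft (cder_ccts (cone_cder_x t x))).
Qed.

Lemma ccts_sidex f a b c d t x : pcts f a b c d -> a <= t <= b -> c <= x <= d ->
  ccts (fun x => t%:C * y' x * f (cone t x)) x.
Proof.
move=> fp tab xcd; apply: cctsM; last by case: (fp t x tab xcd).
by apply: cctsM => //; exact: ccts_cst.
Qed.

Lemma ccts_sidet f a b c d t x : pcts f a b c d -> a <= t <= b -> c <= x <= d ->
  ccts (fun t => y x * f (cone t x)) t.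
Proof.
move=> fp tab xcd; apply: cctsM; last by case: (fp t x tab xcd).
exact: ccts_cst.
Qed.

Section Rectangle.
Variables (a b c d : R).
Hypotheses (ab : a <= b) (cd : c <= d).

Let aab : a <= a <= b. Proof.
by rewrite lexx. Qed.
Let bab : a <= b <= b. Proof.
by rewrite lexx andbT. Qed.
Let ccd : c <= c <= d. Proof.
by rewrite lexx. Qed.
Let dcd : c <= d <= d. Proof.
by rewrite lexx andbT. Qed.

Lemma bdintD f g : pcts f a b c d -> pcts g a b c d ->
  bdint (fun z => f z + g z) a b c d = bdint f a b c d + bdint g a b c d.
Proof.
move=> fp gp.
have ex (t : R) : a <= t <= b -> cint c d (fun x =>
  t%:C * y' x * (f (cone t x) + g (cone t x))) =
    cint c d (fun x => t%:C * y' x * f (cone t x)) + cint c d (fun x =>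
      t%:C * y' x * g (cone t x)).
  move=> tab; rewrite -cintD => [|x xcd|x xcd].
  - by apply: eq_cint => x _; rewrite mulrDr.
  - exact: (ccts_sidex fp).
  - exact: (ccts_sidex gp).
have et (x : R) : c <= x <= d -> cint a b (fun t =>
  y x * (f (cone t x) + g (cone t x))) =
    cint a b (fun t => y x * f (cone t x)) + cint a b (fun t => y x * g (cone t x)).
  move=> xcd; rewrite -cintD => [|t tab|t tab].
  - by apply: eq_cint => t _; rewrite mulrDr.
  - exact: (ccts_sidet fp).
  - exact: (ccts_sidet gp).
rewrite /bdint !ex // !et //.
by move: (cint c d _) (cint c d _) (cint c d _) (cint c d _) (cint a b _)
  (cint a b _)
  (cint a b _) (cint a b _) => *; ring.
Qed.

Lemma bdint_bound f K : pcts f a b c d -> 0 <= a -> b <= 1 ->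
  (forall t x, a <= t <= b -> c <= x <= d -> normc (f (cone t x)) <= K) ->
  normc (bdint f a b c d) <= 4 * K * B * ((b - a) + (d - c)).
Proof.
move=> fp a0 b1 fK.
have B0 : 0 <= B by exact: le_trans (normc_ge0 _) (yB 0).
have K0 : 0 <= K by exact: le_trans (normc_ge0 _) (fK a c aab ccd).
have ex (t : R) : a <= t <= b ->
    normc (cint c d (fun x => t%:C * y' x * f (cone t x))) <= 2 * (B * K) * (d - c).
  move=> tab; apply: cint_bound => // x xcd; first exact: (ccts_sidex fp).
  have t01 : 0 <= t <= 1 by case/andP: tab => *; apply/andP; split; lra.
  case/andP: t01 => t0 t1.
  rewrite !normcM normc_real ger0_norm // ler_pM ?mulr_ge0 ?normc_ge0 //;
    last exact: fK.
  by rewrite -[leRHS]mul1r ler_pM // normc_ge0.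
have et (x : R) : c <= x <= d ->
    normc (cint a b (fun t => y x * f (cone t x))) <= 2 * (B * K) * (b - a).
  move=> xcd; apply: cint_bound => // t tab; first exact: (ccts_sidet fp).
  rewrite !normcM ler_pM ?normc_ge0 //; exact: fK.
rewrite /bdint; apply: le_trans (normcD _ _) _.
apply: le_trans (lerD (normcD _ _) (lexx _)) _.
apply: le_trans (lerD (lerD (normcD _ _) (lexx _)) (lexx _)) _.
rewrite !normcN; move: (ex a aab) (ex b bab) (et c ccd) (et d dcd).
move: (normc (cint c d _)) (normc (cint c d _)) (normc (cint a b _)) (normc
  (cint a b _)).
move=> *; nra.
Qed.

(** The primitive [G] turns each side into a difference of its values at two corners, and these
    cancel around the rectangle. *)
Lemma bdint_affine A E z0 : bdint (fun z => A + E * (z - z0)) a b c d = 0.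
Proof.
pose G z := A * z + E * 2^-1 * (z - z0) ^+ 2.
have GD (p p' : R -> R[i]) x : cder p p' x ->
    cder (fun s => G (p s)) (fun s => p' s * (A + E * (p s - z0))) x.
  move=> pp.
  apply: (@cder_eq _ _ (fun s => (0 * p s + A * p' s) +
     (0 * (p s - z0) ^+ 2 + E * 2^-1 * ((p' s + 0) * (p s - z0) +
       (p s - z0) * (p' s + 0))))).
    by field.
  apply: cderD; first by apply: cderM => //; exact: cder_cst.
  apply: cderM; first exact: cder_cst.
  by rewrite /=; apply: cderM; apply: cderD => //; exact: cder_cst.
have ex (t : R) : a <= t <= b -> cint c d (fun x =>
  t%:C * y' x * (A + E * (cone t x - z0))) =
    G (cone t d) - G (cone t c).
  move=> tab; apply: (cint_FTC (F := fun x => G (cone t x))) => // x.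
    by apply: (ccts_sidex (pcts_affine A E z0 (a := a) (b := b) (c := x)
      (d := x))) => //; rewrite lexx.
  exact: (GD (cone t) _ x (cone_cder_x t x)).
have et (x : R) : cint a b (fun t => y x * (A + E * (cone t x - z0))) =
    G (cone b x) - G (cone a x).
  apply: (cint_FTC (F := fun t => G (cone t x))) => // t.
    by apply: (ccts_sidet (pcts_affine A E z0 (a := t) (b := t) (c := x)
      (d := x))) => //; rewrite lexx.
  exact: (GD (fun s => cone s x) _ t (cone_cder_t t x)).
rewrite /bdint !ex // !et; ring.
Qed.

End Rectangle.

Lemma bdint_split_t f a m b c d : a <= m <= b -> c <= d -> pcts f a b c d ->
  bdint f a b c d = bdint f a m c d + bdint f m b c d.
Proof.
move=> amb cd fp; rewrite /bdint !(cint_split amb).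
- move: (cint c d _) (cint c d _) (cint c d _) (cint a m _) (cint a m _)
  (cint m b _)
    (cint m b _) => *; ring.
- by move=> t tab; apply: (ccts_sidet fp); rewrite ?lexx.
- by move=> t tab; apply: (ccts_sidet fp); rewrite ?lexx ?andbT.
Qed.

Lemma bdint_split_x f a b c m d : c <= m <= d -> a <= b -> pcts f a b c d ->
  bdint f a b c d = bdint f a b c m + bdint f a b m d.
Proof.
move=> cmd ab fp; rewrite /bdint !(cint_split cmd).
- move: (cint a b _) (cint a b _) (cint a b _) (cint c m _) (cint c m _)
  (cint m d _)
    (cint m d _) => *; ring.
- by move=> t tab; apply: (ccts_sidex fp); rewrite ?lexx.
- by move=> t tab; apply: (ccts_sidex fp); rewrite ?lexx ?andbT.
Qed.

(** Near a point, [f] differs from its tangent affine map by [eta] times the distance. On a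
    rectangle of level [n] both the distance and the side lengths are of order [2 ^- n], which gives
    the decay [4 ^- n] required by [bisection]. *)
Lemma goursat f a b c d : 0 <= a <= b -> b <= 1 -> c <= d ->
  (forall t x, a <= t <= b -> c <= x <= d -> cdiff f (cone t x)) ->
  bdint f a b c d = 0.
Proof.
move=> /andP[a0 ab] b1 cd fd; have fp := pcts_cdiff fd.
set h := b - a; set k := d - c.
have h0 : 0 <= h by rewrite subr_ge0.
have k0 : 0 <= k by rewrite subr_ge0.
have B0 : 0 <= B by exact: le_trans (normc_ge0 _) (yB 0).
have Ba : b = a + h by rewrite /h; ring.
have Dc : d = c + k by rewrite /k; ring.
have p2 n : 0 < (2 : R) ^+ n by rewrite exprn_gt0.
have hn n : 0 <= h / 2 ^+ n by rewrite divr_ge0 // ltW.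
have kn n : 0 <= k / 2 ^+ n by rewrite divr_ge0 // ltW.
pose K n s z := bdint f s (s + h / 2 ^+ n) z (z + k / 2 ^+ n).
have -> : bdint f a b c d = K 0%N a c by rewrite /K expr0 !divr1 -Ba -Dc.
apply: (@bisection _ h k) => //.
- move=> n [s z] [/= s1 s2 z1 z2]; rewrite /K /=.
  have hE := half_split h n; have kE := half_split k n.
  move: (hn n.+1) (kn n.+1) => hn1 kn1.
  have fps : pcts f s (s + h / 2 ^+ n) z (z + k / 2 ^+ n).
    by apply: pcts_sub fp => //; rewrite ?Ba ?Dc.
  rewrite (@bdint_split_x _ _ _ _ (z + k / 2 ^+ n.+1)) //; last 2 first.
  + by apply/andP; split; lra.
  + by rewrite lerDl.
  have e1 : z + k / 2 ^+ n.+1 + k / 2 ^+ n.+1 = z + k / 2 ^+ n by lra.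
  have e2 : s + h / 2 ^+ n.+1 + h / 2 ^+ n.+1 = s + h / 2 ^+ n by lra.
  rewrite e1 e2; congr (_ + _); apply: bdint_split_t; do ?[by apply/andP; split;
    lra]; do ?[lra].
    by apply: pcts_sub fps; lra.
  by apply: pcts_sub fps; lra.
- move=> t x e; rewrite -Ba -Dc => tab xcd e0.
  have [E fE] := fd t x tab xcd.
  set L := h + k; have L0 : 0 <= L by rewrite addr_ge0.
  have CK : 0 < 8 * B ^+ 2 * L ^+ 2 + 1 by rewrite ltr_wpDl // !mulr_ge0 ?sqr_ge0.
  (* [bdint_bound] will give [eta (8 B^2 L^2) / 4^n]; the summand 1 keeps the denominator
     positive. *)
  set eta := e / (8 * B ^+ 2 * L ^+ 2 + 1).
  have eta0 : 0 < eta by rewrite divr_gt0.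
  have [r r0 fr] := fE eta eta0.
  have [N NP] := pow2_small (2 * B * L) r0.
  exists N => n [s z] Nn [/= s1 s2 z1 z2] ts xz.
  change (normc (bdint f s (s + h / 2 ^+ n) z (z + k / 2 ^+ n)) <= e / 4 ^+ n).
  set s' := s + _; set z' := z + _.
  have ss' : s <= s' by rewrite lerDl.
  have zz' : z <= z' by rewrite lerDl.
  have fps : pcts f s s' z z' by apply: pcts_sub fp => //; rewrite ?Ba ?Dc.
  (* Minus the tangent map of [f] at [cone t x]; adding it does not change the integral, by
     [bdint_affine]. *)
  pose naff u := - f (cone t x) + - E * (u - cone t x).
  have -> : bdint f s s' z z' = bdint (fun u => f u + naff u) s s' z z'.
    rewrite bdintD //; last exact: pcts_affine.
    by rewrite bdint_affine // addr0.
  have lip u v : normc (cone u v - cone t x) <=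
    B * `|u - t| + `|t| * normc (y v - y x).
    have -> : cone u v - cone t x = (u - t)%:C * y v + t%:C * (y v - y x).
      by rewrite /cone rmorphB /=; ring.
    apply: le_trans (normcD _ _) _; rewrite !normcM !normc_real mulrC.
    by rewrite lerD2r ler_wpM2r.
  have ylip u v : u <= v -> normc (y v - y u) <= 2 * B * (v - u).
    by move=> uv; rewrite -(@cint_FTC _ u v y y') //; apply: cint_bound.
  have ylip' u v : normc (y v - y u) <= 2 * B * `|v - u|.
    case: (lerP u v) => uv; first exact: ylip.
    by rewrite normcB; apply: ylip; exact: ltW.
  have close u v : s <= u <= s' -> z <= v <= z' ->
    normc (cone u v - cone t x) <= 2 * B * L / 2 ^+ n.
    move=> us vz; apply: le_trans (lip u v) _.
    have ut : `|u - t| <= h / 2 ^+ n.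
      by move: ts us; rewrite /s' ler_norml => /andP[? ?] /andP[? ?]; apply/andP;
        split; lra.
    have vx : `|v - x| <= k / 2 ^+ n.
      by move: xz vz; rewrite /z' ler_norml => /andP[? ?] /andP[? ?]; apply/andP;
        split; lra.
    have t1 : `|t| <= 1 by case/andP: tab => *; rewrite ger0_norm; lra.
    have -> : 2 * B * L / 2 ^+ n = 2 * B * (h / 2 ^+ n) + 2 * B * (k / 2 ^+ n).
      by rewrite /L; ring.
    apply: lerD.
      apply: le_trans (ler_wpM2l B0 ut) _; rewrite ler_wpM2r //; lra.
    apply: le_trans (ler_wpM2r (normc_ge0 _) t1) _; rewrite mul1r.
    by apply: le_trans (ylip' _ _) _; rewrite ler_wpM2l // mulr_ge0.
  apply: le_trans (@bdint_bound _ _ _ _ ss' zz' _ (eta *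
    (2 * B * L / 2 ^+ n)) _ _ _ _) _.
  + by apply: pctsD => //; exact: pcts_affine.
  + lra.
  + by rewrite /s'; lra.
  + move=> u v us vz; have cl := close u v us vz.
    have -> : f (cone u v) + naff (cone u v) =
        f (cone u v) - f (cone t x) - E * (cone u v - cone t x) by rewrite /naff;
          ring.
    apply: le_trans (fr _ _) _; first exact: le_lt_trans cl (NP n Nn).
    by rewrite ler_wpM2l // ltW.
  have -> : s' - s + (z' - z) = L / 2 ^+ n by rewrite /s' /z' /L; ring.
  have -> : 4 * (eta * (2 * B * L / 2 ^+ n)) * B * (L / 2 ^+ n) =
      eta * (8 * B ^+ 2 * L ^+ 2) / 4 ^+ n.
    have -> : (4 : R) ^+ n = 2 ^+ n * 2 ^+ n by rewrite -exprMn; congr (_ ^+ _);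
      lra.
    have := p2 n; move: (2 ^+ n) => q q0; field; lra.
  rewrite ler_pM2r ?invr_gt0 ?exprn_gt0 // /eta mulrAC -mulrA ger_pMr //.
  by rewrite ler_pdivrMr // mul1r lerDl.
Qed.

End FormIntegral.

(** * Polynomial approximation on the bidisk *)

Section Taylor.
Variable R : realType.

Lemma derivable_cdiff (g : R[i]^o -> R[i]^o) (z : R[i]^o) : derivable g z 1 ->
  cdiff g z.
Proof.
move=> /cvg_ex[b /cvgrPdist_lt gb]; exists b => e e0.
have e0' : 0 < e%:C by rewrite ltcR.
have /nbhs_ballP[d /= d0 dg] := gb _ e0'.
have dE : d = (Re d)%:C by move: d0; case: (d) => u v;
  rewrite ltcE /= => /andP[/eqP-> _].
exists (Re d); first by move: d0; rewrite dE ltcR.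
move=> y yd; have [->|yz] := eqVneq y z.
  by rewrite !subrr mulr0 subrr normc0 mulr0.
have yz0 : y - z != 0 by rewrite subr_eq0.
have := dg (y - z); rewrite /ball /= sub0r normrN -[X in X < d]/((normc
  (y - z))%:C).
rewrite [X in _ < X]dE ltcR => /(_ yd yz0).
rewrite -[X in X < _]/((normc _)%:C) ltcR => /ltW lte.
have -> : g y - g z - b * (y - z) =
  - ((b - (y - z)^-1 *: (g ((y - z) *: 1 + z) - g z)) * (y - z)).
  rewrite {2}/GRing.scale /= mulr1 subrK /GRing.scale /=.
  by rewrite mulrBl mulrAC mulVf // mul1r opprB.
by rewrite normcN normcM ler_wpM2r // normc_ge0.
Qed.

Lemma diff_cdiff (g : R[i]^o -> R[i]^o) (z : R[i]^o) : differentiable g z ->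
  cdiff g z.
Proof. by move=> /derivable1_diffP; exact: derivable_cdiff. Qed.

Lemma normc_expi (x : R) : normc (expi x) = 1.
Proof. by rewrite /= cos2Dsin2 sqrtr1. Qed.

Lemma expiN (x : R) : expi (- x) * expi x = 1.
Proof.
rewrite /expi cosN sinN; apply: eq_ReIm => /=; last by ring.
by rewrite mulNr opprK -!expr2 cos2Dsin2.
Qed.

Lemma cder_expi (x : R) : cder (@expi R) (fun x => 'i * expi x) x.
Proof.
split=> /=.
  by rewrite mul0r mul1r sub0r; exact: is_derive_cos.
by rewrite mul0r mul1r add0r; exact: is_derive_sin.
Qed.

Lemma cder_expiN (x : R) : cder (fun x : R => expi (- x) : R[i]) (fun x =>
  - 'i * expi (- x)) x.
Proof.
have E : (fun y : R => Re (expi (- y))) = (@cos R) by apply/funext => y /=;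
  rewrite cosN.
have E' : (fun y : R => Im (expi (- y))) = - (@sin R) by apply/funext => y /=;
  rewrite sinN.
split; rewrite ?E ?E' /= oppr0 !mul0r mulN1r ?opprK ?cosN ?sinN.
  by rewrite sub0r ?opprK; exact: is_derive_cos.
by rewrite add0r; exact: is_deriveN.
Qed.

(** The integrand is periodic and its derivative is a nonzero multiple of itself. *)
Lemma cint_expiNX k : (0 < k)%N -> cint 0 (2 * pi) (fun x : R =>
  expi (- x) ^+ k : R[i]) = 0.
Proof.
move=> k0.
have dk j (x : R) : cder (fun x : R => expi (- x) ^+ j : R[i]) (fun x =>
  - 'i * j%:R * expi (- x) ^+ j) x.
  elim: j => [|j IH].
    by apply: cder_eq (cder_cst 1 x); rewrite mulr0 mul0r.
  apply: eq_cder => [y|]; first exact: exprS.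
  apply: cder_eq (cderM (cder_expiN x) IH); rewrite /= exprS -natr1; ring.
have ck j x : ccts (fun x : R =>
  expi (- x) ^+ j : R[i]) x by exact: cder_ccts (dk j x).
have := @cint_FTC _ 0 (2 * pi) _ _ _ _ (dk k).
rewrite mulr_ge0 ?pi_ge0 // => /(_ isT) H.
have {H} : cint 0 (2 * pi) (fun x : R => - 'i * k%:R * expi (- x) ^+ k : R[i]) = 0.
  rewrite H => [|x]; last by apply: cctsM => //; exact: ccts_cst.
  rewrite (_ : expi (- (2 * pi)) = expi (- 0)) ?subrr //.
  by rewrite /expi oppr0 cosN sinN mulr_natl cos2pi sin2pi cos0 sin0 oppr0.
rewrite cintZ => [/eqP|x _]; last exact: ck.
rewrite !mulf_eq0 oppr_eq0 pnatr_eq0 gtn_eqF // orbF => /orP[|/eqP//].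
by rewrite eq_complex /= oner_eq0 andbF.
Qed.

Section Cauchy.
Variables (g : R[i]^o -> R[i]^o) (s : R) (w : R[i]).
Hypotheses (gd : forall z : R[i]^o, normc z < 1 -> differentiable g z)
  (g1 : forall z : R[i], normc z < 1 -> normc (g z) <= 1).
Hypotheses (s1 : s < 1) (ws : normc w < s).

Let s0 : 0 < s. Proof.
exact: le_lt_trans (normc_ge0 _) ws. Qed.

Let y (x : R) : R[i] := s%:C * expi x - w.
Let y' (x : R) : R[i] := s%:C * ('i * expi x).

Let dy x : cder y y' x.
Proof.
apply: (@cder_eq _ _ (fun x => (0 * expi x + s%:C * ('i * expi x)) + 0)).
  by rewrite mul0r add0r addr0.
apply: cderD; last exact: cder_cst.
by apply: cderM; [exact: cder_cst|exact: cder_expi].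
Qed.

Let ce x : ccts (@expi R) x. Proof.
exact: cder_ccts (cder_expi x). Qed.

Let cy' x : ccts y' x.
Proof. by apply: cctsM; [exact: ccts_cst|apply: cctsM;
  [exact: ccts_cst|exact: ce]]. Qed.

Let nse x : normc (s%:C * expi x) = s.
Proof. by rewrite normcM normc_real gtr0_norm // normc_expi mulr1. Qed.

Let yB x : normc (y x) <= 2.
Proof. by apply: le_trans (normcD _ _) _; rewrite nse normcN; have := s1;
  have := ws; lra. Qed.

Let ylb x : s - normc w <= normc (y x).
Proof.
have := normcD (y x) w; rewrite /y subrK nse; lra.
Qed.

Let y0 x : y x != 0.
Proof. by rewrite -normc_gt0; apply: lt_le_trans (ylb x); rewrite subr_gt0. Qed.

Let ny' x : normc (y' x) = s.
Proof. by rewrite normcM normc_real gtr0_norm // normcM normc_expi /= expr0n expr1n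
  /= add0r sqrtr1 !mulr1. Qed.

Let y'B x : normc (y' x) <= 2.
Proof. rewrite ny'; have := s1; lra. Qed.

(* Goursat's lemma on the cone with apex [w] over the circle, cut off at height
   [t]: the two radial sides cancel by periodicity, and the inner side tends to
   [0] with [t] because [g] is continuous at [w]. *)
Lemma cauchy_increment : cint 0 (2 * pi)
  (fun x => y' x * ((g (s%:C * expi x) - g w) / y x)) = 0.
Proof.
set I := cint _ _ _.
pose h (z : R[i]^o) : R[i]^o := (g z - g w) / (z - w).
have pi20 : (0 : R) <= 2 * pi by rewrite mulr_ge0 ?pi_ge0.
have w1 : normc w < 1 by exact: lt_trans s1.
have cone1 t x : 0 <= t <= 1 -> normc (cone w y t x) < 1.
  move=> /andP[t0 t1].
  have -> : cone w y t x = (1 - t)%:C * w + t%:C * (s%:C * expi x).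
    by rewrite /cone /y rmorphB /=; ring.
  apply: le_lt_trans (normcD _ _) _; rewrite normcM [normc (t%:C * _)]normcM nse.
  rewrite !normc_real !ger0_norm ?subr_ge0 //.
  have : (1 - t) * normc w <= (1 - t) * s by rewrite ler_wpM2l ?subr_ge0 // ltW.
  have := s1; lra.
have hE t x : t != 0 -> h (cone w y t x) = (g (cone w y t x) - g w) / (t%:C * y x).
  by move=> _; rewrite /h /cone [w + _]addrC addrK.
have hd t x : 0 < t <= 1 -> cdiff h (cone w y t x).
  move=> /andP[t0 t1]; apply: diff_cdiff.
  have zw : cone w y t x - w != 0.
    rewrite /cone [w + _]addrC addrK mulf_neq0 //.
    by rewrite -normc_gt0 normc_real normr_gt0 gt_eqF.
  apply: differentiableM.
    apply: differentiableB; last exact: differentiable_cst.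
    by apply: gd; apply: cone1; rewrite ltW.
  by apply: differentiableV => //; apply: differentiableB => //;
    exact: differentiable_cst.
have y2pi : y (2 * pi) = y 0.
  by rewrite /y /expi mulr_natl cos2pi sin2pi cos0 sin0.
have Ieq t : 0 < t <= 1 -> I = cint 0 (2 * pi) (fun x =>
  t%:C * y' x * h (cone w y t x)).
  move=> /andP[t0 t1].
  have := @goursat R w y y' 2 dy cy' yB y'B h t 1 0 (2 * pi).
  rewrite ltW //= => /(_ t1 (lexx _) pi20) H.
  have {}H : bdint w y y' h t 1 0 (2 * pi) = 0.
    by apply: H => u x /andP[tu u1] _; apply: hd; rewrite u1 (lt_le_trans t0).
  move: H; rewrite /bdint {1 2}/cone y2pi.
  rewrite (_ : cint t 1 (fun u =>
    y 0 * h (cone w y u (2 * pi))) = cint t 1 (fun u => y 0 * h (cone w y u 0))).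
    rewrite addrNK => /eqP; rewrite subr_eq0 => /eqP <-.
    apply: eq_cint => x _; rewrite !mul1r; congr (_ * _).
    by rewrite /h [w + _]addrC addrK /y subrK.
  by apply: eq_cint => u _; rewrite /cone y2pi.
apply/eqP; rewrite -normc_eq0; apply: contraT => I0.
have {}I0 : 0 < normc I by rewrite lt_def I0 normc_ge0.
have sw : 0 < s - normc w by rewrite subr_gt0.
(* With this bound on the increment of [g], [cint_bound] yields [normc I <= normc I / 2]. *)
set e := normc I * (s - normc w) / (8 * pi).
have pi0 := pi_gt0 R.
have e0 : 0 < e by rewrite divr_gt0 ?mulr_gt0.
have [d d0 gde] := cdiff_cts (diff_cdiff (gd w1)) e0.
(* As [normc (y x) <= 2], the inner curve stays within [2 d / 3 < d] of [w]. *)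
pose t := Num.min 1 (d / 3).
have t0 : 0 < t by rewrite lt_min ltr01 divr_gt0.
have t1 : t <= 1 by rewrite ge_min lexx.
have td : t <= d / 3 by rewrite ge_min lexx orbT.
have := @cint_bound R 0 (2 * pi) (fun x =>
  t%:C * y' x * h (cone w y t x)) (e / (s - normc w)) pi20.
rewrite -Ieq ?t0 // => H.
have {}H : normc I <= 2 * (e / (s - normc w)) * (2 * pi - 0).
  apply: H => x _.
    apply: cctsM; first by apply: cctsM => //; exact: ccts_cst.
    by apply: ccts_comp; [apply: hd;
      rewrite t0|exact: cder_ccts (cone_cder_x w dy t x)].
  rewrite hE ?gt_eqF // normcM [normc (t%:C * y' x)]normcM ny' [X in _ * X <=
    _]normcM.
  rewrite normcV [normc (t%:C * y x)]normcM normc_real gtr0_norm //.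
  (* The [t] of the differential cancels the [t] of the difference quotient, so smallness comes from
     the increment of [g] alone. *)
  have -> : t * s * (normc (g (cone w y t x) - g w) / (t * normc (y x))) =
            s * normc (g (cone w y t x) - g w) / normc (y x).
    have := y0 x; rewrite -normc_eq0 => yx0; field; by rewrite yx0 gt_eqF.
  rewrite ler_pM ?invr_ge0 ?mulr_ge0 ?normc_ge0 ?(ltW s0) //.
    apply: le_trans (ler_piMl (normc_ge0 _) (ltW s1)) _; apply/ltW/gde.
    rewrite /cone [w + _]addrC addrK normcM normc_real gtr0_norm //.
    apply: le_lt_trans (ler_pM (ltW t0) (normc_ge0 _) td (yB x)) _; lra.
  by rewrite lef_pV2 ?posrE ?normc_gt0.
move: H; rewrite {1}/e.
have aux (p : R) : 0 < p ->
    2 * (normc I * (s - normc w) / (8 * p) / (s - normc w)) * (2 * p - 0) =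
      normc I / 2.
  by move=> p0; field; rewrite !gt_eqF.
rewrite aux //; lra.
Qed.

(** Cauchy's formula for the Taylor coefficients at 0, on the circle of radius [s]. *)
Definition taylor_coef k : R[i] := (2 * pi)^-1%:C *
  cint 0 (2 * pi) (fun x => g (s%:C * expi x) * (s^-1%:C * expi (- x)) ^+ k).

(** With [v = 1 / (s e^(ix))], the kernel of [cauchy_increment] is [1 / (1 - w v)]; expanding it as
    a geometric sum of [N] terms plus a remainder makes no use of infinite series. In the constant
    4, one factor 2 bounds [g - g w] and the other is that of [cint_bound]. *)
Lemma taylor_approx N : (0 < N)%N ->
  normc (g w - \sum_(k < N) taylor_coef k * w ^+ k) <=
  4 * ((normc w / s) ^+ N / (1 - normc w / s)).
Proof.
move=> N0; pose v (x : R) : R[i] := s^-1%:C * expi (- x).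
set r := normc w / s.
have r1 : r < 1 by rewrite ltr_pdivrMr // mul1r.
have r0 : 0 <= r by rewrite divr_ge0 ?normc_ge0 // ltW.
have pi0 := pi_gt0 R.
have pi20 : (0 : R) <= 2 * pi by rewrite mulr_ge0 ?pi_ge0.
have w1 : normc w < 1 by exact: lt_trans s1.
have sE0 : s%:C != 0 :> R[i] by rewrite -normc_gt0 normc_real normr_gt0 gt_eqF.
have vE x : s%:C * expi x * v x = 1.
  rewrite /v fmorphV mulrACA mulfV // mul1r mulrC; exact: expiN.
have nv x : normc (w * v x) = r.
  by rewrite !normcM normc_real normc_expi mulr1 gtr0_norm ?invr_gt0.
have q0 x : 1 - w * v x != 0.
  rewrite -normc_gt0; have := normcD (1 - w * v x) (w * v x).
  by rewrite subrK nv normc1; lra.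
have q_lb x : 1 - r <= normc (1 - w * v x).
  by have := normcD (1 - w * v x) (w * v x); rewrite subrK nv normc1; lra.
have yE x : y x = s%:C * expi x * (1 - w * v x).
  by rewrite mulrBr mulr1 mulrCA vE mulr1.
pose G x := g (s%:C * expi x).
have cG x : ccts G x.
  apply: (ccts_comp (c := fun x => s%:C * expi x)).
    by apply: diff_cdiff; apply: gd; rewrite nse.
  by apply: cctsM; [exact: ccts_cst|exact: ce].
have ceN x : ccts (fun x : R =>
  expi (- x) : R[i]) x by exact: cder_ccts (cder_expiN x).
have cv x : ccts v x by apply: cctsM; [exact: ccts_cst|exact: ceN].
have cvk k x : ccts (fun x => v x ^+ k) x by exact: cctsX.
pose E x := (G x - g w) * ((w * v x) ^+ N / (1 - w * v x)).
have cq x : ccts (fun x => 1 - w * v x) x.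
  apply: (@eq_ccts _ _ (fun x => 1 + (- w) * v x)) => [z|]; first by rewrite mulNr.
  by apply: cctsD; [exact: ccts_cst|apply: cctsM => //; exact: ccts_cst].
have cE x : ccts E x.
  apply: cctsM; first by apply: cctsD => //; exact: ccts_cst.
  apply: cctsM.
    by apply: cctsX; apply: cctsM => //; exact: ccts_cst.
  apply: (ccts_comp (g := GRing.inv)) => //; apply: (@diff_cdiff GRing.inv).
  exact: differentiable_Rinv.
have cT k x : ccts (fun x =>
  w ^+ k * (G x * v x ^+ k) + (- g w * w ^+ k) * v x ^+ k) x.
  by apply: cctsD; apply: cctsM;
    [exact: ccts_cst|exact: cctsM|exact: ccts_cst|exact: cvk].
have cI k : cint 0 (2 * pi) (fun x => v x ^+ k) = (k == 0%N)%:R * (2 * pi)%:C.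
  case: k => [|k].
    rewrite mul1r (@cint_FTC _ _ _ (fun x => x%:C) (fun=> 1)) ?subr0 //.
    - by move=> x; exact: ccts_cst.
    - exact: real_cder.
  rewrite mul0r; transitivity (s^-1%:C ^+ k.+1 * cint 0 (2 * pi) (fun x : R =>
    expi (- x) ^+ k.+1 : R[i])).
    rewrite -cintZ => [|x _]; last exact: cctsX.
    by apply: eq_cint => x _; rewrite exprMn.
  by rewrite cint_expiNX ?mulr0.
have key : 0 = (2 * pi)%:C * (\sum_(k < N) taylor_coef k * w ^+ k - g w) +
  cint 0 (2 * pi) E.
  (* Here [y' / y = 'i / (1 - w v)], and the factor ['i] is divided out. *)
  have e1 : cint 0 (2 * pi) (fun x => (G x - g w) / (1 - w * v x)) = 0.
    have := cauchy_increment.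
    rewrite (@eq_cint _ _ _ _ (fun x => 'i * ((G x - g w) / (1 - w * v x)))) =>
      [|x _].
      rewrite cintZ => [/eqP|x _].
        rewrite mulf_eq0 => /orP[|/eqP//].
        by rewrite eq_complex /= oner_eq0 andbF.
      apply: cctsM; first by apply: cctsD => //; exact: ccts_cst.
      apply: (ccts_comp (g := GRing.inv)) => //; apply: (@diff_cdiff GRing.inv).
      exact: differentiable_Rinv.
    rewrite yE /y' -/(G x); field; rewrite q0 sE0 /= andbT.
    by rewrite -normc_gt0 normc_expi.
  rewrite -[LHS]e1.
  rewrite (@eq_cint _ _ _ _ (fun x =>
    \sum_(k < N) (w ^+ k * (G x * v x ^+ k) + (- g w * w ^+ k) * v x ^+ k) + E x)).
    rewrite cintD => [|x _|x _]; last 2 first.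
    - by apply: ccts_sum => k; exact: cT.
    - exact: cE.
    congr (_ + _).
    rewrite (@cint_sum _ _ _ N (fun k x =>
      w ^+ k * (G x * v x ^+ k) + (- g w * w ^+ k) * v x ^+ k)).
      under eq_bigr => k _.
        rewrite cintD => [|x _|x _]; last 2 first.
        - by apply: cctsM; [exact: ccts_cst|exact: cctsM].
        - by apply: cctsM => //; exact: ccts_cst.
        rewrite cintZ => [|x _]; last exact: cctsM.
        rewrite cintZ => [|x _]; last exact: cvk.
        rewrite cI.
      over.
      rewrite big_split /= mulrBr; congr (_ + _).
        rewrite mulr_sumr; apply: eq_bigr => k _; rewrite /taylor_coef fmorphV.
        have : (2 * pi)%:C != 0 :> R[i] by rewrite -normc_gt0 normc_real normr_gt0
          mulf_neq0 // gt_eqF.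
        by move=> p0; rewrite !mulrA mulfV // mul1r mulrC.
      (* Only [k = 0] contributes to the multiple of [g w], whence the condition [0 < N]. *)
      case: N N0 => // n _ in E cE *; rewrite big_ord_recl big1 => [|k _].
        by rewrite /= !expr0 !mulr1 mul1r addr0 mulNr mulrC.
      by rewrite /= mul0r mulr0.
    by move=> k x _; exact: cT.
  move=> x _; rewrite /E.
  have -> : \sum_(k < N) (w ^+ k * (G x * v x ^+ k) + - g w * w ^+ k * v x ^+ k) =
     (G x - g w) * \sum_(k < N) (w * v x) ^+ k.
    by rewrite mulr_sumr; apply: eq_bigr => k _; rewrite [(w * v x) ^+ k]exprMn;
      move: (v x ^+ k) => vk; ring.
  rewrite -mulrDr; congr (_ * _); apply: (mulIf (q0 x)).
  rewrite mulVf // mulrDl divfK // -[1 - _]opprB mulrN mulrC -subrX1.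
  by rewrite opprB subrK.
have nE : normc (cint 0 (2 * pi) E) <= 2 * (2 * (r ^+ N / (1 - r))) * (2 * pi - 0).
  apply: cint_bound => // x _; rewrite !normcM normcX normcV nv.
  apply: ler_pM; rewrite ?normc_ge0 ?mulr_ge0 ?exprn_ge0 ?invr_ge0 ?normc_ge0 //.
    apply: le_trans (normcD _ _) _; rewrite normcN.
    by have := g1 w1; have := g1 (z := s%:C * expi x); rewrite nse => /(_ s1);
      rewrite /G; lra.
  rewrite ler_wpM2l ?exprn_ge0 // lef_pV2 ?posrE ?normc_gt0 //; lra.
move: key => /esym/eqP; rewrite addrC addr_eq0 -mulrN opprB => /eqP key.
move: nE; rewrite key normcM normc_real subr0 ger0_norm //.
set a := normc _; set b := r ^+ N / _ => H.
have {}H : (2 * pi) * a <= (2 * pi) * (4 * b) by lra.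
by move: H; rewrite ler_pM2l // mulr_gt0.
Qed.

End Cauchy.
End Taylor.

(** ['X^M - 1] is separable because [M] is nonzero in [C], and [M] distinct roots of unity of order
    dividing [M] include a primitive one. *)
Lemma prim_root_exists (C : numClosedFieldType) M : (0 < M)%N ->
  {w : C | M.-primitive_root w}.
Proof.
move=> M0; have [rs rsE] := closed_field_poly_normal ('X^M - 1 : {poly C}).
have rs1 : 'X^M - 1 = \prod_(z <- rs) ('X - z%:P) :> {poly C}.
  by rewrite {1}rsE lead_coefDl ?lead_coefXn ?scale1r // size_polyXn size_polyN
    size_poly1.
have urs : uniq rs.
  by rewrite -separable_prod_XsubC -rs1 separable_Xn_sub_1 // pnatr_eq0 -lt0n.
have szrs : size rs = M.
  by have /eqP := size_prod_XsubC rs id; rewrite -rs1 size_XnsubC // eqSS => /eqP.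
have /hasP/sig2W[w _ ?] : has M.-primitive_root rs; last by exists w.
apply: cyclic.has_prim_root; rewrite ?szrs //.
by apply/allP => z zrs; rewrite /root_of_unity rs1 root_prod_XsubC.
Qed.

(** * Interpolation at roots of unity *)

Section Interpolation.
Variable R : realType.

Section Nodes.
Variables (M : nat) (om : R[i]) (r rho s : R).
Hypotheses (M0 : (0 < M)%N) (omP : M.-primitive_root om).
Hypotheses (r0 : 0 <= r) (rrho : r < rho) (rhos : rho < s) (s1 : s < 1).

Let rho0 : 0 < rho. Proof.
exact: le_lt_trans rrho. Qed.
Let rhoC : rho%:C != 0 :> R[i].
Proof. by rewrite -normc_gt0 normc_real normr_gt0 gt_eqF. Qed.

Lemma normc_root : normc om = 1.
Proof.
have : normc om ^+ M == 1 by rewrite -normcX (prim_expr_order omP) normc1.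
by rewrite pexpr_eq1 ?normc_ge0 // => /eqP.
Qed.

Let om0 : om != 0. Proof.
by rewrite -normc_gt0 normc_root. Qed.

Definition sample (l : nat) : R[i] := rho%:C * om ^+ l.

Lemma normc_sample l : normc (sample l) = rho.
Proof. by rewrite normcM normc_real normcX normc_root expr1n mulr1 gtr0_norm. Qed.

(* Exact on polynomials of degree less than [M], like Lagrange interpolation at
   the [M] sample points, and bounded uniformly in [M] on smaller disks because
   its kernel is a truncated geometric series. *)
Definition interp (g : R[i] -> R[i]) (z : R[i]) : R[i] :=
  M%:R^-1 * \sum_(l < M) g (sample l) * \sum_(i < M) (z / sample l) ^+ i.

Lemma root_sum (k : nat) : \sum_(l < M) (om ^+ k) ^+ l =
  if (M %| k)%N then M%:R else 0.
Proof.
case: ifP => Mk.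
  have -> : om ^+ k = 1 by apply/eqP; rewrite -(prim_order_dvd omP).
  by under eq_bigr do rewrite expr1n; rewrite sumr_const card_ord.
apply/eqP; have : (om ^+ k) ^+ M - 1 == 0.
  by rewrite -exprM mulnC exprM (prim_expr_order omP) expr1n subrr.
by rewrite subrX1 mulf_eq0 subr_eq0 -(prim_order_dvd omP) Mk.
Qed.

(** Orthogonality of the powers of [om]. The exponent [k - i] is written [k + (M - i)] to stay in
    [nat]; it lies strictly between 0 and [2 M], so [M] divides it only if [k = i]. *)
Lemma interp_poly (c : nat -> R[i]) z :
  interp (fun x => \sum_(k < M) c k * x ^+ k) z = \sum_(k < M) c k * z ^+ k.
Proof.
have inner (k i : 'I_M) : \sum_(l < M) (sample l ^+ k * (z / sample l) ^+ i) =
    if k == i then M%:R * z ^+ k else 0.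
  transitivity (rho%:C ^+ k / rho%:C ^+ i * z ^+ i * \sum_(l < M) (om ^+ (k +
    (M - i))) ^+ l).
    rewrite mulr_sumr; apply: eq_bigr => l _; rewrite /sample.
    have -> : (om ^+ (k + (M - i))) ^+ l = (om ^+ l) ^+ k / (om ^+ l) ^+ i.
      have -> : om ^+ (k + (M - i)) = om ^+ k / om ^+ i.
        apply: (mulIf (expf_neq0 i om0)); rewrite divfK ?expf_neq0 // -exprD.
        by rewrite -addnA subnK ?(ltnW (ltn_ord i)) // exprD
          (prim_expr_order omP) mulr1.
      by rewrite expr_div_n -!exprM ![(_ * l)%N]mulnC.
    rewrite !exprMn exprVn !exprMn; field.
    by rewrite !expf_neq0.
  rewrite root_sum; case: eqVneq => [->|ki].
    rewrite subnKC ?(ltnW (ltn_ord i)) // dvdnn mulfV ?expf_neq0 // mul1r mulrC //.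
  case: ifP => [/dvdnP[q Mk]|_]; last by rewrite mulr0.
  case/eqP: ki; apply/val_inj => /=; move: (ltn_ord k) (ltn_ord i) Mk.
  by case: q => [|[|q]]; rewrite ?mulSn; lia.
rewrite /interp; under eq_bigr => l _ do rewrite mulr_suml.
rewrite exchange_big mulr_sumr; apply: eq_bigr => k _ /=.
rewrite (eq_bigr (fun l : 'I_M =>
  \sum_(i < M) c k * (sample l ^+ k * (z / sample l) ^+ i))).
  rewrite exchange_big /= (bigD1 k) //= [X in _ + X]big1 ?addr0 => [|i ik].
    by rewrite -mulr_sumr inner eqxx mulrCA mulrA mulrA mulfVK // pnatr_eq0 -lt0n.
  by rewrite -mulr_sumr inner eq_sym (negbTE ik) mulr0.
by move=> l _; rewrite mulr_sumr; apply: eq_bigr => i _; rewrite mulrA.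
Qed.

Let B := (1 - r / rho)^-1.

Let rr : 0 <= r / rho < 1.
Proof. by rewrite divr_ge0 ?(ltW rho0) //= ltr_pdivrMr // mul1r. Qed.

Lemma interp_bound (h : R[i] -> R[i]) e z : normc z <= r -> 0 <= e ->
  (forall l, (l < M)%N -> normc (h (sample l)) <= e) -> normc (interp h z) <= e * B.
Proof.
move=> zr e0 he; case/andP: rr => q0 q1.
have geo : \sum_(i < M) (r / rho) ^+ i <= B.
  have d0 : 0 < 1 - r / rho by rewrite subr_gt0.
  rewrite /B -[leRHS]mul1r ler_pdivlMr //.
  have := subrX1 (r / rho) M; have : 0 <= (r / rho) ^+ M by rewrite exprn_ge0.
  move: (\sum_(i < M) _) (_ ^+ M) => S p; nra.
rewrite /interp normcM normcV.
have -> : normc (M%:R : R[i]) =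
  M%:R by rewrite -(rmorph_nat (real_complex R)) normc_real normr_nat.
rewrite ler_pdivrMl ?ltr0n //.
apply: le_trans (normc_sum _ _ _) _.
have -> : M%:R * (e * B) =
  \sum_(l < M) e * B by rewrite sumr_const card_ord mulr_natl.
apply: ler_sum => l _; rewrite normcM ler_pM ?normc_ge0 // ?he //.
apply: le_trans (normc_sum _ _ _) _; apply: le_trans geo; apply: ler_sum => i _.
rewrite normcX normcM normcV normc_sample lerXn2r ?nnegrE ?divr_ge0 ?normc_ge0
  ?(ltW rho0) //.
by rewrite ler_pM2r ?invr_gt0.
Qed.

(** [interp] reproduces the Taylor polynomial [T], so the error is that of [g - T], once at [z] and
    once at the samples. Three radii are needed: [z] lies within [r], the samples on [rho], and the
    Cauchy integral for [T] runs over [s]. *)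
Lemma interp_approx (g : R[i]^o -> R[i]^o) z :
  (forall u : R[i]^o, normc u < 1 -> differentiable g u) ->
  (forall u : R[i], normc u < 1 -> normc (g u) <= 1) -> normc z <= r ->
  normc (g z - interp g z) <= 4 * ((rho / s) ^+ M / (1 - rho / s)) * (1 + B).
Proof.
move=> gd g1 zr; have s0 : 0 < s by exact: lt_trans rhos.
have qs : 0 <= rho / s < 1.
  by rewrite divr_ge0 ?(ltW rho0) ?(ltW s0) //= ltr_pdivrMr // mul1r.
set E := 4 * _; have E0 : 0 <= E.
  rewrite /E !mulr_ge0 ?exprn_ge0 ?invr_ge0 //; first by case/andP: qs.
  by rewrite subr_ge0 ltW //; case/andP: qs.
pose T (u : R[i]) := \sum_(k < M) taylor_coef g s k * u ^+ k.
have gT (u : R[i]) : normc u <= rho -> normc (g u - T u) <= E.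
  move=> ur; have us : normc u < s by exact: le_lt_trans rhos.
  apply: le_trans (taylor_approx gd g1 s1 us M0) _; rewrite ler_pM2l ?ltr0n //.
  case/andP: qs => q0 q1.
  have uq : normc u / s <= rho / s by rewrite ler_pM2r ?invr_gt0.
  rewrite ler_pM ?exprn_ge0 ?divr_ge0 ?normc_ge0 ?(ltW s0) ?invr_ge0 //.
  - by rewrite subr_ge0 (le_trans uq) // ltW.
  - by rewrite lerXn2r // ?nnegrE ?divr_ge0 ?normc_ge0 ?(ltW s0).
  - by rewrite lef_pV2 ?posrE ?subr_gt0 // ?(le_lt_trans uq) //; lra.
have -> : g z - interp g z = (g z - T z) - interp (fun u => g u - T u) z.
  have -> : interp (fun u => g u - T u) z = interp g z - interp T z.
    rewrite /interp -mulrBr -sumrB; congr (_ * _); apply: eq_bigr => l _.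
    by rewrite mulrBl.
  by rewrite interp_poly -/(T z); ring.
apply: le_trans (normcD _ _) _; rewrite normcN mulrDr mulr1; apply: lerD.
  by apply: gT; apply: le_trans zr _; exact: ltW.
by apply: interp_bound => // l _; apply: gT; rewrite normc_sample.
Qed.

End Nodes.
End Interpolation.

(** * Approximation in two variables *)

Section PolynomialApproximation.
Variable R : realType.
Variable F : cplx2 R -> cplx R.
Hypothesis Fd : forall z : cplx2 R,
  normc z.1 < 1 -> normc z.2 < 1 -> differentiable F z.
Hypothesis F1 : forall z : cplx2 R,
  normc z.1 < 1 -> normc z.2 < 1 -> normc (F z) <= 1.

Lemma diff_slice1 (z w : cplx R) : differentiable F (z, w) ->
  differentiable (fun u : cplx R => F (u, w)) z.
Proof.
move=> Fzw; apply: (@differentiable_comp _ _ _ _ (fun u => (u, w)) F) => //.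
Qed.

Lemma diff_slice2 (z w : cplx R) : differentiable F (z, w) ->
  differentiable (fun u : cplx R => F (z, u)) w.
Proof.
move=> Fzw; apply: (@differentiable_comp _ _ _ _ (fun u => (z, u)) F) => //.
Qed.

(** Interpolate in [z] for fixed [w], then replace the sampled slices by their interpolants in [w];
    the uniform bound [B] of the operator controls the second error. Only slices of [F] are used, so
    no double series or integral occurs. *)
Lemma interp2_approx (r e : R) : 0 <= r < 1 -> 0 < e ->
  exists d, exists c : nat -> nat -> R[i], forall z w : R[i],
    normc z <= r -> normc w <= r ->
    normc (F (z, w) - \sum_(i < d) \sum_(j < d) c i j * z ^+ i * w ^+ j) <= e.
Proof.
move=> /andP[r0 r1] e0.
pose rho := r + (1 - r) / 3; pose s := r + (1 - r) / 3 *+ 2.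
have rrho : r < rho by rewrite /rho; lra.
have rhos : rho < s by rewrite /rho /s; lra.
have s1 : s < 1 by rewrite /s; lra.
have rho0 : 0 < rho by lra.
have s0 : 0 < s by lra.
pose B := (1 - r / rho)^-1; pose q := rho / s.
have q0 : 0 <= q by rewrite divr_ge0 // ltW.
have q1 : q < 1 by rewrite ltr_pdivrMr // mul1r.
have B0 : 0 < B by rewrite invr_gt0 subr_gt0 ltr_pdivrMr // mul1r.
(* One power of [1 + B] is in the error [E] of each variable, the other sums the errors [E] and
   [E * B] of the two stages. *)
pose K := 4 / (1 - q) * (1 + B) ^+ 2.
have K0 : 0 < K by rewrite !mulr_gt0 ?invr_gt0 ?subr_gt0 ?exprn_gt0 ?addr_gt0.
have [M M0 qM] : exists2 M, (0 < M)%N & q ^+ M * K <= e.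
  have /cvgrPdist_lt/(_ (e / K)) : q ^+ M @[M --> \oo] --> 0.
    by apply: cvg_expr; rewrite ger0_norm.
  rewrite divr_gt0 // => /(_ isT)[M _ MP]; exists M.+1 => //.
  have := MP M.+1 (leqnSn M); rewrite /= sub0r normrN ger0_norm ?exprn_ge0 //.
  by rewrite ltr_pdivlMr // => /ltW.
have [om omP] := @prim_root_exists (R[i]) M M0.
pose x l := sample om rho l.
have xr l : normc (x l) = rho := normc_sample M0 omP r0 rrho l.
exists M, (fun i j => M%:R^-1 * M%:R^-1 *
   \sum_(l < M) \sum_(k < M) F (x l, x k) * (x l)^-1 ^+ i * (x k)^-1 ^+ j).
move=> z w zr wr.
set P := \sum_(i < M) _.
have rho1 : rho < 1 by lra.
have w1 : normc w < 1 by lra.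
pose E := 4 * (q ^+ M / (1 - q)) * (1 + B).
have E0 : 0 <= E.
  by rewrite /E !mulr_ge0 ?exprn_ge0 ?invr_ge0 ?subr_ge0 ?addr_ge0 // ltW.
have a1 : normc (F (z, w) - interp M om rho (fun u => F (u, w)) z) <= E.
  apply: (@interp_approx _ _ _ _ _ _ M0 omP r0 rrho rhos s1 (fun u => F (u, w))) =>
    //.
    by move=> u u1; apply: diff_slice1; exact: Fd.
  by move=> u u1; exact: (F1 (z := (u, w))).
pose G u := interp M om rho (fun v => F (u, v)) w.
have a2 (u : R[i]) : normc u < 1 -> normc (F (u, w) - G u) <= E.
  move=> u1.
  apply: (@interp_approx _ _ _ _ _ _ M0 omP r0 rrho rhos s1 (fun v => F (u, v))) =>
    //.
    by move=> v v1; apply: diff_slice2; exact: Fd.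
  by move=> v v1; exact: (F1 (z := (u, v))).
have PE : P = interp M om rho G z.
  rewrite /interp /P mulr_sumr.
  rewrite [RHS](eq_bigr (fun l : 'I_M => \sum_(i < M) \sum_(j < M) \sum_(k < M)
     M%:R^-1 * M%:R^-1 * (F (x l,
       x k) * (x l)^-1 ^+ i * (x k)^-1 ^+ j) * z ^+ i * w ^+ j)); last first.
    move=> l _; rewrite /G /interp mulr_sumr mulr_sumr; apply: eq_bigr => i _.
    rewrite exchange_big /= mulr_sumr mulr_suml mulr_sumr; apply: eq_bigr => k _.
    rewrite !mulr_sumr mulr_suml mulr_sumr; apply: eq_bigr => j _.
    rewrite !exprMn -/(x l) -/(x k); ring.
  rewrite [RHS]exchange_big; apply: eq_bigr => i _.
  rewrite [RHS]exchange_big; apply: eq_bigr => j _ /=.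
  rewrite mulr_sumr !mulr_suml; apply: eq_bigr => l _.
  by rewrite mulr_sumr !mulr_suml.
have a3 : normc (interp M om rho (fun u => F (u, w)) z - P) <= E * B.
  have -> : interp M om rho (fun u => F (u, w)) z - P = interp M om rho (fun u =>
    F (u, w) - G u) z.
    rewrite PE /interp -mulrBr -sumrB; congr (_ * _); apply: eq_bigr => l _.
    by rewrite mulrBl.
  apply: (interp_bound M0 omP r0 rrho) => // l _; apply: a2.
  by rewrite (normc_sample M0 omP r0 rrho).
rewrite -(subrK (interp M om rho (fun u => F (u, w)) z) (F (z, w))) -addrA.
apply: le_trans (normcD _ _) _; apply: le_trans (lerD a1 a3) _.
apply: le_trans qM; rewrite /E /K le_eqVlt; apply/orP; left; apply/eqP.
have : 1 - q != 0 by rewrite subr_eq0 gt_eqF.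
by move=> ?; field.
Qed.

(** Three errors of [e / 3]: [F] is dilated by [r < 1], the dilation is approximated on the closed
    bidisk by a polynomial, and this polynomial, of modulus at most [1 + e / 3], is divided by that
    bound. *)
Lemma poly_approx n (a b : 'I_n -> R[i]) (e : R) :
  (forall k, normc (a k) < 1) -> (forall k, normc (b k) < 1) -> 0 < e ->
  exists d, exists c : nat -> nat -> R[i],
    (forall z w : R[i], normc z = 1 -> normc w = 1 ->
      normc (\sum_(i < d) \sum_(j < d) c i j * z ^+ i * w ^+ j) <= 1) /\
    forall k, normc (\sum_(i < d) \sum_(j < d) c i j * a k ^+ i * b k ^+ j - F
      (a k, b k)) <= e.
Proof.
move=> a1 b1 e0.
have near k : exists2 d : R, 0 < d <= 1 & forall r : R, 1 - d < r < 1 ->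
    normc (F (r%:C * a k, r%:C * b k) - F (a k, b k)) <= e / 3.
  have := @differentiable_continuous _ _ _ _ _ (Fd (z := (a k, b k)) (a1 k) (b1 k)).
  move=> /cvgrPdist_lt/(_ (e / 3)%:C); rewrite ltcR divr_gt0 // => /(_ isT).
  move=> /nbhs_ballP[d /= d0 dF].
  have dE : d = (Re d)%:C by move: d0; case: (d) => u v;
    rewrite ltcE /= => /andP[/eqP-> _].
  have rd0 : 0 < Re d by move: d0; rewrite dE ltcR.
  exists (Num.min 1 (Re d)); first by rewrite lt_min ltr01 rd0 ge_min lexx.
  move=> r /andP[rd r1].
  have rd1 : 1 - r < Num.min 1 (Re d) by lra.
  have r0 : 0 < r by move: rd1; rewrite lt_min => /andP[]; lra.
  have bl (u : R[i]) : normc u < 1 -> normc (u - r%:C * u) < Re d.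
    move=> u1; rewrite -{1}[u]mul1r -mulrBl normcM -(rmorph1
      (real_complex R)) -rmorphB.
    rewrite normc_real ger0_norm; last lra.
    apply: (@le_lt_trans _ _ (1 - r)); last by move: rd1; rewrite lt_min => /andP[].
    by rewrite ler_piMr ?ltW //; lra.
  have := dF (r%:C * a k, r%:C * b k); rewrite /ball /= /prod_ball /= => H.
  rewrite normcB -lecR; apply/ltW/H; rewrite /ball /=.
  by split; rewrite -[X in X < _]/((normc _)%:C) dE ltcR; apply: bl.
have [dd ddP H] := fin_all_exists2 near.
pose d := \big[Num.min/1]_k dd k.
have d01 : 0 < d <= 1.
  rewrite /d; elim/big_ind: _ => [|x y /andP[x0 x1] /andP[y0 y1]|k _];
    first by rewrite ltr01 lexx.
    by rewrite lt_min x0 y0 ge_min x1.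
  exact: ddP.
pose r := 1 - d / 2.
have r01 : 0 <= r < 1 by rewrite /r; case/andP: d01 => *; apply/andP; split; lra.
have rk k : normc (F (r%:C * a k, r%:C * b k) - F (a k, b k)) <= e / 3.
  apply: H => //.
  have : d <= dd k by exact: bigmin_le.
  by rewrite /r; case/andP: d01 => *; apply/andP; split; lra.
case/andP: r01 => r0 r1.
have e30 : 0 < e / 3 by rewrite divr_gt0.
have [N [c cF]] := @interp2_approx r (e / 3) (introT andP (conj r0 r1)) e30.
pose t := (1 + e / 3)^-1.
have t0 : 0 < t by rewrite invr_gt0; lra.
exists N, (fun i j => t%:C * c i j * (r%:C ^+ i * r%:C ^+ j)).
have PE (z w : R[i]) : \sum_(i < N) \sum_(j < N) t%:C * c i j *
  (r%:C ^+ i * r%:C ^+ j) * z ^+ i * w ^+ j =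
   t%:C * \sum_(i < N) \sum_(j < N) c i j * (r%:C * z) ^+ i * (r%:C * w) ^+ j.
  rewrite mulr_sumr; apply: eq_bigr => i _; rewrite mulr_sumr;
    apply: eq_bigr => j _.
  by rewrite !exprMn; ring.
have nr (z : R[i]) : normc z <= 1 -> normc (r%:C * z) <= r.
  by move=> z1; rewrite normcM normc_real ger0_norm // ler_piMr.
have bd (z w : R[i]) : normc z <= 1 -> normc w <= 1 ->
    normc (\sum_(i < N) \sum_(j < N) c i j * (r%:C * z) ^+ i * (r%:C * w) ^+ j) <=
      1 + e / 3.
  move=> z1 w1; set P := \sum_(i < N) _.
  have := cF _ _ (nr _ z1) (nr _ w1); rewrite -/P => FP.
  have F1' : normc (F (r%:C * z, r%:C * w)) <= 1.
    by apply: F1 => /=; apply: le_lt_trans (nr _ _) r1.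
  have := normcD (F (r%:C * z, r%:C * w)) (P - F (r%:C * z, r%:C * w)).
  rewrite addrC subrK [normc (P - _)]normcB; lra.
split=> [z w z1 w1|k].
  rewrite PE normcM normc_real gtr0_norm // mulrC ler_pdivrMr ?mul1r; last lra.
  by apply: bd; rewrite ?z1 ?w1.
rewrite PE; set P := \sum_(i < N) _.
have Pb : normc P <= 1 + e / 3 by apply: bd; exact: ltW.
have PF : normc (F (r%:C * a k, r%:C * b k) - P) <= e / 3 by apply: cF; apply: nr;
  exact: ltW.
have -> : t%:C * P - F (a k, b k) = (t%:C - 1) * P - (F (r%:C * a k,
  r%:C * b k) - P) +
   (F (r%:C * a k, r%:C * b k) - F (a k, b k)) by ring.
apply: le_trans (normcD _ _) _; apply: le_trans (lerD (normcD _ _) (rk k)) _.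
rewrite normcN normcM -(rmorph1 (real_complex R)) -rmorphB normc_real.
have te : t * (1 + e / 3) = 1 by rewrite mulVf //; lra.
have t1 : t <= 1 by rewrite invf_le1; lra.
have -> : `|t - 1| = 1 - t by rewrite distrC ger0_norm //; lra.
have : (1 - t) * normc P <= (1 - t) * (1 + e / 3) by rewrite ler_wpM2l //; lra.
move: PF; move: (normc (_ - _)) => X; move: ((1 - t) * normc P) => Y; lra.
Qed.

End PolynomialApproximation.

(** * Agler decomposition *)

Section AnalyticVonNeumann.
Variable R : realType.
Local Notation C := R[i].

Lemma normc_conj (z : C) : normc (Num.conj z) = normc z.
Proof. by apply: (@complexI R); exact: (norm_conjC z). Qed.

Lemma Re_sum (I : Type) (r : seq I) (P : pred I) (h : I -> C) :
  Re (\sum_(i <- r | P i) h i) = \sum_(i <- r | P i) Re (h i).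
Proof. by apply: (big_morph (@complex.Re R) (@re_add R)). Qed.

Lemma le_Re (z w : C) : z <= w -> Re z <= Re w.
Proof. by rewrite lecE => /andP[]. Qed.

Lemma normc_ge_Re (z : C) : - normc z <= Re z.
Proof. by have := ge_Re_normc z; rewrite ler_norml => /andP[]. Qed.

Variables (n : nat) (a b : 'rV[C]_n) (L D E : 'M[C]_n).
Hypotheses (a1 : forall j, normc (a 0 j) < 1) (b1 : forall j, normc (b 0 j) < 1).
Hypothesis LD : forall j k,
  L j k * (1 - a 0 j * Num.conj (a 0 k)) = (D *m D^t*) j k.
Hypothesis LE : forall j k,
  L j k * (1 - b 0 j * Num.conj (b 0 k)) = (E *m E^t*) j k.

(** Let [M] tend to infinity in [truncated_von_neumann]: the truncation terms are at most [K q ^ M],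
    where [q < 1] is the largest modulus in [a]. *)
Lemma poly_von_neumann d (c : nat -> nat -> C) (p : 'I_n -> C) :
  (forall z w : C, normc z = 1 -> normc w = 1 ->
     normc (\sum_(i < d) \sum_(j < d) c i j * z ^+ i * w ^+ j) <= 1) ->
  (forall k, p k = \sum_(i < d) \sum_(j < d) c i j * a 0 k ^+ i * b 0 k ^+ j) ->
  0 <= Re (\sum_j \sum_k L j k * (1 - p j * Num.conj (p k))).
Proof.
move=> c1 pE; set A := \sum_j _.
pose x j k := (a 0 j * b 0 j) * Num.conj (a 0 k * b 0 k).
pose q := \big[Num.max/0]_j normc (a 0 j).
have q0 : 0 <= q by exact: bigmax_ge_id.
have q1 : q < 1.
  by rewrite /q; elim/big_ind: _ => [|u v u1 v1|j _]; rewrite ?ltr01 ?gt_max ?u1.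
have xq j k : normc (x j k) <= q.
  have ajq : normc (a 0 j) <= q by exact: le_bigmax.
  rewrite !normcM normc_conj normcM -mulrA.
  apply: le_trans ajq; rewrite ler_piMr ?normc_ge0 //.
  by rewrite !mulr_ile1 ?mulr_ge0 ?normc_ge0 // ltW.
pose K := \sum_j \sum_k (normc (L j k) + normc (L j k * p j * Num.conj (p k))).
have K0 : 0 <= K by apply: sumr_ge0 => j _; apply: sumr_ge0 => k _;
  rewrite addr_ge0 ?normc_ge0.
have main M : - (K * q ^+ M) <= Re A.
  have := @truncated_von_neumann _ n a b L D E LD LE d c p M _ pE.
  have cc (z w : C) : `|z| = 1 -> `|w| = 1 ->
      `|\sum_(i < d) \sum_(j < d) c i j * z ^+ i * w ^+ j| <= 1.
    move=> z1 w1; rewrite normcE -[1]/(1%:C) lecR; apply: c1.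
      by apply: (@complexI R); rewrite -normcE z1.
    by apply: (@complexI R); rewrite -normcE w1.
  move=> /(_ cc) H.
  pose e j k := L j k * x j k ^+ (M +
    d.*2) - L j k * p j * Num.conj (p k) * x j k ^+ M.
  have {H}H : 0 <= A - \sum_j \sum_k e j k.
    move: H; rewrite -subr_ge0; congr (0 <= _).
    rewrite /A -!sumrB; apply: eq_bigr => j _; rewrite -!sumrB;
      apply: eq_bigr => k _.
    by rewrite /e /x; ring.
  have {H} : Re (\sum_j \sum_k e j k) <= Re A.
    by move: H; rewrite subr_ge0 => /le_Re.
  apply: le_trans; apply: le_trans (normc_ge_Re _); rewrite lerN2.
  apply: le_trans (normc_sum _ _ _) _; rewrite /K mulr_suml; apply: ler_sum => j _.
  apply: le_trans (normc_sum _ _ _) _; rewrite mulr_suml; apply: ler_sum => k _.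
  apply: le_trans (normcD _ _) _;
    rewrite normcN normcM [normc (_ * x j k ^+ M)]normcM.
  have xM m : (M <= m)%N -> normc (x j k ^+ m) <= q ^+ M.
    move=> Mm; rewrite normcX; apply: (@le_trans _ _ (q ^+ m)).
      by rewrite lerXn2r ?nnegrE ?normc_ge0.
    by apply: ler_wiXn2l => //; exact: ltW.
  by rewrite mulrDl lerD // ler_wpM2l ?normc_ge0 ?xM ?leq_addr.
apply/ler_addgt0Pl => e e0.
have /cvgrPdist_lt/(_ (e / (K + 1))) : q ^+ M @[M --> \oo] --> 0.
  by apply: cvg_expr; rewrite ger0_norm.
have K1 : 0 < K + 1 by lra.
rewrite divr_gt0 // => /(_ isT)[M _ MP].
have := MP M (leqnn M); rewrite /= sub0r normrN ger0_norm ?exprn_ge0 //.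
rewrite ltr_pdivlMr // => qK; have := main M.
have : 0 <= q ^+ M by rewrite exprn_ge0.
nra.
Qed.

(** Only the values at the nodes enter, so [F] may be replaced by a polynomial [h]-close to it
    there; the form changes by at most [3 h K], since [2 h + h] bounds the change of [F F^*]. *)
Lemma analytic_von_neumann (F : cplx2 R -> cplx R) :
  (forall z : cplx2 R, normc z.1 < 1 -> normc z.2 < 1 -> differentiable F z) ->
  (forall z : cplx2 R, normc z.1 < 1 -> normc z.2 < 1 -> normc (F z) <= 1) ->
  0 <= Re (\sum_j \sum_k L j k * (1 - F (a 0 j, b 0 j) * Num.conj (F (a 0 k,
    b 0 k)))).
Proof.
move=> Fd F1; set A := \sum_j _; pose f j : C := F (a 0 j, b 0 j).
have f1 j : normc (f j) <= 1 by exact: (F1 (a 0 j, b 0 j) (a1 j) (b1 j)).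
pose K := \sum_j \sum_k normc (L j k).
have K0 : 0 <= K by apply: sumr_ge0 => j _; apply: sumr_ge0 => k _;
  exact: normc_ge0.
apply/ler_addgt0Pl => e e0.
pose h := Num.min 1 (e / (3 * K + 1)).
have K1 : 0 < 3 * K + 1 by lra.
have h0 : 0 < h by rewrite lt_min ltr01 divr_gt0.
have h1 : h <= 1 by rewrite ge_min lexx.
have hK : h * (3 * K + 1) <= e by rewrite -ler_pdivlMr // ge_min lexx orbT.
have [d [c [c1 cF]]] := poly_approx Fd F1 a1 b1 h0.
pose p k := \sum_(i < d) \sum_(j < d) c i j * a 0 k ^+ i * b 0 k ^+ j.
have := poly_von_neumann c1 (p := p) (fun=> erefl); set P := \sum_j _ => P0.
have pf k : normc (p k - f k) <= h by exact: cF.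
have pb k : normc (p k) <= 2.
  by have := normcD (p k - f k) (f k); rewrite subrK; have := pf k; have := f1 k;
    lra.
have : Re (P - A) <= 3 * h * K.
  apply: le_trans (ler_norm _) _; apply: le_trans (ge_Re_normc _) _.
  rewrite /P /A -sumrB; apply: le_trans (normc_sum _ _ _) _.
  rewrite mulr_sumr; apply: ler_sum => j _; rewrite -sumrB.
  apply: le_trans (normc_sum _ _ _) _; rewrite mulr_sumr; apply: ler_sum => k _.
  rewrite -mulrBr normcM mulrC ler_wpM2r ?normc_ge0 // -/(f j) -/(f k).
  have -> : 1 - p j * Num.conj (p k) - (1 - f j * Num.conj (f k)) =
      - ((p j - f j) * Num.conj (p k) + f j * Num.conj (p k - f k)).
    by rewrite rmorphB /=; ring.
  rewrite normcN; apply: le_trans (normcD _ _) _; rewrite !normcM !normc_conj.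
  have : normc (p j - f j) * normc (p k) <= h * 2 by rewrite ler_pM ?normc_ge0.
  have : normc (f j) * normc (p k - f k) <= 1 * h by rewrite ler_pM ?normc_ge0.
  lra.
have -> : Re (P - A) = Re P - Re A by case: (P) (A) => [? ?] [? ?].
nra.
Qed.

End AnalyticVonNeumann.

(** * Closest point in the cone of Agler kernels *)

Section Separation.
Variable R : realType.
Local Notation C := R[i].

Lemma normc_sqr (z : C) : normc z ^+ 2 = Re z ^+ 2 + Im z ^+ 2.
Proof. by case: z => u v; rewrite sqr_sqrtr ?addr_ge0 ?sqr_ge0. Qed.

Lemma normc_sqrD (u v : C) (e : R) : normc (u + e%:C * v) ^+ 2 =
  normc u ^+ 2 + 2 * e * Re (u * Num.conj v) + e ^+ 2 * normc v ^+ 2.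
Proof. by rewrite !normc_sqr; case: u v => [u1 u2] [v1 v2] /=; ring. Qed.

Lemma ccts_conj (T : topologicalType) (f : T -> C) (x : T) : ccts f x ->
  ccts (fun y => Num.conj (f y)) x.
Proof.
move=> [fr fi]; split.
  by apply: eq_rcts fr => y; case: (f y).
apply: (@eq_rcts _ _ (fun y => 0 - Im (f y))) => [y|];
  first by case: (f y) => ? ? /=; rewrite sub0r.
by apply: rctsB => //; exact: cst_continuous.
Qed.

Lemma mul_conj (z : C) : z * Num.conj z = (normc z ^+ 2)%:C.
Proof. by rewrite -normCK normcE rmorphXn. Qed.

Lemma ler_sum1 (I : finType) (f : I -> R) i : (forall j,
  0 <= f j) -> f i <= \sum_j f j.
Proof. by move=> f0; rewrite (bigD1 i) //= lerDl sumr_ge0. Qed.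

Variables (n : nat) (a b : 'rV[C]_n) (M : 'M[C]_n).
Hypotheses (a1 : forall j, normc (a 0 j) < 1) (b1 : forall j, normc (b 0 j) < 1).

Definition wgt (x : 'rV[C]_n) j k : C := 1 - x 0 j * Num.conj (x 0 k).

(** Kernels enter through square Gram factors, so that the cone is parametrized by unconstrained
    pairs of matrices. *)
Definition agler (X1 X2 : 'M[C]_n) j k : C :=
  wgt a j k * (X1 *m X1^t*) j k + wgt b j k * (X2 *m X2^t*) j k.

Definition defect (X1 X2 : 'M[C]_n) : R :=
  \sum_j \sum_k normc (agler X1 X2 j k - M j k) ^+ 2.

Lemma wgt_diag (x : 'rV[C]_n) j : wgt x j j = (1 - normc (x 0 j) ^+ 2)%:C.
Proof. by rewrite /wgt mul_conj rmorphB. Qed.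

Lemma gram_diag (X : 'M[C]_n) j : (X *m X^t*) j j = (\sum_l normc (X j l) ^+ 2)%:C.
Proof. by rewrite gramE rmorph_sum; apply: eq_bigr => l _; rewrite mul_conj. Qed.

(** Coercivity, which makes the cone closed: the diagonal of [agler X1 X2] is a combination of the
    squared row norms with weights [1 - |a_j|^2] and [1 - |b_j|^2], positive because the nodes are
    in the open bidisk. *)
Lemma defect_bound : exists K : R, forall X1 X2, defect X1 X2 <= defect 0 0 ->
  forall j l, normc (X1 j l) <= K /\ normc (X2 j l) <= K.
Proof.
pose T := \sum_j normc (M j j) + (defect 0 0 + 1).
have d0 X1 X2 : 0 <= defect X1 X2.
  by apply: sumr_ge0 => j _; apply: sumr_ge0 => k _; rewrite exprn_ge0 ?normc_ge0.
(* A crude bound that spares all square roots. *)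
have sq (x : R) : x <= x ^+ 2 + 1.
  have := sqr_ge0 (x - 1 / 2); rewrite sqrrB -subr_ge0; lra.
have T0 : 0 <= T.
  by rewrite !addr_ge0 // sumr_ge0 // => j _; exact: normc_ge0.
pose w (x : 'rV[C]_n) j := 1 - normc (x 0 j) ^+ 2.
have w0 (x : 'rV[C]_n) j : normc (x 0 j) < 1 -> 0 < w x j.
  by move=> x1; rewrite subr_gt0 expr_lt1 ?normc_ge0.
exists (\sum_j (T / w a j + T / w b j) + 1) => X1 X2 XM j l.
pose g (X : 'M[C]_n) := \sum_l normc (X j l) ^+ 2.
have g0 X : 0 <= g X by apply: sumr_ge0 => k _; rewrite exprn_ge0 ?normc_ge0.
have gl (X : 'M[C]_n) : normc (X j l) ^+ 2 <= g X.
  by apply: (ler_sum1 (f := fun l => normc (X j l) ^+ 2)) => k;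
    rewrite exprn_ge0 ?normc_ge0.
have ST : w a j * g X1 + w b j * g X2 <= T.
  have Sjj : agler X1 X2 j j = (w a j * g X1 + w b j * g X2)%:C.
    by rewrite /agler !wgt_diag !gram_diag -!rmorphM -rmorphD.
  have Sd : normc (agler X1 X2 j j - M j j) ^+ 2 <= defect 0 0.
    apply: le_trans XM.
    have f0 i k : 0 <= normc
      (agler X1 X2 i k - M i k) ^+ 2 by rewrite exprn_ge0 ?normc_ge0.
    apply: le_trans (ler_sum1 (f := fun k =>
      normc (agler X1 X2 j k - M j k) ^+ 2) j _) _ => //.
    apply: (ler_sum1 (f := fun j =>
      \sum_k normc (agler X1 X2 j k - M j k) ^+ 2)) => i.
    by rewrite sumr_ge0.
  have Sd1 : normc (agler X1 X2 j j - M j j) <= defect 0 0 + 1.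
    by apply: le_trans (sq _) _; rewrite lerD2r.
  have := normcD (agler X1 X2 j j - M j j) (M j j); rewrite subrK.
  have : normc (M j j) <= \sum_j normc (M j j).
    by apply: (ler_sum1 (f := fun j => normc (M j j))) => k; exact: normc_ge0.
  rewrite Sjj in Sd1 *; rewrite normc_real /T;
    have := ler_norm (w a j * g X1 + w b j * g X2); lra.
have wa := w0 _ _ (a1 j); have wb := w0 _ _ (b1 j).
have ga : g X1 <= T / w a j.
  rewrite ler_pdivlMr // mulrC; have : 0 <= w b j * g X2 by rewrite mulr_ge0 // ltW.
  lra.
have gb : g X2 <= T / w b j.
  rewrite ler_pdivlMr // mulrC; have : 0 <= w a j * g X1 by rewrite mulr_ge0 // ltW.
  lra.
have jK : T / w a j + T / w b j <= \sum_j (T / w a j + T / w b j).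
  apply: (ler_sum1 (f := fun j => T / w a j + T / w b j)) => k.
  by rewrite addr_ge0 // divr_ge0 // ltW // w0.
have Ta : 0 <= T / w a j by rewrite divr_ge0 // ltW.
have Tb : 0 <= T / w b j by rewrite divr_ge0 // ltW.
split.
  by have := sq (normc (X1 j l)); have := gl X1; lra.
by have := sq (normc (X2 j l)); have := gl X2; lra.
Qed.

(** A pair of complex matrices is coded as a real row vector, to which the extreme value theorem on
    a box applies. A pair outside the box has a larger defect than [(0, 0)], which is inside. *)
Lemma defect_min : exists X1 X2, forall Y1 Y2, defect X1 X2 <= defect Y1 Y2.
Proof.
have [K KP] := defect_bound.
pose I : finType := (bool * bool * ('I_n * 'I_n))%type.
pose X k (v : 'rV[R]_#|I|) : 'M[C]_n := \matrix_(i, j)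
  (v 0 (enum_rank (k, false, (i, j))) +i* v 0 (enum_rank (k, true, (i, j)))).
pose V (Y1 Y2 : 'M[C]_n) : 'rV[R]_#|I| := \row_t
  let: (k, c, (i, j)) := enum_val t in
  let z := (if k then Y1 else Y2) i j in if c then Im z else Re z.
have VK Y1 Y2 : X true (V Y1 Y2) = Y1 /\ X false (V Y1 Y2) = Y2.
  by split; apply/matrixP => i j; rewrite !mxE !enum_rankK; case: (_ i j).
have X0 k : X k 0 = 0 by apply/matrixP => i j; rewrite !mxE.
pose box : set 'rV[R]_#|I| := [set v | forall i, `[- K, K]%classic (v ord0 i)].
have cbox : compact box.
  exact: (rV_compact (A := fun=> `[- K,
    K]%classic) (fun=> @segment_compact R (- K) K)).
pose phi v := defect (X true v) (X false v).
have V0 : V 0 0 = 0.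
  apply/rowP => t; rewrite !mxE; case: (enum_val t) => [[k c] [i j]].
  by case: k; case: c; rewrite mxE.
have bound Y1 Y2 : defect Y1 Y2 <= defect 0 0 -> box (V Y1 Y2).
  move=> /KP YK t; rewrite /= in_itv /= -ler_norml mxE.
  case: (enum_val t) => [[k c] [i j]]; have [Y1K Y2K] := YK i j.
  by case: k; case: c; (apply: le_trans;
    [exact: ge_Re_normc + exact: ge_Im_normc|by []]).
have phi_cts : continuous phi.
  have cX k i j v : ccts (fun v => X k v i j) v.
    by split; [apply: (@eq_rcts _ _ (fun v : 'rV[R]_#|I| =>
      v 0 (enum_rank (k, false, (i, j)))))
              |apply: (@eq_rcts _ _ (fun v : 'rV[R]_#|I| =>
                v 0 (enum_rank (k, true, (i, j)))))];
      do ?[by move=> v'; rewrite mxE]; exact: coord_continuous.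
  have cg k j l v : ccts (fun v => (X k v *m (X k v)^t*) j l) v.
    apply: (@eq_ccts _ _ (fun v => \sum_s X k v j s * Num.conj (X k v l s))) =>
      [v'|].
      exact: gramE.
    by apply: ccts_sum => s; apply: cctsM => //; exact: ccts_conj.
  have sum_cts (J : finType) (h : J -> 'rV[R]_#|I| -> R) v : (forall j,
    rcts (h j) v) ->
      rcts (fun v => \sum_j h j v) v.
    move=> hc; elim: (index_enum J) => [|j r IH].
      by apply: (@eq_rcts _ _ (fun=> 0)) => [v'|];
        [rewrite big_nil|exact: cst_continuous].
    by apply: (@eq_rcts _ _ (fun v => h j v + \sum_(j <- r) h j v)) => [v'|];
      [rewrite big_cons|exact: rctsD].
  move=> v; apply: (sum_cts) => j; apply: sum_cts => k.
  have [cr ci] : ccts (fun v => agler (X true v) (X false v) j k - M j k) v.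
    apply: cctsD; last exact: ccts_cst.
    by apply: cctsD; apply: cctsM;
      [exact: ccts_cst|exact: cg|exact: ccts_cst|exact: cg].
  apply: eq_rcts => [y|]; first exact: normc_sqr.
  by apply: rctsD; [exact: (rctsM cr cr)|exact: (rctsM ci ci)].
have box0 : box !=set0.
  by exists 0; rewrite -V0; apply: bound.
have [v vb vmin] := EVT_min_rV box0 cbox (continuous_subspaceT phi_cts).
exists (X true v), (X false v) => Y1 Y2; rewrite -/(phi v).
have phiV Z1 Z2 : phi (V Z1 Z2) = defect Z1 Z2 by rewrite /phi;
  have [-> ->] := VK Z1 Z2.
have [le0|lt0] := leP (defect Y1 Y2) (defect 0 0).
  by rewrite -phiV; apply: vmin; rewrite inE; exact: bound.
apply: le_trans (ltW lt0); rewrite -phiV; apply: vmin.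
by rewrite inE; apply: bound.
Qed.

End Separation.

(** * Duality for the cone of Agler kernels *)

Section AglerDecomposition.
Variable R : realType.
Local Notation C := R[i].

(** Perturbing a kernel adds a column to its factor; a square factor brings it back into the domain
    of [defect]. *)
Lemma gram_square n m (Z : 'M[C]_(n, m)) : exists Y : 'M[C]_n,
  Z *m Z^t* = Y *m Y^t*.
Proof.
apply: psd_factor => [|v]; first by rewrite adjmx_mul trmxCK.
have -> : v *m (Z *m Z^t*) *m v^t* = (v *m Z) *m (v *m Z)^t*.
  by rewrite adjmx_mul !mulmxA.
by rewrite gramE sumr_ge0 // => l _; exact: mul_conjC_ge0.
Qed.

Lemma conj_eq_ge0 (z : C) : Num.conj z = z -> 0 <= Re z -> 0 <= z.
Proof.
case: z => u v [/eqP] vv u0; rewrite lecE /= u0 andbT.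
by move: vv; rewrite eq_sym -addr_eq0 -mulr2n mulrn_eq0.
Qed.

Variables (n : nat) (a b : 'rV[C]_n) (M : 'M[C]_n).
Hypotheses (a1 : forall j, normc (a 0 j) < 1) (b1 : forall j, normc (b 0 j) < 1).
Hypothesis M_herm : forall j k, Num.conj (M j k) = M k j.
(** [M] is nonnegative against the dual cone; for [M = 1 - F F^*] this is von Neumann's
    inequality. *)
Hypothesis M_dual : forall L D E : 'M[C]_n,
  (forall j k, L j k * wgt a j k = (D *m D^t*) j k) ->
  (forall j k, L j k * wgt b j k = (E *m E^t*) j k) ->
  0 <= Re (\sum_j \sum_k L j k * M j k).

Lemma wgt_conj (x : 'rV[C]_n) j k : Num.conj (wgt x j k) = wgt x k j.
Proof. by rewrite /wgt rmorphB rmorph1 rmorphM /= conjCK mulrC. Qed.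

Lemma gram_conj m (X : 'M[C]_(n, m)) j k :
  Num.conj ((X *m X^t*) j k) = (X *m X^t*) k j.
Proof. by rewrite -adjmxE adjmx_mul trmxCK. Qed.

Lemma agler_conj (X1 X2 : 'M[C]_n) j k :
  Num.conj (agler a b X1 X2 j k) = agler a b X1 X2 k j.
Proof. by rewrite /agler rmorphD !rmorphM /= !wgt_conj !gram_conj. Qed.

(* The defect is minimal at some [(X1, X2)]; were it positive there, the
   transpose of [agler X1 X2 - M] would separate [M] from the cone of all
   [agler Y1 Y2], contradicting [M_dual]. *)
Lemma agler_decomposition :
  exists X1 X2 : 'M[C]_n, forall j k, agler a b X1 X2 j k = M j k.
Proof.
have [X1 [X2 Xmin]] := defect_min M a1 b1.
pose Dl j k := agler a b X1 X2 j k - M j k.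
have Dh j k : Num.conj (Dl j k) = Dl k j.
  by rewrite /Dl rmorphB /= agler_conj M_herm.
(* First-order condition: along a direction that stays in the cone, the defect cannot decrease. *)
have dir (H : 'I_n -> 'I_n -> C) :
    (forall e : R, 0 < e < 1 -> exists Y1 Y2, forall j k,
      agler a b Y1 Y2 j k = agler a b X1 X2 j k + e%:C * H j k) ->
    0 <= Re (\sum_j \sum_k Dl j k * Num.conj (H j k)).
  move=> HP; set S := \sum_j _; pose h := \sum_j \sum_k normc (H j k) ^+ 2.
  have h0 : 0 <= h.
    by apply: sumr_ge0 => j _; apply: sumr_ge0 => k _; rewrite exprn_ge0 ?normc_ge0.
  have key (e : R) : 0 < e < 1 -> 0 <= 2 * e * Re S + e ^+ 2 * h.
    move=> e01; have [Y1 [Y2 YE]] := HP e e01.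
    have := Xmin Y1 Y2; rewrite -subr_ge0; congr (0 <= _).
    rewrite /defect -sumrB /h /S Re_sum !mulr_sumr -big_split;
      apply: eq_bigr => j _ /=.
    rewrite -sumrB Re_sum !mulr_sumr -big_split; apply: eq_bigr => k _ /=.
    rewrite YE (_ : agler a b X1 X2 j k + e%:C * H j k - M j k =
      Dl j k + e%:C * H j k).
      by rewrite normc_sqrD -/(Dl j k); ring.
    by rewrite /Dl; ring.
  rewrite leNgt; apply/negP => S0.
  (* Then [e h <= - Re S], and [e (2 Re S + e h)] is negative. *)
  pose e := Num.min (1 / 2) (- Re S / (h + 1)).
  have h1 : 0 < h + 1 by lra.
  have e0 : 0 < e by rewrite lt_min divr_gt0 //= divr_gt0 // oppr_gt0.
  have e2 : e <= 1 / 2 by rewrite ge_min lexx.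
  have eh : e * (h + 1) <= - Re S by rewrite -ler_pdivlMr // ge_min lexx orbT.
  have := key e; rewrite e0 /= => /(_ ltac:(lra)).
  have -> : 2 * e * Re S + e ^+ 2 * h = e * (2 * Re S + e * h) by ring.
  rewrite pmulr_rge0 //; nra.
have gramD (X : 'M[C]_n) (v : 'rV[C]_n) (e : R) : 0 < e -> exists Y : 'M[C]_n,
    forall j k, (Y *m Y^t*) j k =
      (X *m X^t*) j k + e%:C * (v 0 j * Num.conj (v 0 k)).
  move=> e0; pose Z := row_mx X ((Num.sqrt e)%:C *: v^T).
  have [Y YZ] := gram_square Z; exists Y => j k; rewrite -YZ.
  rewrite tr_row_mx map_col_mx mul_row_col mxE; congr (_ + _).
  rewrite gramE big_ord1 !mxE rmorphM /=.
  rewrite (_ : Num.conj (Num.sqrt e)%:C = (Num.sqrt e)%:C); last exact: conjc_real.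
  by rewrite mulrACA -rmorphM -expr2 sqr_sqrtr // ltW.
pose L : 'M[C]_n := \matrix_(j, k) Dl k j.
(* Testing the condition on rank one kernels shows that [L] times the weight is positive
   semidefinite, that is, that [L] belongs to the dual cone. *)
have psd (x : 'rV[C]_n) :
    (forall v : 'rV[C]_n,
      0 <= Re (\sum_j \sum_k Dl j k * Num.conj (wgt x j k * (v 0 j * Num.conj
      (v 0 k))))) ->
    exists D : 'M[C]_n, forall j k, L j k * wgt x j k = (D *m D^t*) j k.
  move=> vP; pose K : 'M[C]_n := \matrix_(j, k) (L j k * wgt x j k).
  have Kh : K^t* = K.
    by apply/matrixP => j k; rewrite adjmxE !mxE [LHS]rmorphM; congr (_ * _);
      [exact: Dh|exact: wgt_conj].
  have [v|D KD] := psd_factor Kh; last first.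
    by exists D => j k; rewrite -KD [RHS]mxE.
  apply: conj_eq_ge0.
    by rewrite -adjmxE !adjmx_mul trmxCK Kh mulmxA.
  have := vP v; rewrite exchange_big; congr (0 <= Re _).
  rewrite mxE [RHS](eq_bigr (fun k => \sum_j v 0 j * K j k * Num.conj (v 0 k))).
    rewrite [RHS]exchange_big; apply: eq_bigr => j _; apply: eq_bigr => k _.
    by rewrite !mxE !rmorphM /= wgt_conj conjCK; ring.
  by move=> k _; rewrite adjmxE mxE mulr_suml.
have [|D LD] := psd a.
  move=> v; apply: dir => e /andP[e0 _]; have [Y YE] := gramD X1 v e e0.
  by exists Y, X2 => j k; rewrite /agler YE; ring.
have [|E LE] := psd b.
  move=> v; apply: dir => e /andP[e0 _]; have [Y YE] := gramD X2 v e e0.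
  by exists X1, Y => j k; rewrite /agler YE; ring.
(* The cone is closed under scaling by [1 - e], so the direction towards the origin is
   admissible. *)
have scale : 0 <= Re (\sum_j \sum_k Dl j k * Num.conj (- agler a b X1 X2 j k)).
  apply: dir => e /andP[e0 e1].
  pose s := (Num.sqrt (1 - e))%:C : C.
  have sX (X : 'M[C]_n) j k : ((s *: X) *m (s *: X)^t*) j k =
    (1 - e)%:C * (X *m X^t*) j k.
    rewrite adjmxZ -scalemxAl -scalemxAr scalerA mxE.
    rewrite (_ : Num.conj s = s); last exact: conjc_real.
    by rewrite -rmorphM -expr2 sqr_sqrtr // subr_ge0 ltW.
  by exists (s *: X1), (s *: X2) => j k; rewrite /agler !sX rmorphB /=; ring.
have dual := M_dual LD LE.
pose dn := \sum_j \sum_k normc (Dl j k) ^+ 2.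
have : dn <= 0.
  move: dual scale; rewrite exchange_big.
  (* As [agler X1 X2 = M + Dl], this pairing is minus the one in [dual] minus the squared norm of
     [Dl]; both being nonnegative, [Dl] vanishes. *)
  have -> : \sum_j \sum_k Dl j k * Num.conj (- agler a b X1 X2 j k) =
     - (\sum_j \sum_k L k j * M k j) - dn%:C.
    rewrite /dn rmorph_sum -opprD -big_split -sumrN; apply: eq_bigr => j _ /=.
    rewrite rmorph_sum -big_split -sumrN; apply: eq_bigr => k _ /=.
    rewrite -mul_conj mxE rmorphN -[M k j]M_herm /Dl !rmorphB /=; ring.
  move: (\sum_j _) => [u v] /=; lra.
move=> dn0; exists X1, X2 => j k; apply/eqP;
  rewrite -subr_eq0 -/(Dl j k) -normc_eq0.
have : normc (Dl j k) ^+ 2 <= 0.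
  apply: le_trans dn0.
  have f0 i l : 0 <= normc (Dl i l) ^+ 2 by rewrite exprn_ge0 ?normc_ge0.
  apply: le_trans (ler_sum1 (f := fun k => normc (Dl j k) ^+ 2) k _) _ => //.
  apply: (ler_sum1 (f := fun j => \sum_k normc (Dl j k) ^+ 2)) => i.
  by rewrite sumr_ge0.
by move=> d0; rewrite -sqrf_eq0 eq_le d0 exprn_ge0 ?normc_ge0.
Qed.

End AglerDecomposition.

(** * Realization *)

Section Realize.
Variable R : realType.
Local Notation C := R[i].

Lemma diskE (z : cplx R) : disk z <-> normc z < 1.
Proof. by rewrite /disk /= -[X in X < _]/((normc z)%:C) -[1]/(1%:C) ltcR. Qed.

Lemma fst_diff (z : cplx2 R) : differentiable (fst : cplx2 R -> cplx R) z.
Proof.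
by apply: (@linear_differentiable _ _ _ (@fst (cplx R) (cplx R))) => x;
  exact: cvg_fst.
Qed.

Lemma snd_diff (z : cplx2 R) : differentiable (snd : cplx2 R -> cplx R) z.
Proof.
by apply: (@linear_differentiable _ _ _ (@snd (cplx R) (cplx R))) => x;
  exact: cvg_snd.
Qed.

Lemma symmetrize_diff (z : cplx2 R) : differentiable (@symmetrize R) z.
Proof.
have d1 := fst_diff z; have d2 := snd_diff z.
apply: differentiable_pair; first exact: differentiableD.
exact: differentiableM.
Qed.

Section Nodes.
Variables (N : nat) (f : cplx2 R -> cplx R) (z w : 'I_N -> C).
Hypotheses (fa : analytic_on (@symm_bidisk R) f)
  (fd : forall l, symm_bidisk l -> disk (f l)).
Hypotheses (z1 : forall j, normc (z j) < 1) (w1 : forall j, normc (w j) < 1).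

Let F (x : cplx2 R) : cplx R := f (symmetrize x).
Let c j : C := f (z j + w j, z j * w j).

(** The left half of the indices stands for the nodes [(z j, w j)], the right half for their flips;
    [swap] is the flip on indices. *)
Let swap : 'I_(N + N) -> 'I_(N + N) :=
  fun i => unsplit (match fintype.split i with inl j => inr j | inr j => inl j end).

Let a : 'rV[C]_(N + N) := row_mx (\row_j z j) (\row_j w j).
Let b : 'rV[C]_(N + N) := row_mx (\row_j w j) (\row_j z j).

Let swapl j : swap (lshift N j) = rshift N j.
Proof. by rewrite /swap (unsplitK (inl j)). Qed.
Let swapr j : swap (rshift N j) = lshift N j.
Proof. by rewrite /swap (unsplitK (inr j)). Qed.
Let al j : a 0 (lshift N j) = z j. Proof.
by rewrite row_mxEl mxE. Qed.
Let ar j : a 0 (rshift N j) = w j. Proof.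
by rewrite row_mxEr mxE. Qed.
Let bl j : b 0 (lshift N j) = w j. Proof.
by rewrite row_mxEl mxE. Qed.
Let br j : b 0 (rshift N j) = z j. Proof.
by rewrite row_mxEr mxE. Qed.

Let ord_cases (P : 'I_(N + N) -> Prop) :
  (forall j, P (lshift N j)) -> (forall j, P (rshift N j)) -> forall i, P i.
Proof. by move=> Pl Pr i; case: (split_ordP i) => j ->. Qed.

Lemma F_diff (x : cplx2 R) : normc x.1 < 1 -> normc x.2 < 1 -> differentiable F x.
Proof.
move=> x1 x2; apply: differentiable_comp; first exact: symmetrize_diff.
by apply: fa; exists x => //; split; apply/diskE.
Qed.

Lemma F_lt1 (x : cplx2 R) : normc x.1 < 1 -> normc x.2 < 1 -> normc (F x) < 1.
Proof. by move=> x1 x2; apply/diskE/fd; exists x => //; split; apply/diskE. Qed.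

(* On the nodes together with their images under the exchange of coordinates,
   averaging a pair of Agler kernels with its own exchanged pair makes each
   kernel the flip of the other. *)
Lemma symmetric_agler : exists m, exists x y : 'I_N -> 'rV[C]_m,
  (forall j k, (1 - z j * Num.conj (z k)) * (x j *m (x k)^t*) 0 0 +
     (1 - w j * Num.conj (w k)) * (y j *m (y k)^t*) 0 0 =
     (1 - c j * Num.conj (c k)) / 2) /\
  (forall j k, (1 - z j * Num.conj (w k)) * (x j *m (y k)^t*) 0 0 +
     (1 - w j * Num.conj (z k)) * (y j *m (x k)^t*) 0 0 =
     (1 - c j * Num.conj (c k)) / 2).
Proof.
pose M : 'M[C]_(N + N) := \matrix_(j, k)
  (1 - F (a 0 j, b 0 j) * Num.conj (F (a 0 k, b 0 k))).
have a1 j : normc (a 0 j) < 1 by elim/ord_cases: j => j; rewrite ?al ?ar.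
have b1 j : normc (b 0 j) < 1 by elim/ord_cases: j => j; rewrite ?bl ?br.
have [|L D E LD LE|X1 [X2 XM]] := @agler_decomposition R _ a b M a1 b1.
- by move=> j k; rewrite !mxE rmorphB rmorph1 rmorphM /= conjCK mulrC.
- have := analytic_von_neumann a1 b1 LD LE F_diff (fun x x1 x2 =>
  ltW (F_lt1 x1 x2)).
  by congr (0 <= Re _); apply: eq_bigr => j _; apply: eq_bigr => k _;
    rewrite [M _ _]mxE.
have Fl j : F (a 0 (lshift N j), b 0 (lshift N j)) = c j by rewrite al bl.
have Fr j : F (a 0 (rshift N j), b 0 (rshift N j)) = c j.
  by rewrite ar br /F /symmetrize /= addrC mulrC.
(* The Gram matrix of [X] is a quarter, not half, of the sum of the first kernel and the flipped
   second one: each resulting identity then has [(1 - c c^* ) / 2] on the right, and their sum needs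
   no normalization by a square root of 2. *)
pose h : C := 2^-1.
pose X : 'M[C]_(N + N, N + N + (N + N)) :=
  h *: row_mx X1 (\matrix_i row (swap i) X2).
have XE i k : (X *m X^t*) i k =
  h * h * ((X1 *m X1^t*) i k + (X2 *m X2^t*) (swap i) (swap k)).
  have hc : Num.conj h = h by rewrite /h fmorphV rmorph_nat.
  rewrite /X adjmxZ -scalemxAl -scalemxAr scalerA mxE hc; congr (_ * _).
  rewrite tr_row_mx map_col_mx mul_row_col mxE; congr (_ + _).
  by rewrite -[LHS]gram_row -[RHS]gram_row !rowK.
exists (N + N + (N + N))%N, (fun j => row (lshift N j) X), (fun j =>
  row (rshift N j) X).
have ME i k : M i k = 1 - F (a 0 i, b 0 i) * Num.conj (F (a 0 k,
  b 0 k)) by rewrite mxE.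
have hh (u v t : C) : u = t -> v = t -> h * h * (u + v) = t / 2.
  by move=> -> ->; rewrite /h; field.
split=> j k; rewrite !gram_row !XE ?swapl ?swapr.
  have := XM (lshift N j) (lshift N k); have := XM (rshift N j) (rshift N k).
  rewrite /agler /wgt !ME !Fl !Fr !al !ar !bl !br => rr ll.
  rewrite -(hh _ _ _ ll rr); ring.
have := XM (lshift N j) (rshift N k); have := XM (rshift N j) (lshift N k).
rewrite /agler /wgt !ME !Fl !Fr !al !ar !bl !br => rl lr.
rewrite -(hh _ _ _ lr rl); ring.
Qed.

(* With [u = x + y] and [v = x - y], the sum and the difference of the two
   identities of [symmetric_agler] say that [(1, z x + w y)] and [(f, u)] have
   the same Gram matrix, and so do [z x - w y] and [v]. *)
Lemma realization : exists m, exists tau : 'M[C]_m, exists U : 'M[C]_(1 + m),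
  [/\ tau \is unitarymx, U \is unitarymx & forall j,
   exists2 g, g *m pencil tau U (z j + w j) (z j * w j) = ursubmx U &
     transfer tau U (z j + w j) (z j * w j) g = c j].
Proof.
have [m [x [y [xy1 xy2]]]] := symmetric_agler.
have norm1 (t : C) : normc t < 1 -> `|t| < 1 by move=> t1;
  rewrite normcE (_ : 1 = 1%:C) // ltcR.
pose ip (u v : 'rV[C]_m) := (u *m v^t*) 0 0.
have ipD (u u' v v' : 'rV[C]_m) (p q r s : C) :
    ip (p *: u + q *: u') (r *: v + s *: v') =
    p * Num.conj r * ip u v + p * Num.conj s * ip u v' +
    (q * Num.conj r * ip u' v + q * Num.conj s * ip u' v').
  rewrite /ip !gramE !mulr_sumr -!big_split; apply: eq_bigr => l _ /=.
  by rewrite !mxE rmorphD !rmorphM /=; ring.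
have ipr (p q : C) (v v' : 'rV[C]_m) :
    (row_mx p%:M v *m (row_mx q%:M v')^t*) 0 0 = p * Num.conj q + ip v v'.
  rewrite tr_row_mx map_col_mx mul_row_col mxE; congr (_ + _).
  by rewrite gramE big_ord1 !mxE eqxx !mulr1n.
pose P : 'M[C]_(N, m) := \matrix_j (z j *: x j + - w j *: y j).
pose Q : 'M[C]_(N, m) := \matrix_j (1 *: x j + -1 *: y j).
pose r j := z j *: x j + w j *: y j.
pose u j := 1 *: x j + 1 *: y j.
pose S : 'M[C]_(N, 1 + m) := \matrix_j row_mx 1%:M (r j).
pose T : 'M[C]_(N, 1 + m) := \matrix_j row_mx (c j)%:M (u j).
have [|tau tauU PQ] := @unitary_extension C m N P Q.
  apply/matrixP => j k;
    rewrite -[LHS]gram_row -[RHS]gram_row !rowK -!/(ip _ _) !ipD.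
  rewrite !rmorphN rmorph1 /=.
  have := xy1 j k; rewrite -(xy2 j k) -!/(ip _ _) => /eqP;
    rewrite -subr_eq0 => /eqP e.
  by apply/eqP; rewrite eq_sym -subr_eq0 -e; apply/eqP; ring.
have [|U UU ST] := @unitary_extension C (1 + m) N S T.
  apply/matrixP => j k; rewrite -[LHS]gram_row -[RHS]gram_row !rowK.
  rewrite !ipr /r /u !ipD !rmorph1.
  have e : 1 - c j * Num.conj (c k) =
    (1 - c j * Num.conj (c k)) / 2 + (1 - c j * Num.conj (c k)) / 2.
    by field.
  rewrite -{1}(xy1 j k) -(xy2 j k) -!/(ip _ _) in e.
  by apply/eqP; rewrite eq_sym -subr_eq0; apply/eqP; move: e => /eqP;
    rewrite eq_sym -subr_eq0 => /eqP <-; ring.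
exists m, tau, U; split=> // j.
apply: (@transfer_node _ m tau U tauU (z j) (w j) (x j) (y j) (c j));
  rewrite ?norm1 //.
  move/row_matrixP: PQ => /(_ j); rewrite row_mul !rowK scaleNr => ->.
  by rewrite scale1r scaleN1r.
by move/row_matrixP: ST => /(_ j); rewrite row_mul !rowK /u !scale1r.
Qed.

End Nodes.
End Realize.

(** * The transfer function as a ratio of polynomials *)

Section PolynomialForm.
Variables (C : numClosedFieldType) (m : nat) (tau : 'M[C]_m) (U : 'M[C]_(1 + m)).

(** Evaluation as a ring morphism, so that it commutes with determinants and adjugates of polynomial
    matrices. *)
Definition eval2 (s p : C) : {poly {poly C}} -> C :=
  horner_eval p \o horner_eval s%:P.

HB.instance Definition _ s p := GRing.RMorphism.on (eval2 s p).

Lemma eval2E s p q : eval2 s p q = q.[s, p].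
Proof. by []. Qed.

Definition cst2 (c : C) : {poly {poly C}} := c%:P%:P.

Lemma eval2_cst s p c : eval2 s p (cst2 c) = c.
Proof. by rewrite eval2E /cst2 !hornerC. Qed.

Lemma eval2_X s p : eval2 s p 'X = s.
Proof. by rewrite eval2E hornerX hornerC. Qed.

Lemma eval2_Y s p : eval2 s p ('X)%:P = p.
Proof. by rewrite eval2E hornerC hornerX. Qed.

Lemma eval2_cstmx s p k l (M : 'M[C]_(k,
  l)) : map_mx (eval2 s p) (map_mx cst2 M) = M.
Proof. by apply/matrixP => i j; rewrite !mxE eval2_cst. Qed.

Let D : 'M[C]_m := drsubmx U.

Definition pencil2 : 'M[{poly {poly C}}]_m :=
  (cst2 2)%:M - 'X *: map_mx cst2 (tau + D) +
    (cst2 2 * ('X)%:P) *: map_mx cst2 (tau *m D).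

Definition numer2 : 'M[{poly {poly C}}]_m :=
  'X%:M - (cst2 2 * ('X)%:P) *: map_mx cst2 tau.

Definition den2 : {poly {poly C}} := \det pencil2.

(** Cramer's rule: the state is [B] times the adjugate of the pencil, divided by [den2]. *)
Definition num2 : {poly {poly C}} := cst2 (ulsubmx U 0 0) * den2 +
  (map_mx cst2 (ursubmx U) *m \adj pencil2 *m numer2 *m map_mx cst2
    (dlsubmx U)) 0 0.

Lemma eval2_pencil s p : map_mx (eval2 s p) pencil2 = pencil tau U s p.
Proof.
rewrite /pencil2 map_mxD map_mxB !map_mxZ map_scalar_mx !eval2_cstmx /=.
by rewrite rmorphM /= !eval2_cst eval2_X eval2_Y.
Qed.

Lemma eval2_numer s p : map_mx (eval2 s p) numer2 = numer tau s p.
Proof.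
rewrite /numer2 map_mxB map_mxZ map_scalar_mx eval2_cstmx /=.
by rewrite rmorphM /= eval2_cst eval2_X eval2_Y.
Qed.

Lemma eval2_den s p : den2.[s, p] = \det (pencil tau U s p).
Proof. by rewrite -eval2E /den2 -det_map_mx eval2_pencil. Qed.

(** From [B = g pencil], [B] times the adjugate is [den2] times [g], and no inverse matrix is
    needed. *)
Lemma eval2_num s p g : den2.[s, p] != 0 -> g *m pencil tau U s p = ursubmx U ->
  transfer tau U s p g = num2.[s, p] / den2.[s, p].
Proof.
move=> d0 gE; rewrite -[num2.[s,
  p]]eval2E /num2 rmorphD rmorphM /= eval2_cst eval2E.
rewrite mulrDl mulfK // /transfer mxE; congr (_ + _).
rewrite -[X in _ = X / _](_ : (map_mx (eval2 s p) (map_mx cst2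
  (ursubmx U) *m \adj pencil2 *m numer2 *m map_mx cst2 (dlsubmx U))) 0 0 = _);
  last by rewrite mxE.
rewrite !map_mxM /= !eval2_cstmx map_mx_adj /= eval2_pencil eval2_numer -gE.
rewrite -[g *m _ *m \adj _]mulmxA mul_mx_adj mul_mx_scalar -!scalemxAl [in RHS]mxE.
by rewrite -eval2_den mulrAC mulfV // mul1r.
Qed.

Lemma pencil_solve s p : den2.[s, p] != 0 -> exists g,
  g *m pencil tau U s p = ursubmx U.
Proof.
rewrite eval2_den => d0; exists (ursubmx U *m invmx (pencil tau U s p)).
by rewrite mulmxKV // unitmxE unitfE.
Qed.

(** This shows that [den2] is not the zero polynomial, as the null set argument requires. *)
Lemma den2_00 : den2.[0, 0] != 0.
Proof. by rewrite eval2_den pencil00 det_scalar expf_neq0 // pnatr_eq0. Qed.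

End PolynomialForm.

(** * Holomorphy and radial limits of ratios *)

Section Differentiable.
Variable R : realType.
Local Notation C := R[i].

Lemma horner_diff (q : {poly C}) (h : cplx2 R ->
  cplx R) (z : cplx2 R) : differentiable h z ->
  differentiable (fun x => q.[h x] : cplx R) z.
Proof.
move=> hz; elim/poly_ind: q => [|q c IH].
  rewrite (_ : (fun x => _) = cst 0); last by apply/funext => x; rewrite horner0.
  exact: differentiable_cst.
rewrite (_ : (fun x => _) = (fun x => q.[h x] : cplx R) * h + cst c).
  by apply: differentiableD; [exact: differentiableM|exact: differentiable_cst].
by apply/funext => x; rewrite hornerMXaddC.
Qed.

Lemma horner2_diff (q : {poly {poly C}}) (z : cplx2 R) :
  differentiable (fun x : cplx2 R => q.[x.1, x.2] : cplx R) z.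
Proof.
elim/poly_ind: q => [|q c IH].
  rewrite (_ : (fun x => _) = cst 0); last by apply/funext => x; rewrite !horner0.
  exact: differentiable_cst.
rewrite (_ : (fun x => _) = (fun x : cplx2 R =>
  q.[x.1, x.2] : cplx R) * fst + (fun x => c.[x.2] : cplx R)).
  apply: differentiableD; last by apply: horner_diff; exact: snd_diff.
  by apply: differentiableM => //; exact: fst_diff.
by apply/funext => x; rewrite hornerMXaddC !hornerE.
Qed.

Lemma ratio_diff (p q : {poly {poly C}}) (z : cplx2 R) : q.[z.1, z.2] != 0 ->
  differentiable (fun x : cplx2 R => p.[x.1, x.2] / q.[x.1, x.2] : cplx R) z.
Proof.
move=> q0; apply: differentiableM; first exact: horner2_diff.
by apply: differentiableV => //; exact: horner2_diff.
Qed.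

Lemma ccts_cvg_left (h : R -> C) (x : R) : ccts h x ->
  (h y : cplx R) @[y --> x^'-] --> (h x : cplx R).
Proof.
move=> /cctsP hx; apply: cvg_at_left_filter; apply/cvgrPdist_lt => e e0.
have eE : e = (Re e)%:C by move: e0; case: (e) => u v;
  rewrite ltcE /= => /andP[/eqP-> _].
have {}e0 : 0 < Re e by move: e0; rewrite eE ltcR.
have [d d0 hd] := hx _ e0; apply/nbhs_ballP; exists d => //= y;
  rewrite /ball /= => yd.
by rewrite eE -[X in X < _]/((normc _)%:C) ltcR normcB; apply: hd; rewrite distrC.
Qed.

(** Where the denominator does not vanish on the symmetrized torus, the ratio is continuous across
    the boundary, so its radial limit is its value. *)
Lemma radial_path_cvg (f : cplx2 R -> cplx R) (z : cplx2 R) : {for z,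
  continuous f} ->
  radial_limit f z (f z).
Proof.
case: z => z1 z2 fz; rewrite /radial_limit /=.
apply: (@cvg_comp _ _ _ (fun r : R => (r%:C * z1, r%:C ^+ 2 * z2) : cplx2 R) f _
  (nbhs ((z1, z2) : cplx2 R))) => //.
have rc k (u : C) : ccts (fun r : R => r%:C ^+ k * u) 1.
  apply: cctsM; last exact: ccts_cst.
  by apply: cctsX; exact: cder_ccts (real_cder 1).
apply: (cvg_pair (G := nbhs (z1 : cplx R)) (H := nbhs (z2 : cplx R))).
  by have := ccts_cvg_left (rc 1%N z1); rewrite mul1r.
by have := ccts_cvg_left (rc 2 z2); rewrite expr1n mul1r.
Qed.

End Differentiable.

(** * Null sets of the torus *)

Section NullSet.
Variable R : realType.
Local Notation C := R[i].
Local Notation mu := (@lebesgue_measure R).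

(** The cosine is injective on each half of [[0, 2 pi]], so a root of a polynomial accounts for at
    most two angles. *)
Lemma expi_fiber (z : C) (t : R) : 0 <= t <= 2 * pi -> expi t = z ->
  t = acos (Re z) \/ t = pi + acos (- Re z).
Proof.
move=> /andP[t0 t2] <-; rewrite [Re _]/=; case: (lerP t pi) => tpi.
  by left; rewrite cosK // in_itv /= t0.
right; have -> : - cos t = cos (t - pi).
  by rewrite cosB cospi sinpi mulr0 addr0 mulrN1.
by rewrite cosK ?in_itv /=; lra.
Qed.

Lemma poly_zeros_countable (q : {poly C}) : q != 0 ->
  countable [set t : R | 0 <= t <= 2 * pi /\ q.[expi t] = 0].
Proof.
move=> q0; have [rs qE] := closed_field_poly_normal q.
pose s := [seq acos (Re z) | z <- rs] ++ [seq pi + acos (- Re z) | z <- rs].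
apply: finite_set_countable; apply: sub_finite_set (finite_seq s).
move=> t /= [t02 qt].
have : root q (expi t) by apply/eqP.
rewrite qE rootZ ?lead_coef_eq0 // root_prod_XsubC => trs.
rewrite mem_cat; have [->|->] := expi_fiber t02 erefl.
  by rewrite (map_f (fun z : C => acos (Re z))).
by rewrite (map_f (fun z : C => pi + acos (- Re z))) // orbT.
Qed.

Lemma symmetrized_poly (q : {poly {poly C}}) (z : C) :
  exists p : {poly C}, forall w, p.[w] = q.[z + w, z * w].
Proof.
elim/poly_ind: q => [|q c [p pE]].
  by exists 0 => w; rewrite !horner0.
exists (p * (z%:P + 'X) + (c \Po (z *: 'X))) => w.
by rewrite hornerMXaddC !hornerE horner_comp pE !hornerE.
Qed.

Lemma horner2_0r (q : {poly {poly C}}) : exists p : {poly C}, forall z,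
  p.[z] = q.[z, 0].
Proof.
elim/poly_ind: q => [|q c [p pE]].
  by exists 0 => w; rewrite !horner0.
exists (p * 'X + c.[0]%:P) => w.
by rewrite !hornerMXaddC !hornerE pE.
Qed.

Definition cmeas (h : R * R -> C) := measurable_fun [set: R * R] (fun t =>
  Re (h t)) /\
  measurable_fun [set: R * R] (fun t => Im (h t)).

Lemma cmeasD g h : cmeas g -> cmeas h -> cmeas (fun t => g t + h t).
Proof.
move=> [gr gi] [hr hi]; split.
  by rewrite (_ : (fun t => _) = (fun t => Re (g t) + Re (h t)));
    [exact: measurable_funD|apply/funext => t; rewrite re_add].
by rewrite (_ : (fun t => _) = (fun t => Im (g t) + Im (h t)));
  [exact: measurable_funD|apply/funext => t; rewrite im_add].
Qed.

Lemma cmeasM g h : cmeas g -> cmeas h -> cmeas (fun t => g t * h t).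
Proof.
move=> [gr gi] [hr hi]; split.
  rewrite (_ : (fun t => _) = (fun t => Re (g t) * Re (h t) - Im (g t) * Im (h t))).
    by apply: measurable_funB; exact: measurable_funM.
  by apply/funext => t; rewrite re_mul.
rewrite (_ : (fun t => _) = (fun t => Re (g t) * Im (h t) + Im (g t) * Re (h t))).
  by apply: measurable_funD; exact: measurable_funM.
by apply/funext => t; rewrite im_mul.
Qed.

Lemma cmeas_cst z : cmeas (fun=> z). Proof.
by split; exact: measurable_cst. Qed.

Lemma cmeas_horner (q : {poly C}) h : cmeas h -> cmeas (fun t => q.[h t]).
Proof.
move=> mh; elim/poly_ind: q => [|q c IH].
  by rewrite (_ : (fun t => _) = (fun=> 0)); [exact: cmeas_cst|apply/funext => t;
    rewrite horner0].
rewrite (_ : (fun t => _) = (fun t => q.[h t] * h t + c)).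
  by apply: cmeasD (cmeas_cst _); exact: cmeasM.
by apply/funext => t; rewrite hornerMXaddC.
Qed.

Lemma cmeas_horner2 (q : {poly {poly C}}) g h : cmeas g -> cmeas h ->
  cmeas (fun t => q.[g t, h t]).
Proof.
move=> mg mh; elim/poly_ind: q => [|q c IH].
  by rewrite (_ : (fun t => _) = (fun=> 0)); [exact: cmeas_cst|apply/funext => t;
    rewrite !horner0].
rewrite (_ : (fun t => _) = (fun t => q.[g t, h t] * g t + c.[h t])).
  by apply: cmeasD; [exact: cmeasM|exact: cmeas_horner].
by apply/funext => t; rewrite hornerMXaddC !hornerE.
Qed.

Lemma cmeas_expi (k : R * R -> R) : measurable_fun [set: R * R] k ->
  cmeas (fun t => expi (k t)).
Proof.
move=> mk; split => /=.
  by apply: (measurableT_comp _ mk); apply: continuous_measurable_fun;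
    exact: continuous_cos.
by apply: (measurableT_comp _ mk); apply: continuous_measurable_fun;
  exact: continuous_sin.
Qed.

Definition torus_zeros (q : {poly {poly C}}) : set (R * R) :=
  [set t | (`[0, 2 * pi] `*` `[0, 2 * pi]) t /\
    q.[expi t.1 + expi t.2, expi t.1 * expi t.2] = 0].

Lemma torus_zeros_measurable q : measurable (torus_zeros q).
Proof.
pose h (t : R * R) : C := q.[expi t.1 + expi t.2, expi t.1 * expi t.2].
have [hr hi] : cmeas h.
  have m1 : cmeas (fun t : R * R => expi t.1) by apply: cmeas_expi;
    exact: measurable_fst.
  have m2 : cmeas (fun t : R * R => expi t.2) by apply: cmeas_expi;
    exact: measurable_snd.
  by apply: cmeas_horner2; [exact: cmeasD|exact: cmeasM].
have -> : torus_zeros q = (`[0, 2 * pi] `*` `[0, 2 * pi]) `&`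
    ((fun t => Re (h t)) @^-1` [set 0] `&` (fun t => Im (h t)) @^-1` [set 0]).
  apply/seteqP; split=> t [t02].
    by rewrite -/(h t) => ht; split=> //; split; rewrite /= ht.
  by move=> [hr0 hi0]; split=> //; exact: eq_ReIm.
apply: measurableI; first by apply: measurableX; exact: measurable_itv.
apply: measurableI.
  by have := hr measurableT _ (measurable_set1 0); rewrite setTI.
by have := hi measurableT _ (measurable_set1 0); rewrite setTI.
Qed.

(** Fubini with countable slices: for fixed [z] the polynomial [w |-> q(z + w, z w)] takes the value
    [q(z, 0)] at [w = 0], so it is nonzero unless [q(z, 0) = 0]. The exceptional angles are
    themselves countable, as [z |-> q(z, 0)] is nonzero at 0. *)
Lemma torus_zeros_null q : q.[0, 0] != 0 -> (mu \x mu)%E (torus_zeros q) = 0%E.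
Proof.
move=> q00; rewrite /product_measure1.
have [p0 p0E] := horner2_0r q.
have p00 : p0 != 0.
  by apply: contraNneq q00 => p0z; rewrite -p0E p0z horner0.
pose N0 := [set t : R | 0 <= t <= 2 * pi /\ p0.[expi t] = 0].
have cN0 : countable N0 by exact: poly_zeros_countable.
rewrite (@ae_eq_integral _ _ _ mu setT (cst 0%E)) ?integral_cst ?mul0e //.
- exact: (@measurable_fun_xsection _ _ _ _ R (@lebesgue_measure R) _
  (torus_zeros_measurable q)).
- exists N0; split.
  + exact: countable_measurable.
  + exact: countable_lebesgue_measure0.
  move=> t /= nt; apply: contrapT => tN0; apply: nt => _.
  have [t02|nt02] := pselect (0 <= t <= 2 * pi); last first.
    rewrite (_ : xsection _ _ = set0) ?measure0 //.
    apply/seteqP; split=> // u; rewrite /xsection /= inE => -[[/= + _] _].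
    by rewrite in_itv.
  apply: countable_lebesgue_measure0.
  have [p pE] := symmetrized_poly q (expi t).
  have p_neq0 : p != 0.
    apply/eqP => pz; apply: tN0; split=> //.
    by rewrite p0E -[expi t]addr0 -{2}(mulr0 (expi t)) -pE pz horner0.
  apply: sub_countable (poly_zeros_countable p_neq0); apply: subset_card_le.
  move=> u; rewrite /xsection /= inE => -[[/= _ +] qu].
  by rewrite in_itv /= => u02; split=> //; rewrite pE.
Qed.

End NullSet.

(** * Rational inner interpolants *)

Lemma rational_inner_interpolant (R : realType) (N : nat)
    (lam : 'I_N -> cplx2 R) (w : 'I_N -> cplx R) (j0 : 'I_N) :
  (forall j, symm_bidisk (lam j)) -> (forall j, disk (w j)) -> solvable lam w ->
  exists f : cplx2 R -> cplx R,
    [/\ interpolant lam w f, rational_on (@symm_bidisk R) f & unimodular_ae f].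
Proof.
move=> lamG wD [f0 [f0a f0D f0w]].
have zP j : exists z : cplx2 R,
  (normc z.1 < 1 /\ normc z.2 < 1) /\ symmetrize z = lam j.
  by have [z [/diskE ? /diskE ?] ?] := lamG j; exists z.
have [z zs] := fin_all_exists zP.
have norm1 (t : R[i]) : normc t < 1 -> `|t| < 1.
  by move=> t1; rewrite normcE (_ : 1 = 1%:C) // ltcR.
have [m [tau [U [tauU UU nodes]]]] := realization f0a f0D
  (z := fun j => (z j).1) (w := fun j => (z j).2) (fun j => (zs j).1.1) (fun j =>
    (zs j).1.2).
pose p := num2 tau U; pose q := den2 tau U.
pose f (x : cplx2 R) : cplx R := p.[x.1, x.2] / q.[x.1, x.2].
have q_neq0 (a b : R[i]) : normc a < 1 -> normc b < 1 -> q.[a + b, a * b] != 0.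
  move=> a1 b1; rewrite eval2_den -unitfE -unitmxE.
  by apply: pencil_unit => //; exact: norm1.
have fE (a b : R[i]) g : q.[a + b,
  a * b] != 0 -> g *m pencil tau U (a + b) (a * b) = ursubmx U ->
    f (symmetrize (a, b)) = transfer tau U (a + b) (a * b) g.
  by move=> q0 gE; rewrite (eval2_num q0 gE).
have f_node j : f (lam j) = w j.
  have [g gE gw] := nodes j; have [[a1 b1] e] := zs j.
  rewrite -e [z j]surjective_pairing (fE _ _ g (q_neq0 _ _ a1 b1) gE) gw.
  by rewrite -f0w -e.
have f_torus (a b : R[i]) : normc a = 1 -> normc b = 1 -> q.[a + b, a * b] != 0 ->
    `|f (symmetrize (a, b))| = 1.
  move=> a1 b1 q0; have [g gE] := pencil_solve q0.
  rewrite (fE _ _ g q0 gE).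
  by apply: (transfer_torus tauU UU _ _ gE); rewrite normcE ?a1 ?b1.
exists f; split; first split=> //.
- move=> _ [[a b] [/diskE a1 /diskE b1] <-]; apply: ratio_diff; exact: q_neq0.
- move=> _ [[a b] [/diskE a1 /diskE b1] <-].
  have q0 := q_neq0 _ _ a1 b1; have [g gE] := pencil_solve q0.
  have [le1 eq1] := transfer_le1 tauU UU (norm1 _ a1) (norm1 _ b1) gE.
  rewrite /disk /= (fE _ _ g q0 gE) lt_neqAle le1 andbT; apply/eqP => f1.
  (* With [B = 0] the state at the node [j0] vanishes too, so [w j0] is the same constant of modulus
     1, against [wD]. *)
  have B0 : ursubmx U = 0 by rewrite -gE (eq1 f1) mul0mx.
  have [g' g'E] := nodes j0; have [[a1' b1'] e] := zs j0.
  rewrite B0 in g'E.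
  rewrite (pencil_inj tauU UU (norm1 _ a1') (norm1 _ b1') g'E) => fw.
  have := wD j0; rewrite /disk /= -f0w -e -[f0 _]fw.
  by have := f1; rewrite /transfer (eq1 f1) !mul0mx => ->; rewrite ltxx.
- exists p, q => _ [[a b] [/diskE a1 /diskE b1] <-]; split=> //.
  exact: q_neq0.
- exists (torus_zeros q); split.
  + exact: torus_zeros_measurable.
  + by apply: torus_zeros_null; exact: den2_00.
  move=> t /= /not_implyP[t02 nl]; split=> //; apply: contrapT => /eqP q0;
    apply: nl.
  set b := symmetrize _; exists (f b).
    by apply: radial_path_cvg; apply: differentiable_continuous; exact: ratio_diff.
  exact: (f_torus (expi t.1) (expi t.2) (normc_expi _) (normc_expi _) q0).
Qed.

Theorem theorem1p2 (R : realType) (N : nat)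
    (lam : 'I_N -> cplx2 R) (w : 'I_N -> cplx R)
    (lam_distinct : injective lam)
    (lam_in_G : forall j, symm_bidisk (lam j))
    (w_in_D : forall j, disk (w j))
    (lam_w_solvable : solvable lam w) :
  exists f : cplx2 R -> cplx R,
    [/\ interpolant lam w f,
        rational_on (@symm_bidisk R) f &
        unimodular_ae f].
Proof.
case: N => [|N] in lam w lam_distinct lam_in_G w_in_D lam_w_solvable *; last first.
  exact: (rational_inner_interpolant ord0).
(* Without nodes a unimodular constant would not be excluded. *)
have disk0 : disk (0 : cplx R) by apply/diskE; rewrite normc0 ltr01.
have [|||f [[fa fD _] fr fu]] := @rational_inner_interpolant R 1 (fun=> (0, 0)) (fun=> 0) ord0.
- by move=> _; exists (0, 0); rewrite /symmetrize /= ?addr0 ?mulr0.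
- by [].
- exists (cst 0); split=> // x _; exact: differentiable_cst.
by exists f; split=> //; split=> // -[].
Qed.
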